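(* Given a dynamic flow network $\mathcal{N}$ whose edge capacities are uniform, with $n$ nodes, $m$ edges, $k$ sources and a single sink of in-degree $d$, and a supply/demand function $w$, the minimum feasible time horizon $T^*$ with respect to $(\mathcal{N},w)$ can be computed in $O(nmdk^d)$ time.
   Context: A dynamic flow network $\mathcal{N}=(D=(V,E),u,\tau,S^+,\{s^-\})$ consists of a directed graph $D=(V,E)$ with $n=|V|$, $m=|E|$, a capacity $u>0$ common to all edges, transit times $\tau:E\to\mathbb{R}_{>0}$, sources $S^+\subseteq V$ with $k=|S^+|$, and a single sink $s^-\in V\setminus S^+$ with $d$ edges entering it. A supply/demand function is $w:V\to\mathbb{R}$ with $w(v)>0$ for $v\in S^+$, $w(s^-)<0$, $w(v)=0$ otherwise, and $\sum_v w(v)=0$. A dynamic flow $f:E\times[0,\infty)\to\mathbb{R}_{\ge0}$ gives the rate $f(e,\theta)$ at which flow enters edge $e$ at time $\theta$; it arrives at the head of $e$ at time $\theta+\tau(e)$. It is feasible w.r.t. $(w,T)$ if $0\le f(e,\theta)\le u$ for all $e,\theta$; for every $v$ and every $\theta\ge0$, (flow leaving $v$ during $[0,\theta]$) minus (flow arriving at $v$ during $[0,\theta]$) is at most $\max\{w(v),0\}$; and for every $v$, this difference over $[0,T]$ equals $w(v)$. The minimum feasible time horizon $T^*$ is the minimum $T$ for which a feasible dynamic flow w.r.t. $(w,T)$ exists. *)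

(* Defs.v *)
(* Built on MathComp and MathComp-Analysis. *)
From HB Require Import structures.
From mathcomp Require Import all_boot all_order all_algebra.
From mathcomp Require Import all_classical all_reals all_analysis.

Set Implicit Arguments.
Unset Strict Implicit.
Unset Printing Implicit Defensive.

Import Order.TTheory GRing.Theory Num.Theory.
Local Open Scope classical_set_scope.
Local Open Scope ring_scope.

(** * Dynamic flow networks with uniform edge capacity and a single sink *)

(* The nodes are 'I_n and the edges 'I_m; parallel edges and loops are not
   excluded. *)
Record network (R : realType) (n m : nat) := Network {
  etail : 'I_m -> 'I_n;
  ehead : 'I_m -> 'I_n;
  capacity : R;
  transit : 'I_m -> R;
  sources : {set 'I_n};
  sink : 'I_n;
  capacity_gt0 : 0 < capacity;
  transit_gt0 : forall e, 0 < transit e;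
  sink_notin_sources : sink \notin sources
}.

Definition nb_sources (R : realType) (n m : nat) (N : network R n m) : nat :=
  #|sources N|.

Definition sink_indegree (R : realType) (n m : nat) (N : network R n m) : nat :=
  #|[set e | ehead N e == sink N]|.

Definition supply_demand (R : realType) (n m : nat) (N : network R n m)
    (w : 'I_n -> R) : Prop :=
  [/\ forall v, v \in sources N -> 0 < w v,
      w (sink N) < 0,
      forall v, v \notin sources N -> v != sink N -> w v = 0
    & \sum_v w v = 0].

Definition flow_leaving (R : realType) (n m : nat) (N : network R n m)
    (f : 'I_m -> R -> R) (v : 'I_n) (theta : R) : R :=
  \sum_(e | etail N e == v)
    \int[lebesgue_measure]_(t in `[0, theta]) f e t.

(* Flow entering e at time t reaches the head of e at time t + transit e, which
   is at most theta iff t <= theta - transit e; the interval is empty when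
   theta < transit e. *)
Definition flow_arriving (R : realType) (n m : nat) (N : network R n m)
    (f : 'I_m -> R -> R) (v : 'I_n) (theta : R) : R :=
  \sum_(e | ehead N e == v)
    \int[lebesgue_measure]_(t in `[0, theta - transit N e]) f e t.

(* Only the restriction of f e to [0, +oo[ matters. *)
Definition feasible_flow (R : realType) (n m : nat) (N : network R n m)
    (w : 'I_n -> R) (T : R) (f : 'I_m -> R -> R) : Prop :=
  [/\ forall e, measurable_fun (`[0, +oo[ : set R) (f e),
      forall e theta, 0 <= theta -> 0 <= f e theta <= capacity N,
      forall v theta, 0 <= theta ->
        flow_leaving N f v theta - flow_arriving N f v theta
          <= Num.max (w v) 0
    & forall v, flow_leaving N f v T - flow_arriving N f v T = w v].

Definition feasible_horizon (R : realType) (n m : nat) (N : network R n m)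
    (w : 'I_n -> R) (T : R) : Prop :=
  0 <= T /\ exists f, feasible_flow N w T f.

Definition min_feasible_horizon (R : realType) (n m : nat) (N : network R n m)
    (w : 'I_n -> R) (T : R) : Prop :=
  feasible_horizon N w T /\ forall T', feasible_horizon N w T' -> T <= T'.

(** * The real RAM *)

(* A uniform-cost random access machine with integer and real memory, given by
   structured programs.  The memory is organised in arrays: [IGet a i] and
   [RGet a i] read cell [i] of the integer, resp. real, array number [a].
   Array numbers are literals of the program, cell indices are computed.
   Integers support only addition and truncated subtraction (so that long
   integers cannot be built by repeated squaring), reals the exact field
   operations and comparisons; there is no rounding and no conversion between
   the two sorts. *)
Inductive iexpr : Type :=
| ICst of nat
| IGet of nat & iexpr
| IAdd of iexpr & iexpr
| ISub of iexpr & iexpr.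

Inductive rexpr : Type :=
| RCst of nat
| RGet of nat & iexpr
| RAdd of rexpr & rexpr
| RSub of rexpr & rexpr
| RMul of rexpr & rexpr
| RDiv of rexpr & rexpr.

Inductive test : Type :=
| ILe of iexpr & iexpr
| RLe of rexpr & rexpr
| TNot of test
| TAnd of test & test.

Inductive program : Type :=
| Skip
| ISet of nat & iexpr & iexpr
| RSet of nat & iexpr & rexpr
| Seq of program & program
| Cond of test & program & program
| While of test & program.

(* Every node of an evaluated expression is one elementary operation. *)
Fixpoint icost (x : iexpr) : nat :=
  match x with
  | ICst _ => 1
  | IGet _ i => (icost i).+1
  | IAdd x1 x2 | ISub x1 x2 => (icost x1 + icost x2).+1
  end.

Fixpoint rcost (x : rexpr) : nat :=
  match x with
  | RCst _ => 1
  | RGet _ i => (icost i).+1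
  | RAdd x1 x2 | RSub x1 x2 | RMul x1 x2 | RDiv x1 x2 =>
      (rcost x1 + rcost x2).+1
  end.

Fixpoint tcost (b : test) : nat :=
  match b with
  | ILe x1 x2 => (icost x1 + icost x2).+1
  | RLe x1 x2 => (rcost x1 + rcost x2).+1
  | TNot b1 => (tcost b1).+1
  | TAnd b1 b2 => (tcost b1 + tcost b2).+1
  end.

Record state (R : realType) := State {
  imem : nat -> nat -> nat;
  rmem : nat -> nat -> R
}.

Fixpoint ieval (R : realType) (s : state R) (x : iexpr) : nat :=
  match x with
  | ICst c => c
  | IGet a i => imem s a (ieval s i)
  | IAdd x1 x2 => (ieval s x1 + ieval s x2)%N
  | ISub x1 x2 => (ieval s x1 - ieval s x2)%N
  end.

Fixpoint reval (R : realType) (s : state R) (x : rexpr) : R :=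
  match x with
  | RCst c => c%:R
  | RGet a i => rmem s a (ieval s i)
  | RAdd x1 x2 => reval s x1 + reval s x2
  | RSub x1 x2 => reval s x1 - reval s x2
  | RMul x1 x2 => reval s x1 * reval s x2
  | RDiv x1 x2 => reval s x1 / reval s x2
  end.

Fixpoint teval (R : realType) (s : state R) (b : test) : bool :=
  match b with
  | ILe x1 x2 => (ieval s x1 <= ieval s x2)%N
  | RLe x1 x2 => reval s x1 <= reval s x2
  | TNot b1 => ~~ teval s b1
  | TAnd b1 b2 => teval s b1 && teval s b2
  end.

Definition upd (A : Type) (mem : nat -> nat -> A) (a i : nat) (x : A)
    : nat -> nat -> A :=
  fun b j => if (b == a) && (j == i) then x else mem b j.

(* [exec s p t s']: started in [s], the program [p] halts in [s'] after exactly
   [t] elementary operations. *)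
Inductive exec (R : realType) : state R -> program -> nat -> state R -> Prop :=
| exec_skip s : exec s Skip 1 s
| exec_iset s a i x :
    exec s (ISet a i x) (icost i + icost x).+1
      (State (upd (imem s) a (ieval s i) (ieval s x)) (rmem s))
| exec_rset s a i x :
    exec s (RSet a i x) (icost i + rcost x).+1
      (State (imem s) (upd (rmem s) a (ieval s i) (reval s x)))
| exec_seq s1 s2 s3 p1 p2 t1 t2 :
    exec s1 p1 t1 s2 -> exec s2 p2 t2 s3 ->
    exec s1 (Seq p1 p2) (t1 + t2) s3
| exec_cond_true s s' b p1 p2 t :
    teval s b -> exec s p1 t s' ->
    exec s (Cond b p1 p2) ((tcost b).+1 + t) s'
| exec_cond_false s s' b p1 p2 t :
    ~~ teval s b -> exec s p2 t s' ->
    exec s (Cond b p1 p2) ((tcost b).+1 + t) s'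
| exec_while_true s1 s2 s3 b p t1 t2 :
    teval s1 b -> exec s1 p t1 s2 -> exec s2 (While b p) t2 s3 ->
    exec s1 (While b p) ((tcost b).+1 + t1 + t2) s3
| exec_while_false s b p :
    ~~ teval s b -> exec s (While b p) (tcost b).+1 s.

(** * Input and output conventions *)

Definition of_ord (A : Type) (x0 : A) (n : nat) (g : 'I_n -> A) (i : nat) : A :=
  oapp g x0 (insub i).

(* Integer arrays: 0 holds n, m and the sink; 1 and 2 the tails and heads of the
   edges; 3 the indicator of the sources.  Real arrays: 0 holds the capacity in
   cell 0; 1 the transit times; 2 the supplies.  All other cells are 0. *)
Definition input_state (R : realType) (n m : nat) (N : network R n m)
    (w : 'I_n -> R) : state R :=
  State
    (fun a i =>
       match a with
       | 0 => nth 0%N [:: n; m; nat_of_ord (sink N)] i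
       | 1 => of_ord 0%N (fun e => nat_of_ord (etail N e)) i
       | 2 => of_ord 0%N (fun e => nat_of_ord (ehead N e)) i
       | 3 => of_ord 0%N (fun v => nat_of_bool (v \in sources N)) i
       | _ => 0%N
       end)
    (fun a i =>
       match a with
       | 0 => nth 0 [:: capacity N] i
       | 1 => of_ord 0 (transit N) i
       | 2 => of_ord 0 w i
       | _ => 0
       end).

(* The result is read from cell 0 of real array 3. *)
Definition output (R : realType) (s : state R) : R := rmem s 3 0.

(* Main.v *)
Require Import Defs.
From HB Require Import structures.
From mathcomp Require Import all_boot all_order all_algebra.
From mathcomp Require Import all_classical all_reals all_analysis.
From mathcomp Require Import measurable_realfun ring lra zify.

(** A horizon [T] is feasible iff every cut over time is large enough: for all
   [beta] vanishing at the sink, the supply of the sources with [beta >= T] is at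
   most [u * \sum_e max(0, beta (tail e) - beta (head e) - tau e)].  Necessity is
   weak duality for the cumulated flows.  For sufficiency, the time-expanded
   networks with cells of length [T / K] have feasible flows by Gale's theorem
   (their cuts are cuts over time, with transit times rounded down); an ultrafilter
   limit of their cumulated flows is Lipschitz, and its Radon-Nikodym density is
   the dynamic flow.

   With uniform capacities, a cut violated by a set [A] of sources is certified by
   an optimal static 0/1 flow [x] out of [A], which has at most [d] units, hence at
   most [d] sources counted with multiplicity.  So it suffices to run, for each of
   the [k ^ d] tuples of sources, [d] shortest-path augmentations, and to read off
   lower bounds on the horizon from the residual distances of each intermediate
   flow: its potentials (distances to the sink and to the sources in use) define
   cuts over time which are tight at an optimal [x].  Shortest paths are computed
   with [n + 1] scans of all edges (Dijkstra with potentials), in time [O(nm)]. *)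

(** The horizon is unknown while tuples are enumerated, so no stage can optimise for it. What frees
    the search from both the horizon and the violating set is that an optimal static flow for them
    has least cost among the 0/1 flows with the same supplies, and successive shortest paths find
    such a flow from the supplies alone. Soundness and completeness are then separate: the bounds of
    every stage, whatever its tuple, come from genuine cuts over time and are valid; and if the
    largest bound [b] were infeasible, the tuple attached to a cut violated at [b] would have
    produced a bound above [b]. Two distances are needed because an optimal flow must resist two
    kinds of exchange: adding a unit (distance to the sink) and trading or cancelling one (distance
    to the sources in use). Ties are broken by flow value, which gives the strict inequality needed
    in the last argument. A tuple costs [d + 1] stages; weighing the candidates of a stage takes
    [O(nk)], which is within [O(nm)] because in a feasible instance every source has an outgoing
    edge, so that [k <= m]. *)

Set Implicit Arguments.
Unset Strict Implicit.
Unset Printing Implicit Defensive.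

Import Order.TTheory GRing.Theory Num.Theory.
Import numFieldNormedType.Exports.
Local Open Scope ring_scope.

(** * The theorem of Gale on transshipments *)

Section gale.
Variables (R : realFieldType) (V A : finType) (tl hd : A -> V) (c : A -> R).
Hypothesis c0 : forall a, 0 <= c a.

Definition out_capacity (P : {set A}) (X : {set V}) : R :=
  \sum_(a in P | (tl a \in X) && (hd a \notin X)) c a.

Lemma out_capacity_submod (P : {set A}) (X Y : {set V}) :
  out_capacity P (X :&: Y) + out_capacity P (X :|: Y)
    <= out_capacity P X + out_capacity P Y.
Proof.
rewrite /out_capacity ![\sum_(a in P | _) c a]big_mkcondr -!big_split/=.
apply: ler_sum => a _; rewrite !inE.
by have := c0 a; case: (tl a \in X); case: (hd a \in X); case: (tl a \in Y);
  case: (hd a \in Y) => /=; lra.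
Qed.

Lemma out_capacityD1 (P : {set A}) a X : a \in P ->
  out_capacity P X = (if (tl a \in X) && (hd a \notin X) then c a else 0)
                     + out_capacity (P :\ a) X.
Proof.
by move=> aP; rewrite /out_capacity big_mkcondr (big_setD1 a aP)/= -big_mkcondr.
Qed.

(** Arcs are eliminated one at a time. The value of [a] is the least nonnegative one that leaves
    every cut crossed outwards by [a] sufficient in the other arcs; the supplies of its two ends are
    then corrected by that amount. *)
Lemma gale_subset (P : {set A}) (b : V -> R) :
  \sum_v b v = 0 ->
  (forall X : {set V}, \sum_(v in X) b v <= out_capacity P X) ->
  exists f : A -> R, (forall a, 0 <= f a <= c a) /\
    forall v, \sum_(a in P | tl a == v) f a - \sum_(a in P | hd a == v) f a = b v.
Proof.
elim: {P}#|P| {-2}P (erefl #|P|) b => [|k IHk] P Pk b b0 bX.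
  exists (fun=> 0); split=> [a|v]; first by rewrite lexx c0.
  have P0 : P = finset.set0 by apply/eqP; rewrite -cards_eq0 Pk.
  rewrite !big1// subrr; apply/eqP; rewrite eq_le.
  have outP X : out_capacity P X = 0.
    by rewrite /out_capacity big_pred0// => a; rewrite P0 inE.
  (* Without arcs, the conditions at [v] alone and at its complement force [b v = 0]. *)
  have h1 := bX [set v]%SET; rewrite outP big_set1 in h1; rewrite h1 andbT.
  have := bX (~: [set v])%SET; rewrite outP.
  move: b0; rewrite (bigD1 v)//=.
  rewrite (eq_bigl (mem (~: [set v])%SET)) /=; first lra.
  by move=> u; rewrite !inE.
have [a aP] : exists a, a \in P by apply/card_gt0P; rewrite Pk.
set x := tl a; set y := hd a; pose P' := P :\ a.
have P'k : #|P'| = k by have := cardsD1 a P; rewrite aP Pk add1n => -[].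
pose bs (X : {set V}) := \sum_(v in X) b v.
pose la := \big[Num.max/0]_(X : {set V} | (x \in X) && (y \notin X))
   (bs X - out_capacity P' X).
have la0 : 0 <= la by exact: bigmax_ge_id.
have laX (X : {set V}) : x \in X -> y \notin X -> bs X - out_capacity P' X <= la.
  by move=> h1 h2; apply: (@le_bigmax_cond _ _ _ _ X); rewrite h1.
have bsP X : bs X <= (if (x \in X) && (y \notin X) then c a else 0) + out_capacity P' X.
  by rewrite -out_capacityD1//; exact: bX.
have lac : la <= c a.
  apply: bigmax_le => // X xyX; have := bsP X; rewrite xyX; lra.
(* Uncrossing: [a] leaves neither [X :&: Y] nor [X :|: Y], so both satisfy the cut condition without
   [a], and submodularity separates the lower bounds on the value of [a] from the upper ones. *)
have laY (Y : {set V}) : x \notin Y -> y \in Y -> la <= out_capacity P' Y - bs Y.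
  move=> xY yY; apply: bigmax_le => [|X /andP[xX yX]].
    by have := bsP Y; rewrite (negbTE xY)/=; lra.
  have := out_capacity_submod P' X Y.
  have := bsP (X :&: Y); have := bsP (X :|: Y); rewrite !inE yY (negbTE xY) !(andbF,
    orbT, andbT)/=.
  have : bs (X :|: Y) + bs (X :&: Y) = bs X + bs Y.
    rewrite /bs ![\sum_(v in _) b v]big_mkcond -!big_split/=; apply: eq_bigr => v _.
    by rewrite !inE; case: (v \in X); case: (v \in Y); rewrite /= ?addr0 ?add0r.
  lra.
pose b' v := b v - (if v == x then la else 0) + (if v == y then la else 0).
have delta (X : {set V}) z : \sum_(v in X) (if v == z then la else 0) = if z \in X then
  la else 0.
  rewrite -big_mkcondr/=; case: ifP => zX.
    by rewrite (big_pred1 z)// => v /=; case: eqP => [->|]; rewrite ?zX ?andbF.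
  by rewrite big_pred0// => v; case: eqP => [->|]; rewrite ?zX ?andbF.
have b'X (X : {set V}) : \sum_(v in X) b' v =
    bs X - (if x \in X then la else 0) + (if y \in X then la else 0).
  by rewrite /b' big_split sumrB !delta.
have [||f [fc fb]] := IHk P' P'k b'.
- have -> : \sum_v b' v = \sum_(v in [set: V]%SET) b' v.
    by apply: eq_bigl => v; rewrite inE.
  rewrite b'X !inE addrNK /bs -[RHS]b0.
  by apply: eq_bigl => v; rewrite inE.
- move=> X; rewrite b'X.
  have := bsP X; have := laX X; have := laY X.
  case: (boolP (x \in X)) => xX; case: (boolP (y \in X)) => yX /=.
  + by lra.
  + by move=> _ /(_ isT isT); lra.
  + by move=> /(_ isT isT); lra.
  + by lra.
exists (fun i => if i == a then la else f i); split.
  by move=> i; case: eqP => [->|_]; rewrite ?la0 ?fc.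
have part (h : A -> V) v : \sum_(i in P | h i == v) (if i == a then la else f i)
    = (if v == h a then la else 0) + \sum_(i in P' | h i == v) f i.
  rewrite big_mkcondr (big_setD1 a aP)/= eqxx eq_sym -big_mkcondr/=; congr (_ + _).
  by apply: eq_bigr => i; rewrite !inE; case: eqP.
move=> v; rewrite !part; have := fb v; rewrite /b' -/x -/y; lra.
Qed.

Lemma gale (b : V -> R) : \sum_v b v = 0 ->
  (forall X : {set V}, \sum_(v in X) b v <=
     \sum_(a | (tl a \in X) && (hd a \notin X)) c a) ->
  exists f : A -> R, (forall a, 0 <= f a <= c a) /\
    forall v, \sum_(a | tl a == v) f a - \sum_(a | hd a == v) f a = b v.
Proof.
move=> b0 bX; have [|f [fc fb]] := @gale_subset [set: A]%SET b b0.
  move=> X; apply: le_trans (bX X) _; rewrite /out_capacity.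
  by rewrite [leRHS](eq_bigl (fun a => (tl a \in X) && (hd a \notin X)))// => a; rewrite inE.
exists f; split=> // v; rewrite -fb; congr (_ - _).
  by apply: eq_bigl => a; rewrite inE.
by apply: eq_bigl => a; rewrite inE.
Qed.

End gale.

(** * Cuts over time *)

Section cuts.
Variables (R : realType) (n m : nat) (N : network R n m).

(** [v] belongs to the cut from time [T - beta v] on, and the positive part is the length of the
    time window in which flow can enter [e] inside the cut and reach its head while that is still
    outside. The sink joins only at the horizon; the vertices with [T <= beta v] are present from
    time 0. *)
Definition cut_value (beta : 'I_n -> R) : R :=
  \sum_e Num.max 0 (beta (etail N e) - beta (ehead N e) - transit N e).

Definition cut_condition (w : 'I_n -> R) (T : R) : Prop :=
  forall beta, beta (sink N) = 0 ->
    \sum_(v in sources N | T <= beta v) w v <= capacity N * cut_value beta.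

Lemma supply_ge0 (w : 'I_n -> R) v : supply_demand N w -> v != sink N -> 0 <= w v.
Proof.
move=> [w1 _ w3 _] vs; have [/w1 /ltW//|vS] := boolP (v \in sources N).
by rewrite w3.
Qed.

Lemma sum_fiber (I J : finType) (V : zmodType) (h : I -> J) (G : I -> J -> V) :
  \sum_j \sum_(i | h i == j) G i j = \sum_i G i (h i).
Proof.
rewrite (exchange_big_dep xpredT)//=; apply: eq_bigr => i _.
by rewrite (big_pred1 (h i))// => j; rewrite eq_sym.
Qed.

End cuts.

(** Lowering [beta] by [T' - T] turns a cut for [T'] into one for [T]. Clipping at 0 restores the
    value at the sink and, as transit times are positive, does not raise the value of the cut. *)
Lemma cut_condition_mono (R : realType) (n m : nat) (N : network R n m) w T T' :
  supply_demand N w -> 0 <= T <= T' -> cut_condition N w T -> cut_condition N w T'.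
Proof.
move=> sd /andP[T0 TT] cT beta bs.
pose b' v := Num.max 0 (beta v - (T' - T)).
have b's : b' (sink N) = 0 by rewrite /b' bs; apply/max_idPl; lra.
apply: le_trans (le_trans (cT b' b's) _).
  rewrite big_mkcond [leRHS]big_mkcond/=; apply: ler_sum => v _.
  have [vS|] //= := boolP (v \in sources N).
  have w0 : 0 <= w v by case: sd => /(_ _ vS)/ltW.
  have [h|h] := leP T' (beta v); last by case: ifP.
  by rewrite ifT// /b' le_max; apply/orP; right; lra.
rewrite ler_wpM2l ?(ltW (capacity_gt0 N))//; apply: ler_sum => e _.
have := transit_gt0 N e; rewrite /b' => t0.
by case: (leP 0 (beta (etail N e) - (T' - T))) => h1;
   case: (leP 0 (beta (ehead N e) - (T' - T))) => h2; rewrite ge_max !le_max lexx/=;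
   case: (leP 0 (beta (etail N e) - beta (ehead N e) - transit N e)) => h3;
   apply/orP; (left; lra) || (right; lra).
Qed.

(** * Time-expanded networks *)

(** The case [k = K.+1] is the empty set, that is, a vertex which never joins the cut. *)
Lemma upward_closed_index (K : nat) (P : pred 'I_K.+1) :
  (forall i : 'I_K.+1, P i -> (i.+1 < K.+1)%N -> P (inord i.+1)) ->
  exists2 k : nat, (k <= K.+1)%N & forall i : 'I_K.+1, P i = (k <= i)%N.
Proof.
move=> up; have ex : exists k, (k == K.+1) || ((k < K.+1)%N && P (inord k)).
  by exists K.+1; rewrite eqxx.
have [k Pk kmin] := ex_minnP ex.
exists k; first by apply: kmin; rewrite eqxx.
move=> i; apply/idP/idP => [Pi|ki].
  by apply: kmin; rewrite ltn_ord inord_val Pi orbT.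
move: Pk; have kK : (k < K.+1)%N by exact: leq_ltn_trans ki (ltn_ord i).
rewrite kK ltn_eqF//= => Pk.
suff H j : (k + j < K.+1)%N -> P (inord (k + j)).
  by have := H (i - k)%N; rewrite subnKC// inord_val => ->.
elim: j => [|j IHj]; first by rewrite addn0.
rewrite addnS => kj; have kj' := ltnW kj.
by have := up _ (IHj kj'); rewrite inordK// => ->.
Qed.

Section time_expanded.
Variables (R : realType) (n m : nat) (N : network R n m) (w : 'I_n -> R) (T : R).
Hypotheses (sd : supply_demand N w) (T0 : 0 < T) (cc : cut_condition N w T).
Variable K : nat.
Let dl : R := T / K.+1%:R.
(** Rounding down can only enlarge discrete cuts, so the cut condition carries over without loss. In
    exchange the flow may arrive too early, by less than one cell, an error that vanishes in the
    limit. *)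
Let q e : nat := Num.truncn (transit N e / dl).
Let u := capacity N.

Let dl0 : 0 < dl. Proof. by rewrite divr_gt0. Qed.
Let u0 : 0 < u. Proof. exact: capacity_gt0. Qed.
Let TE : K.+1%:R * dl = T.
Proof. by rewrite /dl mulrC divfK. Qed.
Let qle e : (q e)%:R * dl <= transit N e.
Proof.
by rewrite -ler_pdivlMr// truncn_le divr_ge0// ltW// transit_gt0.
Qed.

Let node := ('I_n * 'I_K.+1)%type.
Let arc := (('I_m * 'I_K.+1) + ('I_n * 'I_K.+1))%type.
Let tl (a : arc) : node :=
  match a with inl (e, i) => (etail N e, i) | inr (v, i) => (v, i) end.
Let hd (a : arc) : node :=
  match a with
  | inl (e, i) => (ehead N e, inord (i + q e))
  | inr (v, i) => (v, inord i.+1) end.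
Let W := \sum_(v | v != sink N) w v.
(** Waiting at a vertex is limited only by the total supply [W], which is as good as infinite. Arcs
    beyond the last cell are sent back to cell 0 by [inord]; capacity 0 removes them. *)
Let c (a : arc) : R :=
  match a with
  | inl (e, i) => if (i + q e < K.+1)%N then u * dl else 0
  | inr (v, i) => if (i.+1 < K.+1)%N then W else 0 end.
Let b (x : node) : R :=
  if x.1 == sink N then (if x.2 == ord_max then w x.1 else 0)
  else if x.2 == ord0 then w x.1 else 0.

Let W0 : 0 <= W.
Proof. by apply: sumr_ge0 => v; exact: supply_ge0. Qed.

Let wsink : w (sink N) = - W.
Proof. by case: sd => _ _ _; rewrite (bigD1 (sink N))//= -/W; lra. Qed.

Let c0 a : 0 <= c a.
Proof.
case: a => [[e i]|[v i]] /=; case: ifP => // _.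
by rewrite mulr_ge0// ltW.
Qed.

Let bX (X : {set node}) : \sum_(x in X) b x =
  (if (sink N, ord_max) \in X then - W else 0)
  + \sum_(v | (v != sink N) && ((v, ord0) \in X)) w v.
Proof.
rewrite big_mkcond (eq_bigr (fun x => if (x.1, x.2) \in X then b (x.1, x.2) else 0));
  last first.
  by case.
rewrite -(pair_bigA _ (fun v i => if (v, i) \in X then b (v, i) else 0))/=.
rewrite (bigD1 (sink N))//=; congr (_ + _).
  rewrite (bigD1 ord_max)//= big1 ?addr0 /b/= ?eqxx ?wsink// => i /negbTE ->.
  by case: ifP.
rewrite big_mkcondr; apply: eq_bigr => v vs.
rewrite (bigD1 ord0)//= big1 ?addr0 /b/= ?(negbTE vs) ?eqxx// => i /negbTE ->.
by case: ifP.
Qed.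

Let bX_le (X : {set node}) : \sum_(x in X) b x <= W.
Proof.
rewrite bX; have : \sum_(v | (v != sink N) && ((v, ord0) \in X)) w v <= W.
  rewrite /W big_mkcondr; apply: ler_sum => v vs; case: ifP => // _.
  exact: supply_ge0 vs.
by have := W0; case: ifP => _; lra.
Qed.

(** If a holdover arc leaves [X], its capacity pays for everything. If [X] contains the last copy of
    the sink, its net supply is at most 0. Otherwise [X] contains each vertex from some cell [idx v]
    on, and is a cut over time with [beta v = T - idx v * dl]. *)
Let cutX (X : {set node}) : \sum_(x in X) b x <=
  \sum_(a | (tl a \in X) && (hd a \notin X)) c a.
Proof.
have [/existsP[v /existsP[i /and3P[vi iK vi1]]]|noh] :=
    boolP [exists v, exists i : 'I_K.+1, [&& (v, i) \in X, (i.+1 < K.+1)%N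
     & (v, inord i.+1) \notin X]].
  apply: le_trans (bX_le X) _.
  rewrite (bigD1 (inr (v, i)))/=; last by rewrite vi.
  by rewrite iK lerDl; apply: sumr_ge0.
have up v (i : 'I_K.+1) : (v, i) \in X -> (i.+1 < K.+1)%N -> (v, inord i.+1) \in X.
  move=> vi iK; apply: contraNT noh => vi1.
  by apply/existsP; exists v; apply/existsP; exists i; rewrite vi iK.
have idx_ v : {k : nat | (k <= K.+1)%N & forall i : 'I_K.+1, ((v, i) \in X) = (k <= i)%N}.
  exact/cid2/upward_closed_index/up.
pose idx v := s2val (idx_ v).
have idxK v : (idx v <= K.+1)%N by rewrite /idx; case: (idx_ v).
have idxX v i : ((v, i) \in X) = (idx v <= i)%N by rewrite /idx; case: (idx_ v).
have cge0 : 0 <= \sum_(a | (tl a \in X) && (hd a \notin X)) c a by exact: sumr_ge0.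
have [sX|sX] := boolP ((sink N, ord_max) \in X).
  apply: le_trans cge0; rewrite bX sX.
  have : \sum_(v | (v != sink N) && ((v, ord0) \in X)) w v <= W.
    rewrite /W big_mkcondr; apply: ler_sum => v vs; case: ifP => // _.
    exact: supply_ge0 vs.
  lra.
have idxs : idx (sink N) = K.+1.
  by apply/eqP; rewrite eqn_leq idxK/= ltnNge -(idxX _ ord_max).
pose beta v := T - (idx v)%:R * dl.
have betas : beta (sink N) = 0 by rewrite /beta idxs TE subrr.
have := cc betas.
have -> : \sum_(v in sources N | T <= beta v) w v = \sum_(x in X) b x.
  rewrite bX (negbTE sX) add0r big_mkcond [RHS]big_mkcond/=; apply: eq_bigr => v _.
  have -> : (T <= beta v) = ((v, ord0) \in X).
    rewrite idxX leqn0 /beta lerBrDr gerDl.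
    by rewrite pmulr_lle0// lern0.
  have [->|vs] := eqVneq v (sink N); first by rewrite (negbTE (sink_notin_sources N)).
  have [//|vS] := boolP (v \in sources N).
  by case: sd => _ _ -> //=; case: ifP.
move=> /le_trans; apply.
rewrite big_mkcond/= big_sumType/=.
apply: le_trans (_ : \sum_(a : 'I_m * 'I_K.+1) (if (tl (inl a) \in X) && (hd (inl a)
  \notin X) then c (inl a) else 0) <= _); last first.
  by rewrite lerDl; apply: sumr_ge0 => a _; case: ifP => // _; exact: (c0 (inr a)).
rewrite (eq_bigr (fun a => if (tl (inl (a.1, a.2)) \in X) && (hd (inl (a.1, a.2)) \notin
  X) then c (inl (a.1, a.2)) else 0)); last by case.
rewrite -(pair_bigA _ (fun e i => if (tl (inl (e, i)) \in X) && (hd (inl (e, i)) \notin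
  X) then c (inl (e, i)) else 0))/=.
rewrite mulr_sumr; apply: ler_sum => e _.
set t := etail N e; set h := ehead N e.
(* These are the cells whose copy of [e] leaves [X]. *)
apply: le_trans (_ : \sum_(idx t <= i < idx h - q e) u * dl <= _).
  rewrite sumr_const_nat -mulr_natr -mulrA ler_pM2l//.
  rewrite ge_max mulr_ge0 ?ler0n ?(ltW dl0)//=.
  rewrite /beta -/t -/h.
  have := qle e.
  have [le1|lt1] := leqP (q e + idx t) (idx h).
    have -> : ((idx h - q e - idx t)%:R : R) = (idx h)%:R - (q e)%:R - (idx t)%:R.
      by rewrite !natrB//; lia.
    by lra.
  move=> qe; have h2 : (idx h)%:R <= (q e + idx t)%:R :> R by rewrite ler_nat ltnW.
  have := ler_wpM2r (ltW dl0) h2; rewrite natrD => h3.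
  have : 0 <= dl * (idx h - q e - idx t)%:R by rewrite mulr_ge0// ltW.
  lra.
rewrite (big_nat_widenl _ 0)//.
rewrite (big_nat_widen _ _ K.+1); last by rewrite (leq_trans (leq_subr _ _)).
rewrite big_mkord [leLHS]big_mkcond/=; apply: ler_sum => i _.
have [/andP[h1 h2]|_] := boolP (idx t <= i < idx h - q e)%N; last by case: ifP => // _;
  exact: (c0 (inl (e, i))).
have h3 : (i + q e < idx h)%N by lia.
have h4 : (i + q e < K.+1)%N by exact: leq_trans h3 (idxK _).
by rewrite !idxX h1 inordK// -ltnNge h3 h4.
Qed.

Lemma time_expanded_flow : exists g : 'I_m -> nat -> R,
  [/\ forall e i, 0 <= g e i <= u * dl, forall e i, (K.+1 <= i)%N -> g e i = 0,
   forall v k, (k <= K.+1)%N ->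
     \sum_(e | etail N e == v) \sum_(0 <= i < k) g e i
     - \sum_(e | ehead N e == v) \sum_(0 <= i < k - q e) g e i <= Num.max (w v) 0
  & forall v, \sum_(e | etail N e == v) \sum_(0 <= i < K.+1) g e i
     - \sum_(e | ehead N e == v) \sum_(0 <= i < K.+1 - q e) g e i = w v].
Proof.
have b0 : \sum_x b x = 0.
  have -> : \sum_x b x = \sum_(x in [set: node]%SET) b x.
    by apply: eq_bigl => x; rewrite inE.
  rewrite bX inE; have -> : \sum_(v | (v != sink N) && ((v, ord0) \in [set: node]%SET)) w v = W.
    by apply: eq_bigl => v; rewrite inE andbT.
  lra.
have [f [fc fb]] := gale c0 b0 cutX.
have fY (Y : {set node}) : \sum_(a | tl a \in Y) f a - \sum_(a | hd a \in Y) f a =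
  \sum_(x in Y) b x.
  have part (h : arc -> node) : \sum_(a | h a \in Y) f a = \sum_(x in Y) \sum_(a | h a ==
    x) f a.
    rewrite (exchange_big_dep (fun a => h a \in Y))//=; last by move=> x a xY /eqP ->.
    apply: eq_bigr => a aY; rewrite (big_pred1 (h a))// => x.
    by rewrite /= eq_sym; case: eqP => [->|]; rewrite ?aY ?andbF.
  by rewrite !part -sumrB; apply: eq_bigr => x _; exact: fb.
pose g e i := if (i < K.+1)%N then f (inl (e, inord i)) else 0.
have fcl e (i : 'I_K.+1) : (K.+1 <= i + q e)%N -> f (inl (e, i)) = 0.
  move=> h; have := fc (inl (e, i)); rewrite /c ltnNge h /=; lra.
have fcr v (i : 'I_K.+1) : (K.+1 <= i.+1)%N -> f (inr (v, i)) = 0.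
  move=> h; have := fc (inr (v, i)); rewrite /c ltnNge h /=; lra.
have ud0 : 0 <= u * dl by rewrite mulr_ge0// ltW.
(* Adding up conservation over the copies of [v] in the first [k] cells leaves the amount [s] held
   over into the next one. *)
have key v k : (k <= K.+1)%N -> exists2 s : R, 0 <= s /\ (k = K.+1 -> s = 0) &
  \sum_(e | etail N e == v) \sum_(0 <= i < k) g e i
     - \sum_(e | ehead N e == v) \sum_(0 <= i < k - q e) g e i + s =
  (if v == sink N then (if k == K.+1 then w v else 0) else (if (0 < k)%N then w v else 0)).
  move=> kK; pose Y := [set x : node | (x.1 == v) && (x.2 < k)%N].
  exists (\sum_(a : 'I_n * 'I_K.+1 | tl (inr a) \in Y) f (inr a) - \sum_(a : 'I_n *
    'I_K.+1| hd (inr a) \in Y) f (inr a)).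
    split.
      rewrite subr_ge0 big_mkcond [leRHS]big_mkcond; apply: ler_sum => -[v' i] _ /=.
      rewrite !inE /=; have f0 : 0 <= f (inr (v', i)) by have /andP[] := fc (inr (v', i)).
      have [iK|iK] := leqP K.+1 i.+1.
        by rewrite fcr//; case: ifP; case: ifP.
      rewrite inordK//; case: eqP => //= _.
      by case: (ltnP i.+1 k) => h; [rewrite (ltnW h)|case: ifP].
    move=> kE; apply/eqP; rewrite subr_eq0; apply/eqP.
    rewrite big_mkcond [RHS]big_mkcond; apply: eq_bigr => -[v' i] _ /=.
    rewrite !inE /= kE ltn_ord; have [iK|iK] := leqP K.+1 i.+1.
      by rewrite fcr//; case: ifP; case: ifP.
    by rewrite inordK// iK.
  have fsplit (h : arc -> node) : \sum_(a | h a \in Y) f a =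
      \sum_(a : 'I_m * 'I_K.+1) (if h (inl a) \in Y then f (inl a) else 0)
      + \sum_(a : 'I_n * 'I_K.+1 | h (inr a) \in Y) f (inr a).
    by rewrite big_mkcond/= big_sumType/= -[X in _ + X = _]big_mkcond.
  have := fY Y; rewrite !fsplit.
  have -> : \sum_(a : 'I_m * 'I_K.+1) (if tl (inl a) \in Y then f (inl a) else 0) =
     \sum_(e | etail N e == v) \sum_(0 <= i < k) g e i.
    rewrite (eq_bigr (fun a => if tl (inl (a.1, a.2)) \in Y then f (inl (a.1, a.2)) else
      0)); last by case.
    rewrite -(pair_bigA _ (fun e i => if tl (inl (e, i)) \in Y then f (inl (e, i)) else 0))/=.
    rewrite [RHS]big_mkcond/=; apply: eq_bigr => e _.
    case: ifP => ev; last first.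
      by rewrite big1// => i _; rewrite inE /= ev.
    rewrite (big_nat_widen _ _ K.+1)// big_mkord [RHS]big_mkcond/=; apply: eq_bigr => i _.
    by rewrite inE /= ev /g ltn_ord inord_val.
  have -> : \sum_(a : 'I_m * 'I_K.+1) (if hd (inl a) \in Y then f (inl a) else 0) =
     \sum_(e | ehead N e == v) \sum_(0 <= i < k - q e) g e i.
    rewrite (eq_bigr (fun a => if hd (inl (a.1, a.2)) \in Y then f (inl (a.1, a.2)) else
      0)); last by case.
    rewrite -(pair_bigA _ (fun e i => if hd (inl (e, i)) \in Y then f (inl (e, i)) else 0))/=.
    rewrite [RHS]big_mkcond/=; apply: eq_bigr => e _.
    case: ifP => ev; last first.
      by rewrite big1// => i _; rewrite inE /= ev.
    rewrite (big_nat_widen _ _ K.+1); last by rewrite (leq_trans (leq_subr _ _)).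
    rewrite big_mkord [RHS]big_mkcond/=; apply: eq_bigr => i _.
    rewrite inE /= ev /g ltn_ord inord_val /=.
    have [iK|iK] := leqP K.+1 (i + q e).
      by rewrite fcl//; case: ifP; case: ifP.
    by rewrite inordK//; have -> : (i + q e < k)%N = (i < k - q e)%N by lia.
  rewrite bX !inE /= => fYE.
  have -> : (if v == sink N then (if k == K.+1 then w v else 0) else (if (0 < k)%N then w
    v else 0)) =
    (if (sink N == v) && (K < k)%N then - W else 0) + \sum_(v0 | (v0 != sink N) && ((v0,
      ord0) \in Y)) w v0.
    rewrite (eq_bigl (fun v0 => (v0 == v) && ((v != sink N) && (0 < k)%N))); last first.
      by move=> v0; rewrite inE /= andbCA; case: (v0 =P v) => [->|].
    rewrite big_mkcondr /= big_pred1_eq (eq_sym (sink N)).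
    case: eqP => [->|_]; rewrite /= ?add0r// addr0.
    by rewrite wsink eqn_leq kK.
  by rewrite -fYE; lra.
exists g; split.
- by move=> e i; rewrite /g; case: ifP => // _; rewrite ?lexx ?ud0//; have := fc (inl (e,
    inord i));
   rewrite /c; case: ifP => // _ /andP[-> /le_trans ->].
- by move=> e i h; rewrite /g ltnNge h.
- move=> v k kK; have [s [s0 _] E] := key v k kK.
  have : (if v == sink N then (if k == K.+1 then w v else 0) else (if (0 < k)%N then w v
    else 0)) <= Num.max (w v) 0.
    by case: ifP => _; case: ifP => _; rewrite le_max lexx ?orbT.
  by rewrite -E; lra.
- move=> v; have [s [_ s0] E] := key v K.+1 (leqnn _).
  move: E; rewrite s0// eqxx addr0 => ->.
  by case: ifP.
Qed.

End time_expanded.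

Local Open Scope classical_set_scope.

(** * Densities of Lipschitz functions *)

Lemma itv_integrable_cst (R : realType) (x y : bool) (a b r : R) :
  lebesgue_measure.-integrable [set` Interval (BSide x a) (BSide y b)] (cst r%:E).
Proof.
apply: measurable_bounded_integrable => //.
  by rewrite /= lebesgue_measure_itv; case: ifP => // _; rewrite -EFinB ltry.
exact: bounded_cst.
Qed.

Section density.
Variable R : realType.
Notation mu := (@lebesgue_measure R).

Lemma stieltjes_itv_oc (F : cumulative R R) (a b : R) : a <= b ->
  lebesgue_stieltjes_measure F `]a, b] = (F b - F a)%:E.
Proof.
move=> ab; rewrite /lebesgue_stieltjes_measure/= /measure_extension/=
  measurable_mu_extE/=; last first.
  exact: is_ocitv.
by rewrite wlength_itv_bnd.
Qed.

Lemma lipschitz_right_continuous (F : R -> R) :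
  (forall x y, x <= y -> 0 <= F y - F x <= y - x) -> right_continuous F.
Proof.
move=> HF; apply: right_continuousW => x.
apply/cvgrPdist_le => /= e e0; near=> y.
have [xy|/ltW yx] := leP x y.
  rewrite distrC ger0_norm; last by have /andP[] := HF _ _ xy.
  have /andP[_ /le_trans] := HF _ _ xy; apply.
  have : `|x - y| <= e by near: y; exact: cvgr_dist_le.
  by rewrite distrC ger0_norm// subr_ge0.
rewrite ger0_norm; last by have /andP[] := HF _ _ yx.
have /andP[_ /le_trans] := HF _ _ yx; apply.
have : `|x - y| <= e by near: y; exact: cvgr_dist_le.
by rewrite ger0_norm// subr_ge0.
Unshelve. all: by end_near. Qed.

End density.

(** The proof is an argument of the alias so that an instance of cumulative function can be attached
    to it. *)
Definition lipschitz_fun (R : realType) (F : R -> R)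
  of (forall x y, x <= y -> 0 <= F y - F x <= y - x) : R -> R := F.

Section lipschitz_cumulative.
Variables (R : realType) (F : R -> R)
  (HF : forall x y, x <= y -> 0 <= F y - F x <= y - x).

Let F_nd : nondecreasing (lipschitz_fun HF).
Proof. by move=> x y xy; rewrite -subr_ge0; have /andP[] := HF xy. Qed.

HB.instance Definition _ := isCumulative.Build R _ R (lipschitz_fun HF)
  F_nd (lipschitz_right_continuous HF).

End lipschitz_cumulative.

Section density_lipschitz.
Variable R : realType.
Notation mu := (@lebesgue_measure R).

Lemma lipschitz_complement (F : R -> R) :
  (forall x y, x <= y -> 0 <= F y - F x <= y - x) ->
  forall x y, x <= y -> 0 <= (y - F y) - (x - F x) <= y - x.
Proof.
move=> HF x y /HF /andP[h1 h2]; apply/andP; split; lra.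
Qed.

(** [F] and [x - F x] are both nondecreasing, and their Stieltjes measures add up to the Lebesgue
    measure on half-open intervals, hence everywhere. Absolute continuity follows at once. *)
Lemma stieltjes_le_lebesgue (F : R -> R)
    (HF : forall x y, x <= y -> 0 <= F y - F x <= y - x) (A : set R) :
  measurable A ->
  (lebesgue_stieltjes_measure (lipschitz_fun HF) A <= mu A)%E.
Proof.
move=> mA.
pose nu1 := lebesgue_stieltjes_measure (lipschitz_fun HF).
pose nu2 := lebesgue_stieltjes_measure (lipschitz_fun (lipschitz_complement HF)).
have -> : mu A = measure_add nu1 nu2 A.
  rewrite /lebesgue_measure; apply: lebesgue_stieltjes_measure_unique => //= X.
  move=> /ocitvP[->|[[a b] /= ab ->]]; first by rewrite !measure0.
  rewrite /msum 2!big_ord_recr big_ord0 /= add0e /nu1 /nu2.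
  rewrite !stieltjes_itv_oc ?ltW// -EFinD; congr EFin.
  by rewrite /idfun /= /lipschitz_fun; ring.
by rewrite measure_addE leeDl// /nu2; exact: measure_ge0.
Qed.

Lemma lipschitz1_density (F : R -> R) (T : R) : 0 <= T ->
  (forall x y, x <= y -> 0 <= F y - F x <= y - x) ->
  exists f : R -> R, [/\ measurable_fun setT f, forall x, 0 <= f x <= 1 &
    forall th, 0 <= th ->
      \int[mu]_(t in `[0, th]) f t = F (Num.min th T) - F 0].
Proof.
move=> T0 HF.
pose nu : {measure set (measurableTypeR R) -> \bar R} :=
  lebesgue_stieltjes_measure (lipschitz_fun HF).
have mD : measurable (`]0, T]%classic : set (measurableTypeR R)) by exact: measurable_itv.
have nuE a b : a <= b -> nu `]a, b]%classic = (F b - F a)%:E.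
  exact: stieltjes_itv_oc.
have nuD : (nu `]0%R, T]%classic < +oo)%E by rewrite nuE// ltry.
pose nuT : {finite_measure set (measurableTypeR R) -> \bar R} := mfrestr mD nuD.
have nuT_le A : measurable A -> (nuT A <= mu A)%E.
  move=> mA; rewrite /nuT /= /mfrestr /mrestr.
  apply: le_trans (stieltjes_le_lebesgue HF _) _; first exact: measurableI.
  by apply: le_measure; rewrite ?inE//; exact: measurableI.
have dom : nuT `<< mu.
  apply/null_content_dominatesP => A mA muA0; apply/eqP.
  by rewrite -measure_le0 -muA0 nuT_le.
have [f [f0 ffin fint fE]] : exists f : R -> \bar R,
    [/\ forall x, (0 <= f x)%E, forall x, f x \is a fin_num,
        mu.-integrable setT f
      & forall A : set R, measurable A -> nuT A = (\int[mu]_(x in A) f x)%E].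
  exact: radon_nikodym_sigma_finite dom.
have mf : measurable_fun [set: R] f by case/integrableP: fint.
(* The density is at most 1 only almost everywhere, but a flow must respect its capacity at every
   time. Truncation keeps all integrals: the two versions agree where [f <= 1], and elsewhere
   [g = 1] suffices because [nuT <= mu]. *)
pose g x := Num.min (fine (f x)) 1.
have mg : measurable_fun [set: R] g.
  apply: measurable_minr => //; exact: measurableT_comp.
have g01 x : 0 <= g x <= 1.
  by rewrite /g le_min ler01 andbT ge_min lexx orbT andbT fine_ge0.
exists g; split => // th th0.
have gE (A : set R) : measurable A -> (\int[mu]_(x in A) (g x)%:E)%E = nuT A.
  move=> mA; apply/eqP; rewrite eq_le; apply/andP; split.
    rewrite fE//; apply: ge0_le_integral => //.
    - by move=> x _; rewrite lee_fin; have /andP[] := g01 x.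
    - by apply: measurable_funTS; apply/measurable_EFinP.
    - exact: measurable_funTS.
    - move=> x _; rewrite -[leRHS]fineK//.
      by rewrite lee_fin /g ge_min lexx.
  pose B := [set x | f x <= 1%E]%E.
  have mB : measurable B.
    rewrite -[B]setTI; exact: emeasurable_fun_le.
  have mgE D : measurable_fun D (fun x => (g x)%:E).
    by apply: measurable_funTS; apply/measurable_EFinP.
  have g0E x : (0 <= (g x)%:E)%E by rewrite lee_fin; have /andP[] := g01 x.
  have mAB : measurable (A `&` B) by exact: measurableI.
  have mAC : measurable (A `&` ~` B) by apply: measurableI => //; exact: measurableC.
  have h1 : (nuT (A `&` B) <= \int[mu]_(x in A `&` B) (g x)%:E)%E.
    rewrite fE//; apply: ge0_le_integral => //;
      [exact: measurable_funTS|exact: mgE|].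
    move=> x [_]; rewrite /B /= => fx; rewrite -[leLHS]fineK// lee_fin /g le_min lexx/=.
    by rewrite -lee_fin fineK.
  have h2 : (nuT (A `&` ~` B) <= \int[mu]_(x in A `&` ~` B) (g x)%:E)%E.
    apply: le_trans (nuT_le _ mAC) _.
    rewrite -[leLHS]mul1e -integral_cst//; apply: ge0_le_integral => //; first exact: mgE.
    move=> x [_]; rewrite /B /= => /negP; rewrite -ltNge => fx.
    rewrite lee_fin /g le_min lexx andbT -lee_fin fineK//; exact: ltW.
  have AE : A = (A `&` B) `|` (A `&` ~` B) by rewrite -setIUr setUv setIT.
  have dAB : [disjoint A `&` B & A `&` ~` B].
    by apply/disj_setPS => x [[_ ?] [_ ?]].
  rewrite AE measureU//; last by apply/disj_set2P.
  have -> : (\int[mu]_(x in A `&` B `|` A `&` ~` B) (g x)%:E = \int[mu]_(x in A `&` B) (g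
    x)%:E + \int[mu]_(x in A `&` ~` B) (g x)%:E)%E.
    by apply: ge0_integral_setU => //; exact: mgE.
  exact: leeD.
rewrite /Rintegral gE// /nuT /= /mfrestr /mrestr.
have -> : `[0, th] `&` `]0, T] = `]0, Num.min th T]%classic.
  apply/seteqP; split => x /=; rewrite !in_itv/= le_min.
    by move=> [/andP[_ ->] /andP[-> ->]].
  by move=> /and3P[x0 -> ->]; rewrite x0 ltW.
by rewrite nuE ?le_min ?th0.
Qed.

Lemma lipschitz_density (F : R -> R) (u T : R) : 0 < u -> 0 <= T ->
  (forall x y, x <= y -> 0 <= F y - F x <= u * (y - x)) ->
  (forall x, T <= x -> F x = F T) -> F 0 = 0 ->
  exists f : R -> R, [/\ measurable_fun setT f, forall x, 0 <= f x <= u &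
    forall th, 0 <= th -> \int[mu]_(t in `[0, th]) f t = F th].
Proof.
move=> u0 T0 HF FT F0.
have HG x y : x <= y -> 0 <= u^-1 * F y - u^-1 * F x <= y - x.
  move=> /HF /andP[h1 h2]; rewrite -mulrBr; apply/andP; split; last by rewrite ler_pdivrMl.
  by rewrite mulr_ge0 ?invr_ge0// ltW.
have [f [mf f01 fE]] := lipschitz1_density T0 HG.
have mu_f : measurable_fun setT (fun x => u * f x).
  exact: measurable_funM.
exists (fun x => u * f x); split => // [x|th th0].
  have /andP[h0 h1] := f01 x; apply/andP; split; first by rewrite mulr_ge0// ltW.
  by rewrite -[leRHS]mulr1 ler_pM2l.
rewrite RintegralZl//; last first.
  apply: (@le_integrable _ _ _ _ _ _ _ (cst 1%E)) => //.
  - by apply: measurable_funTS; apply/measurable_EFinP.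
  - move=> x _ /=; have /andP[h0 h1] := f01 x.
    by rewrite ger0_norm ?lee_fin// normr1.
  - exact: itv_integrable_cst.
rewrite fE// F0 mulr0 subr0 mulrA divff ?gt_eqF// mul1r.
by have [|/ltW /FT] := leP th T.
Qed.

End density_lipschitz.

(** * Feasible horizons and cuts *)

Section cumulated_flow.
Variables (R : realType) (f : R -> R) (u : R).
Hypothesis mf : measurable_fun (`[0, +oo[ : set R) f.
Hypothesis fu : forall t, 0 <= t -> 0 <= f t <= u.
Notation mu := (@lebesgue_measure R).

Lemma cumul_eq0 t : t <= 0 -> \int[mu]_(x in `[0, t]) f x = 0.
Proof.
rewrite le_eqVlt => /predU1P[->|t0].
  by rewrite set_itv1 Rintegral_set1.
by rewrite set_itv_ge ?Rintegral_set0// bnd_simp -ltNge.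
Qed.

Lemma bounded_integrable a b : 0 <= a -> mu.-integrable `]a, b] (EFin \o f).
Proof.
move=> a0; apply: (@le_integrable _ _ _ _ _ _ _ (cst u%:E)) => //.
- apply/measurable_EFinP; apply: measurable_funS mf => //.
  by move=> x /=; rewrite !in_itv/= andbT => /andP[/ltW/(le_trans a0)].
- move=> x /=; rewrite in_itv/= => /andP[/ltW/(le_trans a0)/fu /andP[h0 h1] _].
  by rewrite lee_fin !ger0_norm// (le_trans h0).
- exact: itv_integrable_cst.
Qed.

Lemma bounded_integrable_cc b : mu.-integrable `[0, b] (EFin \o f).
Proof.
apply: (@le_integrable _ _ _ _ _ _ _ (cst u%:E)) => //.
- apply/measurable_EFinP; apply: measurable_funS mf => //.
  by move=> x /=; rewrite !in_itv/= andbT => /andP[].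
- move=> x /=; rewrite in_itv/= => /andP[/fu /andP[h0 h1] _].
  by rewrite lee_fin !ger0_norm// (le_trans h0).
- exact: itv_integrable_cst.
Qed.

Lemma cumul_lipschitz a b : a <= b ->
  0 <= \int[mu]_(x in `[0, b]) f x - \int[mu]_(x in `[0, a]) f x <= u * (b - a).
Proof.
have u0 : 0 <= u by have /andP[] := fu (lexx 0); exact: le_trans.
wlog a0 : a / 0 <= a => [hw|].
  have [a0|a0] := leP 0 a; first exact: hw.
  have [b0 _|b0] := leP 0 b; last first.
    move=> ab; rewrite (cumul_eq0 (ltW a0)) (cumul_eq0 (ltW b0)) subrr.
    by apply/andP; split=> //; rewrite mulr_ge0// subr_ge0.
  have := hw 0 (lexx _) b0; rewrite (cumul_eq0 (ltW a0)) (cumul_eq0 (lexx 0)).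
  move=> /andP[-> /le_trans]; apply; rewrite ler_wpM2l//; lra.
move=> ab; rewrite Rintegral_itvB ?bnd_simp//; last exact: bounded_integrable_cc.
have int := @bounded_integrable a b a0.
have fab x : `]a, b]%classic x -> 0 <= f x <= u.
  by rewrite /= in_itv/= => /andP[/ltW /(le_trans a0)/fu].
apply/andP; split; first by apply: Rintegral_ge0 => x /fab /andP[].
have -> : u * (b - a) = \int[mu]_(x in `]a, b]) u.
  rewrite Rintegral_cst//= lebesgue_measure_itv/= lte_fin.
  by move: ab; rewrite le_eqVlt => /predU1P[->|->]; rewrite ?ltxx ?subrr//= ?mulr0.
apply: le_Rintegral => //; last by move=> x /fab /andP[].
exact: itv_integrable_cst.
Qed.

End cumulated_flow.

(** Each vertex is observed at its own time [al v], when it joins the cut. Summing the net outflows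
    regroups them by edges: what enters [e] after its tail has joined and early enough to arrive
    before its head joins is at most the capacity times the length of that window. *)
Lemma feasible_cut (R : realType) (n m : nat) (N : network R n m) w T :
  supply_demand N w -> feasible_horizon N w T -> cut_condition N w T.
Proof.
move=> sd [T0 [f [mf fu fle feq]]] beta betas.
pose F e t := \int[lebesgue_measure]_(x in `[0, t]) f e x.
have FL e a b : a <= b -> 0 <= F e b - F e a <= capacity N * (b - a).
  exact: cumul_lipschitz (mf e) (fu e) _ _.
have F0 e t : t <= 0 -> F e t = 0 by exact: cumul_eq0.
pose net v t := flow_leaving N f v t - flow_arriving N f v t.
have netE t : \sum_v net v (t v) =
    \sum_e (F e (t (etail N e)) - F e (t (ehead N e) - transit N e)).
  rewrite sumrB sumrB; congr (_ - _).
    by rewrite /flow_leaving (sum_fiber _ (fun e v => F e (t v))).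
  by rewrite /flow_arriving (sum_fiber _ (fun e v => F e (t v - transit N e))).
pose al v := T - beta v.
have h1 : \sum_(v in sources N | T <= beta v) w v <= \sum_v (net v T - net v (al v)).
  rewrite big_mkcond/=; apply: ler_sum => v _.
  have netT : net v T = w v by exact: feq.
  have [->|vs] := eqVneq v (sink N).
    by rewrite (negbTE (sink_notin_sources N)) /= /al betas subr0 subrr.
  have w0 := supply_ge0 sd vs.
  have [Tb|Tb] := leP T (beta v).
    have -> : net v (al v) = 0.
      rewrite /net /flow_leaving /flow_arriving !big1 ?subrr// => e _; apply: F0.
        have := transit_gt0 N e; rewrite /al; lra.
      by rewrite /al; lra.
    by rewrite netT subr0 andbT; case: ifP.
  rewrite andbF subr_ge0 netT.
  have := fle v (al v); rewrite /net => /(_ _)/le_trans; apply; first by rewrite /al; lra.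
  by rewrite ge_max lexx.
apply: le_trans h1 _; rewrite sumrB.
have -> : \sum_v net v T = 0.
  by case: sd => _ _ _ wE; rewrite -[RHS]wE; apply: eq_bigr => v _; exact: feq.
rewrite sub0r (netE al) -sumrN mulr_sumr; apply: ler_sum => e _.
rewrite opprB.
have [h|/ltW h] := leP (al (ehead N e) - transit N e) (al (etail N e)).
  have /andP[+ _] := FL e _ _ h; rewrite subr_ge0 -subr_le0 => /le_trans; apply.
  by rewrite mulr_ge0 ?le_max ?lexx// ltW// capacity_gt0.
have /andP[_ /le_trans] := FL e _ _ h; apply.
rewrite ler_wpM2l ?(ltW (capacity_gt0 N))// le_max; apply/orP; right.
by rewrite /al; lra.
Qed.

(** * Limits of time-expanded flows *)

Section step_cumul.
Variables (R : realType) (u dl : R) (g : nat -> R).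
Hypotheses (dl0 : 0 < dl) (g0 : forall i, 0 <= g i <= u * dl).

Definition step_cumul (t : R) : R := \sum_(0 <= i < Num.truncn (t / dl)) g i.

Lemma sum_nat_bound a b : (a <= b)%N ->
  0 <= \sum_(0 <= i < b) g i - \sum_(0 <= i < a) g i <= (b%:R - a%:R) * (u * dl).
Proof.
move=> ab; rewrite (big_cat_nat (leq0n a) ab)//= addrAC subrr add0r; apply/andP; split.
  by apply: sumr_ge0 => i _; have /andP[] := g0 i.
rewrite -natrB// mulr_natl -sumr_const_nat; apply: ler_sum => i _.
by have /andP[] := g0 i.
Qed.

Let ud0 : 0 <= u * dl.
Proof. by have /andP[] := g0 0%N; exact: le_trans. Qed.

Lemma step_cumul_lip a b : a <= b ->
  0 <= step_cumul b - step_cumul a <= u * (b - a) + u * dl.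
Proof.
move=> ab; have ab' : a / dl <= b / dl by rewrite ler_pM2r// invr_gt0.
have u0 : 0 <= u by move: ud0; rewrite pmulr_lge0.
have kab := le_truncn ab'.
have /andP[h1 h2] := sum_nat_bound kab; rewrite h1 /=; apply: le_trans h2 _.
have [k0|k0] := eqVneq (Num.truncn (b / dl)) 0%N.
  move: kab; rewrite k0 leqn0 => /eqP ->; rewrite subrr mul0r addr_ge0//.
  by rewrite mulr_ge0// subr_ge0.
have hb : (Num.truncn (b / dl))%:R <= b / dl.
  by rewrite truncn_le; apply: le_trans (ltW ltr01) _; rewrite -truncn_gt0 lt0n.
have ha := truncnS_gt (a / dl).
rewrite mulrCA -mulrDr ler_wpM2l// -ler_pdivlMr// mulrDl divff ?gt_eqF// mulrBl.
by rewrite -natr1 in ha; lra.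
Qed.

Lemma step_cumul0 t : t <= 0 -> step_cumul t = 0.
Proof.
move=> t0; rewrite /step_cumul; have -> : Num.truncn (t / dl) = 0%N.
  apply/eqP; rewrite -leqn0 truncn_le_nat; apply: le_lt_trans (_ : 0 < _) => //.
  by rewrite pmulr_lle0// invr_gt0.
by rewrite big_geq.
Qed.

(** Shifting the clock by [ta] and shifting the index by the rounded [ta] differ by at most one
    cell: this is the price of rounding transit times down. *)
Lemma step_cumul_shift th ta : 0 <= th -> 0 <= ta ->
  0 <= \sum_(0 <= i < Num.truncn (th / dl) - Num.truncn (ta / dl)) g i
       - step_cumul (th - ta) <= u * dl.
Proof.
move=> th0 ta0; rewrite /step_cumul; set k := Num.truncn (th / dl).
set q := Num.truncn (ta / dl); set k' := Num.truncn _.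
have hk : k%:R <= th / dl < k.+1%:R by rewrite truncn_itv// divr_ge0// ltW.
have hq : q%:R <= ta / dl < q.+1%:R by rewrite truncn_itv// divr_ge0// ltW.
have hk' := truncnS_gt ((th - ta) / dl); rewrite -/k' mulrBl in hk'.
have kle : (k' <= k - q)%N.
  have [->//|k'0] := eqVneq k' 0%N.
  have : k'%:R <= (th - ta) / dl.
    by rewrite truncn_le; apply: le_trans (ltW ltr01) _; rewrite -truncn_gt0 lt0n.
  rewrite mulrBl => h.
  have : (k' + q)%:R < k.+1%:R :> R by rewrite natrD; lra.
  by rewrite ltr_nat; lia.
have kge : (k - q <= k'.+1)%N.
  have [|kq] := leqP k q; first by rewrite -subn_eq0 => /eqP ->.
  have : k%:R < (k'.+1 + q.+1)%:R :> R by rewrite natrD; lra.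
  by rewrite ltr_nat; lia.
have /andP[-> /le_trans] := sum_nat_bound kle; apply => /=.
rewrite -[leRHS]mul1r ler_wpM2r// lerBlDr.
by rewrite nat1r ler_nat.
Qed.

End step_cumul.

(** One ultrafilter serves every edge and every time, so that no subsequence has to be extracted
    diagonally. *)
Lemma ultra_bounded_cvg (R : realType) (U : set_system nat) (s : nat -> R) (B : R) :
  UltraFilter U -> (forall k, 0 <= s k <= B) -> exists l : R, s @ U --> l.
Proof.
move=> UU sB; have PU : ProperFilter U by exact: ultra_proper.
have [|p [_ cl]] := @segment_compact R 0 B (s @ U).
  by apply: (@filterS _ U _ setT) => [k _ /=|]; [rewrite in_itv/=|exact: filterT].
exists p => B' nB'; have [//|h] := in_ultra_setVsetC (s @^-1` B') UU.
have [x [/= nx xB]] := cl (~` B') B' h nB'.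
by [].
Qed.

Lemma cvg_le_to (R : realType) (U : set_system nat) (PU : ProperFilter U) (f g : nat ->
  R) (l l' : R) :
  f @ U --> l -> g @ U --> l' -> (forall k, f k <= g k) -> l <= l'.
Proof. by move=> fl gl fg; apply: (ler_cvg_to fl gl); exact: nearW. Qed.

Lemma cvg_sumr (R : realType) (U : set_system nat) (FU : Filter U) (I : Type) (r : seq I)
    (P : pred I) (f : I -> nat -> R) (l : I -> R) :
  (forall i, f i @ U --> l i) ->
  (fun k => \sum_(i <- r | P i) f i k) @ U --> \sum_(i <- r | P i) l i.
Proof.
move=> fl; elim: r => [|i r IHr].
  rewrite big_nil (_ : (fun _ => _) = cst 0); first exact: cvg_cst.
  by apply/funext => k; rewrite big_nil.
rewrite big_cons (_ : (fun _ => _) = (fun k => if P i then f i k + \sum_(j <- r | P j) f j k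
    else \sum_(j <- r | P j) f j k)); last by apply/funext => k; rewrite big_cons.
by case: (P i) => //; apply: cvgD => //; exact: fl.
Qed.

(** At [T = 0] the cut [beta = 0] has value 0 and contains all sources. Positivity makes the cells
    of the time expansion nondegenerate. *)
Lemma cut_condition_horizon_gt0 (R : realType) (n m : nat) (N : network R n m) w T :
  supply_demand N w -> 0 <= T -> cut_condition N w T -> 0 < T.
Proof.
move=> [w1 w2 w3 w4]; rewrite le_eqVlt => /predU1P[<-|//] /(_ (fun=> 0) erefl).
have -> : cut_value N (fun=> 0) = 0.
  rewrite /cut_value big1// => e _.
  by rewrite subrr sub0r; apply/max_idPl; rewrite oppr_le0 ltW// transit_gt0.
rewrite mulr0; move: w4; rewrite (bigD1 (sink N))//= => w4.
have -> : \sum_(v in sources N | 0 <= 0 :> R) w v = \sum_(v | v != sink N) w v.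
  rewrite big_mkcond [RHS]big_mkcond; apply: eq_bigr => v _; rewrite lexx andbT.
  have [->|vs] := eqVneq v (sink N); first by rewrite (negbTE (sink_notin_sources N)).
  by case: (boolP (v \in sources N)) => // /w3 ->.
lra.
Qed.

Lemma cut_feasible (R : realType) (n m : nat) (N : network R n m) w T :
  supply_demand N w -> 0 <= T -> cut_condition N w T -> feasible_horizon N w T.
Proof.
move=> sd Tge0 cc; split=> //; have T0 := cut_condition_horizon_gt0 sd Tge0 cc.
set u := capacity N; have u0 : 0 < u := capacity_gt0 N.
have [g gP] := choice (time_expanded_flow sd T0 cc).
pose dl (K : nat) : R := T / K.+1%:R.
have dl0 K : 0 < dl K by rewrite divr_gt0.
have g0 K e i : 0 <= g K e i <= u * dl K by case: (gP K).
pose G K e t := step_cumul (dl K) (g K e) t.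
have TdlK K : Num.truncn (T / dl K) = K.+1.
  have -> : T / dl K = K.+1%:R by rewrite /dl invf_div mulrCA divff ?gt_eqF// mulr1.
  exact: natrK.
have dlT K : dl K <= T by rewrite /dl ler_pdivrMr// ler_peMr// ler1n.
have [U [UU ooU]] := ultraFilterLemma (_ : ProperFilter \oo).
have PU : ProperFilter U by exact: ultra_proper.
have cvG e t : exists l : R, (fun K => G K e t) @ U --> l.
  apply: (@ultra_bounded_cvg _ _ _ (u * `|t| + u * T)) => // K.
  have [t0|/ltW t0] := leP t 0.
    by rewrite /G step_cumul0// lexx addr_ge0// mulr_ge0 ?(ltW u0).
  have := step_cumul_lip (dl0 K) (g0 K e) t0.
  rewrite (step_cumul0 _ (dl0 K) (lexx 0)) !subr0 ger0_norm// => /andP[-> /le_trans]; apply.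
  by rewrite lerD2l ler_pM2l.
pose F e t : R := sval (cid (cvG e t)).
have FP e t : (fun K => G K e t) @ U --> F e t by rewrite /F; case: cid.
have dlcvg (a b : R) : (fun K => a + b * dl K) @ U --> a.
  have h : (fun K => a + b * dl K) @ \oo --> a.
    rewrite -[X in _ --> X]addr0; apply: cvgD; first exact: cvg_cst.
    rewrite -[X in _ --> X](mulr0 b); apply: cvgM; first exact: cvg_cst.
    rewrite -[X in _ --> X](mulr0 T) /dl; apply: cvgM; first exact: cvg_cst.
    exact: cvg_harmonic.
  by move=> A /h; exact: ooU.
have FL e a b : a <= b -> 0 <= F e b - F e a <= u * (b - a).
  move=> ab; have cvd : (fun K => G K e b - G K e a) @ U --> F e b - F e a.
    by apply: cvgB; exact: FP.
  apply/andP; split.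
    apply: cvg_le_to (cvg_cst 0) cvd _ => K.
    by have /andP[] := step_cumul_lip (dl0 K) (g0 K e) ab.
  apply: cvg_le_to cvd (dlcvg _ u) _ => K.
  by have /andP[] := step_cumul_lip (dl0 K) (g0 K e) ab.
have F0 e t : t <= 0 -> F e t = 0.
  move=> t0; apply/eqP; rewrite eq_le; apply/andP; split.
    apply: cvg_le_to (FP e t) (cvg_cst 0) _ => K.
    by rewrite /G step_cumul0.
  apply: cvg_le_to (cvg_cst 0) (FP e t) _ => K.
  by rewrite /G step_cumul0.
have GT K e t : T <= t -> G K e t = G K e T.
  move=> Tt; rewrite /G /step_cumul TdlK.
  have kk : (K.+1 <= Num.truncn (t / dl K))%N.
    by rewrite -(TdlK K); apply: le_truncn; rewrite ler_pM2r// invr_gt0.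
  rewrite (big_cat_nat (leq0n _) kk)//=.
  have -> : \sum_(K.+1 <= i < Num.truncn (t / dl K)) g K e i = 0; last by rewrite addr0.
  by rewrite big_nat big1// => i /andP[iK _]; case: (gP K) => _ ->.
have FT e t : T <= t -> F e t = F e T.
  move=> Tt; apply/eqP; rewrite eq_le; apply/andP; split.
    by apply: cvg_le_to (FP e t) (FP e T) _ => K; rewrite GT.
  by apply: cvg_le_to (FP e T) (FP e t) _ => K; rewrite GT.
pose net v t := \sum_(e | etail N e == v) F e t
                - \sum_(e | ehead N e == v) F e (t - transit N e).
pose netG K v t := \sum_(e | etail N e == v) G K e t
                - \sum_(e | ehead N e == v) G K e (t - transit N e).
have netcv v t : (fun K => netG K v t) @ U --> net v t.
  by apply: cvgB; apply: cvg_sumr => e; exact: FP.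
(* The balance of the discrete flow, which satisfies the constraints exactly; the sampled balance
   [netG] exceeds it by at most one cell of capacity per edge. *)
pose ex K v t := \sum_(e | etail N e == v) \sum_(0 <= i < Num.truncn (t / dl K)) g K e i
  - \sum_(e | ehead N e == v) \sum_(0 <= i < Num.truncn (t / dl K) - Num.truncn (transit
      N e / dl K)) g K e i.
have netGex K v t : 0 <= t -> ex K v t <= netG K v t <= ex K v t + (m%:R * u) * dl K.
  move=> t0; rewrite /netG /ex.
  pose er e := \sum_(0 <= i < Num.truncn (t / dl K) - Num.truncn (transit N e / dl K)) g
    K e i - G K e (t - transit N e).
  have erP e : 0 <= er e <= u * dl K.
    exact: (step_cumul_shift (dl0 K) (g0 K e) t0 (ltW (transit_gt0 N e))).
  have -> : \sum_(e | ehead N e == v) G K e (t - transit N e) =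
    \sum_(e | ehead N e == v) \sum_(0 <= i < Num.truncn (t / dl K) - Num.truncn (transit
      N e / dl K)) g K e i - \sum_(e | ehead N e == v) er e.
    by rewrite -sumrB; apply: eq_bigr => e _; rewrite /er subKr.
  have : 0 <= \sum_(e | ehead N e == v) er e by apply: sumr_ge0 => e _; have /andP[] := erP e.
  have : \sum_(e | ehead N e == v) er e <= m%:R * u * dl K.
    rewrite -mulrA mulr_natl -[X in _ *+ X]card_ord -sumr_const.
    rewrite big_mkcond; apply: ler_sum => e _; have /andP[h1 h2] := erP e.
    by case: ifP => // _; exact: le_trans h1 h2.
  rewrite /G /step_cumul; lra.
have net_le v t : 0 <= t <= T -> net v t <= Num.max (w v) 0.
  move=> /andP[t0 tT]; apply: cvg_le_to (netcv v t) (dlcvg _ (m%:R * u)) _ => K;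
  have /andP[_ /le_trans] := netGex K v t t0; apply.
  rewrite lerD2r /ex; have [_ _ + _] := gP K; apply.
  by rewrite -(TdlK K); apply: le_truncn; rewrite ler_pM2r// invr_gt0.
have exT K v : ex K v T = w v by rewrite /ex TdlK; case: (gP K) => _ _ _ ->.
have net_T v : net v T = w v.
  apply/eqP; rewrite eq_le; apply/andP; split.
    apply: cvg_le_to (netcv v T) (dlcvg _ (m%:R * u)) _ => K;
    rewrite -(exT K).
    by have /andP[_] := netGex K v T (ltW T0).
  apply: cvg_le_to (cvg_cst _) (netcv v T) _ => K; rewrite -(exT K).
  by have /andP[] := netGex K v T (ltW T0).
have [f fP] := choice (fun e => lipschitz_density u0 Tge0 (FL e) (FT e) (F0 e 0 (lexx 0))).
have fE e t : \int[lebesgue_measure]_(x in `[0, t]) f e x = F e t.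
  have [/ltW t0|t0] := ltP t 0; last by case: (fP e) => _ _ ->.
  by rewrite F0// cumul_eq0.
have netE v t : flow_leaving N f v t - flow_arriving N f v t = net v t.
  by congr (_ - _); apply: eq_bigr => e _; exact: fE.
exists f; split.
- by move=> e; apply: measurable_funTS; case: (fP e).
- by move=> e t _; case: (fP e).
(* After the horizon nothing more departs while arrivals can only grow, so the balance at [T] is an
   upper bound. *)
- move=> v t t0; rewrite netE; have [tT|/ltW tT] := leP t T; first by apply: net_le; rewrite t0.
  apply: le_trans (_ : net v T <= _); last by apply: net_le; rewrite Tge0 lexx.
  rewrite /net lerB//; first by apply: ler_sum => e _; rewrite (FT e t).
  apply: ler_sum => e _; rewrite -subr_ge0.
  by have /andP[] := FL e (T - transit N e) (t - transit N e) (lerB tT (lexx _)).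
- by move=> v; rewrite netE.
Qed.

Local Close Scope classical_set_scope.

(** * Cost-aware weakest preconditions *)

Section ram.
Variable R : realType.
Implicit Types (s : state R) (p : program).

Fixpoint iwrites p : seq nat :=
  match p with
  | ISet a _ _ => [:: a]
  | Seq p1 p2 | Cond _ p1 p2 => iwrites p1 ++ iwrites p2
  | While _ p1 => iwrites p1
  | _ => [::]
  end.

Fixpoint rwrites p : seq nat :=
  match p with
  | RSet a _ _ => [:: a]
  | Seq p1 p2 | Cond _ p1 p2 => rwrites p1 ++ rwrites p2
  | While _ p1 => rwrites p1
  | _ => [::]
  end.

(** Preservation is tracked by whole arrays and read off the syntax; hence every scalar variable of
    the algorithm occupies an array of its own, and the side conditions compute to [true]. *)
Definition frame (iw rw : seq nat) s s' : Prop :=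
  (forall a, a \notin iw -> imem s' a = imem s a) /\
  (forall a, a \notin rw -> rmem s' a = rmem s a).

Lemma frame_refl iw rw s : frame iw rw s s.
Proof. by []. Qed.

Lemma frame_trans iw rw s1 s2 s3 :
  frame iw rw s1 s2 -> frame iw rw s2 s3 -> frame iw rw s1 s3.
Proof.
by move=> [h1 h2] [h3 h4]; split=> a ha; [rewrite h3// h1|rewrite h4// h2].
Qed.

Lemma frame_cat iw rw iw' rw' s1 s2 s3 :
  frame iw rw s1 s2 -> frame iw' rw' s2 s3 -> frame (iw ++ iw') (rw ++ rw') s1 s3.
Proof.
by move=> [h1 h2] [h3 h4]; split=> a; rewrite mem_cat negb_or => /andP[ha hb];
  [rewrite h3// h1|rewrite h4// h2].
Qed.

Lemma frame_sub iw rw iw' rw' s s' : {subset iw <= iw'} -> {subset rw <= rw'} ->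
  frame iw rw s s' -> frame iw' rw' s s'.
Proof.
by move=> hi hr [h1 h2]; split=> a ha; [apply: h1|apply: h2];
  apply: contra ha; [exact: hi|exact: hr].
Qed.

Lemma upd_other (A : Type) (mem : nat -> nat -> A) a i x b :
  b != a -> upd mem a i x b = mem b.
Proof. by move=> /negbTE ba; apply/funext => j; rewrite /upd ba. Qed.

Lemma upd_same (A : Type) (mem : nat -> nat -> A) a i x j :
  upd mem a i x a j = if j == i then x else mem a j.
Proof. by rewrite /upd eqxx. Qed.

Lemma upd_row (A : Type) (mem : nat -> nat -> A) a i x :
  upd mem a i x a = (fun j => if j == i then x else mem a j).
Proof. by apply/funext => j; rewrite upd_same. Qed.

Lemma exec_frame s p t s' : exec s p t s' -> frame (iwrites p) (rwrites p) s s'.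
Proof.
elim=> {s p t s'} /=.
- by move=> s; exact: frame_refl.
- move=> s a i x; split=> // b; rewrite inE => ba /=; exact: upd_other.
- move=> s a i x; split=> // b; rewrite inE => ba /=; exact: upd_other.
- move=> s1 s2 s3 p1 p2 t1 t2 _ h1 _ h2.
  by apply: (@frame_trans _ _ _ s2); [move: h1|move: h2]; apply: frame_sub => a;
    rewrite mem_cat => ->; rewrite ?orbT.
- by move=> s s' b p1 p2 t _ _; apply: frame_sub => a; rewrite mem_cat => ->.
- by move=> s s' b p1 p2 t _ _; apply: frame_sub => a; rewrite mem_cat => ->; rewrite orbT.
- by move=> s1 s2 s3 b p t1 t2 _ _ h1 _ h2; exact: frame_trans h1 h2.
- by move=> s b p _; exact: frame_refl.
Qed.

(* [wp p c s Q]: run from [s], [p] halts within [c] operations in a state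
   satisfying [Q]. *)
Definition wp p (c : nat) s (Q : state R -> Prop) : Prop :=
  exists t s', [/\ exec s p t s', (t <= c)%N & Q s'].

Lemma wp_conseq p c c' s (Q Q' : state R -> Prop) : wp p c s Q -> (c <= c')%N ->
  (forall s', frame (iwrites p) (rwrites p) s s' -> Q s' -> Q' s') -> wp p c' s Q'.
Proof.
move=> [t [s' [h1 h2 h3]]] cc QQ; exists t, s'; split=> //.
  exact: leq_trans h2 cc.
by apply: QQ => //; exact: exec_frame h1.
Qed.

Lemma wp_seq p1 p2 c1 c2 s (Q : state R -> Prop) :
  wp p1 c1 s (fun s1 => wp p2 c2 s1 Q) -> wp (Seq p1 p2) (c1 + c2) s Q.
Proof.
move=> [t1 [s1 [h1 h2 [t2 [s2 [h3 h4 h5]]]]]].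
by exists (t1 + t2)%N, s2; split=> //; [exact: exec_seq h1 h3|exact: leq_add].
Qed.

Lemma wp_seqf p1 p2 c1 c2 c s (Q1 Q : state R -> Prop) : wp p1 c1 s Q1 ->
  (forall s1, frame (iwrites p1) (rwrites p1) s s1 -> Q1 s1 -> wp p2 c2 s1 Q) ->
  (c1 + c2 <= c)%N -> wp (Seq p1 p2) c s Q.
Proof.
move=> h1 h2 hc; apply: wp_conseq (_ : wp _ (c1 + c2) s Q) hc _ => //.
by apply: wp_seq; apply: wp_conseq h1 (leqnn _) _.
Qed.

Lemma wp_cond b p1 p2 c s (Q : state R -> Prop) :
  (teval s b -> wp p1 c s Q) -> (~~ teval s b -> wp p2 c s Q) ->
  wp (Cond b p1 p2) ((tcost b).+1 + c) s Q.
Proof.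
move=> H1 H2; case: (boolP (teval s b)) => hb.
  have [t [s' [h1 h2 h3]]] := H1 hb.
  by exists ((tcost b).+1 + t)%N, s'; split=> //; [exact: exec_cond_true|rewrite leq_add2l].
have [t [s' [h1 h2 h3]]] := H2 hb.
by exists ((tcost b).+1 + t)%N, s'; split=> //; [exact: exec_cond_false|rewrite leq_add2l].
Qed.

Fixpoint loop_free p : bool :=
  match p with
  | Seq p1 p2 | Cond _ p1 p2 => loop_free p1 && loop_free p2
  | While _ _ => false
  | _ => true
  end.

Fixpoint max_cost p : nat :=
  match p with
  | Skip => 1
  | ISet _ i x => (icost i + icost x).+1
  | RSet _ i x => (icost i + rcost x).+1
  | Seq p1 p2 => max_cost p1 + max_cost p2
  | Cond b p1 p2 => (tcost b).+1 + maxn (max_cost p1) (max_cost p2)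
  | While _ _ => 0
  end.

Fixpoint run p s : state R :=
  match p with
  | Skip => s
  | ISet a i x => State (upd (imem s) a (ieval s i) (ieval s x)) (rmem s)
  | RSet a i x => State (imem s) (upd (rmem s) a (ieval s i) (reval s x))
  | Seq p1 p2 => run p2 (run p1 s)
  | Cond b p1 p2 => if teval s b then run p1 s else run p2 s
  | While _ _ => s
  end.

(** Code without loops is verified by computing its final state; [loop_free] excludes the dummy
    values of [run] and [max_cost] on [While]. *)
Lemma wp_run p c s (Q : state R -> Prop) :
  loop_free p -> (max_cost p <= c)%N -> Q (run p s) -> wp p c s Q.
Proof.
suff H : loop_free p -> wp p (max_cost p) s (eq (run p s)).
  move=> /H h hc hQ; apply: wp_conseq h hc _ => s' _ <- //.
elim: p s {Q} => [|a i x|a i x|p1 IH1 p2 IH2|b p1 IH1 p2 IH2|b p IH] s //=.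
- by move=> _; exists 1%N, s; split=> //; exact: exec_skip.
- by move=> _; do 2 eexists; split; first exact: exec_iset.
- by move=> _; do 2 eexists; split; first exact: exec_rset.
- move=> /andP[l1 l2]; apply: wp_seq.
  by apply: wp_conseq (IH1 s l1) (leqnn _) _ => s' _ <-; exact: IH2.
- move=> /andP[l1 l2]; apply: wp_cond => [hb|/negbTE hb]; rewrite hb.
    by apply: wp_conseq (IH1 s l1) _ _ => //; exact: leq_maxl.
  by apply: wp_conseq (IH2 s l2) _ _ => //; exact: leq_maxr.
Qed.

Definition iget (a : nat) : iexpr := IGet a (ICst 0).
Definition rget (a : nat) : rexpr := RGet a (ICst 0).
Definition iset (a : nat) (x : iexpr) := ISet a (ICst 0) x.
Definition rset (a : nat) (x : rexpr) := RSet a (ICst 0) x.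
Definition ilt (x y : iexpr) : test := TNot (ILe y x).

Definition For (i : nat) (hi : iexpr) (body : program) : program :=
  Seq (iset i (ICst 0))
      (While (ilt (iget i) hi) (Seq body (iset i (IAdd (iget i) (ICst 1))))).

Definition iassign s (a x : nat) : state R :=
  State (upd (imem s) a 0 x) (rmem s).

(** [hi] is evaluated anew at every test, so its value must be stable under whatever the body may
    write. Apart from [hi], the 12 covers the test and the increment of a round, the 10 the
    initialisation and the failing test. *)
Lemma wp_for i hi body s cb H (Inv : nat -> state R -> Prop) (Q : state R -> Prop) c :
  i \notin iwrites body ->
  (forall s1, frame (i :: iwrites body) (rwrites body) s s1 -> ieval s1 hi = H) ->
  Inv 0%N (iassign s i 0) ->
  (forall k s1, (k < H)%N -> frame (i :: iwrites body) (rwrites body) s s1 ->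
     imem s1 i 0 = k -> Inv k s1 ->
     wp body cb s1 (fun s2 => Inv k.+1 (iassign s2 i k.+1))) ->
  (H * (cb + icost hi + 12) + (icost hi + 10) <= c)%N ->
  (forall s1, frame (i :: iwrites body) (rwrites body) s s1 -> Inv H s1 -> Q s1) ->
  wp (For i hi body) c s Q.
Proof.
move=> ib hiE I0 Istep cH IQ.
rewrite /For; set B := Seq body _; set F := frame _ _ in hiE Istep IQ *.
have loop r k s1 : (k + r = H)%N -> F s s1 -> imem s1 i 0 = k -> Inv k s1 ->
    wp (While (ilt (iget i) hi) B) (r * (cb + icost hi + 12) + (icost hi + 6)) s1 Q.
  elim: r k s1 => [|r IHr] k s1 kr Fs ik Ik.
    rewrite addn0 in kr; rewrite {}kr in ik Ik.
    exists (tcost (ilt (iget i) hi)).+1, s1; split.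
    - by apply: exec_while_false; rewrite /= hiE// ik leqnn.
    - by rewrite /=; lia.
    - exact: IQ.
  have kH : (k < H)%N by rewrite -kr addnS ltnS leq_addr.
  have [t [s2 [e1 e2 I2]]] := Istep k s1 kH Fs ik Ik.
  have fr2 := exec_frame e1.
  have i2 : imem s2 i 0 = k by rewrite (fr2.1 i ib).
  have fr3 : F s (iassign s2 i k.+1).
    apply: frame_trans Fs _; split=> a; last by move=> ha; rewrite /= fr2.2.
    by rewrite inE negb_or => /andP[h1 h2]; rewrite /= upd_other// fr2.1.
  have [t3 [s3 [e4 e5 Q3]]] := IHr k.+1 (iassign s2 i k.+1) ltac:(lia) fr3
     (upd_same _ _ _ _ _) I2.
  exists ((tcost (ilt (iget i) hi)).+1 + (t + (icost (ICst 0) + icost (IAdd (iget i)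
    (ICst 1))).+1) + t3)%N, s3; split=> //.
  - apply: exec_while_true; first by rewrite /= hiE// ik -ltnNge.
      apply: exec_seq e1 _; exact: exec_iset.
    by rewrite /= i2 addn1.
  - by rewrite /= !mulSn; move: e5; lia.
apply: wp_conseq (_ : wp _ (4 + (H * (cb + icost hi + 12) + (icost hi + 6))) s Q) _ _ =>
  //; last first.
  by apply: leq_trans cH; lia.
apply: wp_seq; exists 3%N, (iassign s i 0); split=> //; first exact: exec_iset.
apply: (loop H 0%N) => //; last by rewrite /= upd_same.
by split=> // a; rewrite inE negb_or => /andP[h1 _]; exact: upd_other.
Qed.

End ram.

(** * Static flows *)

Lemma sink_indegreeE (R : realType) (n m : nat) (N : network R n m) :
  sink_indegree N = (\sum_(e | ehead N e == sink N) 1)%N.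
Proof.
rewrite /sink_indegree -sum1_card; apply: eq_bigl => e.
by apply/asboolP/idP.
Qed.

Section static_flows.
Variables (R : realType) (n m : nat) (N : network R n m) (w : 'I_n -> R).
Hypothesis sd : supply_demand N w.
Let u := capacity N.
Let u0 : 0 < u. Proof. exact: capacity_gt0. Qed.
Implicit Types (x : 'I_m -> bool) (beta : 'I_n -> R) (a : nat -> 'I_n) (A : {set 'I_n})
  (sg rh : 'I_n -> R).

(* The residual graph of the static 0/1 flow [x]: saturated edges are reversed. *)
Definition rfrom x e := if x e then ehead N e else etail N e.
Definition rto x e := if x e then etail N e else ehead N e.
Definition rlen x e : R := if x e then - transit N e else transit N e.

Definition bal x v : R :=
  \sum_(e | etail N e == v) (x e)%:R - \sum_(e | ehead N e == v) (x e)%:R.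
Definition flow_cost x : R := \sum_e (x e)%:R * transit N e.

Definition residual_potential x beta :=
  forall e, beta (rfrom x e) <= beta (rto x e) + rlen x e.

Lemma flow_cost_ge0 x : 0 <= flow_cost x.
Proof. by apply: sumr_ge0 => e _; rewrite mulr_ge0// ltW// transit_gt0. Qed.

Lemma bal_potential x beta :
  \sum_e (x e)%:R * (beta (etail N e) - beta (ehead N e)) = \sum_v bal x v * beta v.
Proof.
under [RHS]eq_bigr do rewrite /bal mulrBl !mulr_suml.
rewrite sumrB (sum_fiber _ (fun e v => (x e)%:R * beta v)).
rewrite (sum_fiber _ (fun e v => (x e)%:R * beta v)) -sumrB.
by apply: eq_bigr => e _; rewrite mulrBr.
Qed.

Lemma sum_bal x : \sum_v bal x v = 0.
Proof.
have := bal_potential x (fun=> 1); under [X in _ = X -> _]eq_bigr do rewrite mulr1.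
by move=> <-; rewrite big1// => e _; rewrite subrr mulr0.
Qed.

Lemma bal_sink x : bal x (sink N) = - \sum_(v | v != sink N) bal x v.
Proof. by have := sum_bal x; rewrite (bigD1 (sink N))//=; lra. Qed.

Lemma cut_sumE x beta : \sum_v bal x v * beta v - flow_cost x =
  \sum_e (x e)%:R * (beta (etail N e) - beta (ehead N e) - transit N e).
Proof.
rewrite -bal_potential -sumrB; apply: eq_bigr => e _.
by rewrite -mulrBr.
Qed.

Lemma weak_duality x beta : \sum_v bal x v * beta v - flow_cost x <= cut_value N beta.
Proof.
rewrite cut_sumE; apply: ler_sum => e _; case: (x e).
  by rewrite mul1r le_max lexx orbT.
by rewrite mul0r le_max lexx.
Qed.

Lemma cut_value_residual x beta : residual_potential x beta ->
  cut_value N beta = \sum_v bal x v * beta v - flow_cost x.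
Proof.
move=> rp; rewrite cut_sumE; apply: eq_bigr => e _.
have := rp e; rewrite /rfrom /rto /rlen; case: (x e) => h.
  by rewrite mul1r; apply/max_idPr; lra.
by rewrite mul0r; apply/max_idPl; lra.
Qed.

Lemma min_cost x y beta : residual_potential x beta ->
  (forall v, bal x v = bal y v) -> flow_cost x <= flow_cost y.
Proof.
move=> /cut_value_residual cE xy; have := weak_duality y beta.
have : \sum_v bal x v * beta v = \sum_v bal y v * beta v.
  by apply: eq_bigr => v _; rewrite xy.
lra.
Qed.

Definition flip x e : 'I_m -> bool := fun e' => if e' == e then ~~ x e else x e'.

Lemma bal_flip x e v :
  bal (flip x e) v = bal x v + (v == rfrom x e)%:R - (v == rto x e)%:R.
Proof.
have part (h : 'I_m -> 'I_n) : \sum_(e' | h e' == v) (flip x e e')%:R =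
    \sum_(e' | h e' == v) (x e')%:R
    + (if h e == v then (~~ x e)%:R - (x e)%:R else 0) :> R.
  rewrite big_mkcond [X in _ = X + _]big_mkcond (bigD1 e)//= [X in _ = X + _](bigD1 e)//=.
  rewrite /flip eqxx.
  have -> : \sum_(i < m | i != e) (if h i == v then (if i == e then ~~ x e else x i)%:R
    else 0) =
    \sum_(i < m | i != e) (if h i == v then (x i)%:R else 0) :> R.
    by apply: eq_bigr => i /negbTE ->.
  by case: ifP => _; ring.
rewrite /bal !part /rfrom /rto !(eq_sym v).
by case: (x e); case: (etail N e == v); case: (ehead N e == v) => /=; ring.
Qed.

Lemma flow_cost_flip x e : flow_cost (flip x e) = flow_cost x + rlen x e.
Proof.
rewrite /flow_cost (bigD1 e)//= [X in _ = X + _](bigD1 e)//= /flip eqxx /rlen.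
have -> : \sum_(i < m | i != e) (if i == e then ~~ x e else x i)%:R * transit N i =
    \sum_(i < m | i != e) (x i)%:R * transit N i.
  by apply: eq_bigr => i /negbTE ->.
by case: (x e) => /=; ring.
Qed.

Lemma residual_flip x beta e : residual_potential x beta ->
  beta (rfrom x e) = beta (rto x e) + rlen x e -> residual_potential (flip x e) beta.
Proof.
move=> rp te e'; rewrite /rfrom /rto /rlen /flip.
have [->|_] := eqVneq e' e; last exact: rp.
by move: te; rewrite /rfrom /rto /rlen; case: (x e) => /=; lra.
Qed.

Lemma residual_min x b1 b2 : residual_potential x b1 -> residual_potential x b2 ->
  residual_potential x (fun v => Num.min (b1 v) (b2 v)).
Proof.
move=> h1 h2 e; have := h1 e; have := h2 e => H2 H1.
have [h|h] := leP (b1 (rto x e)) (b2 (rto x e)).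
  by rewrite ge_min; apply/orP; left; lra.
by rewrite ge_min; apply/orP; right; lra.
Qed.

Lemma residual_shift x b c : residual_potential x b ->
  residual_potential x (fun v => c + b v).
Proof. by move=> h e; have := h e; lra. Qed.

Definition supply_count a j v : R := \sum_(i < j) (a i == v)%:R.

Definition has_supplies x a j := forall v, v != sink N -> bal x v = supply_count a j v.

Lemma supply_sum a j beta : (forall i, (i < j)%N -> a i != sink N) ->
  \sum_(v | v != sink N) supply_count a j v * beta v = \sum_(i < j) beta (a i).
Proof.
move=> aj; under eq_bigr do rewrite mulr_suml.
rewrite exchange_big/=; apply: eq_bigr => i _.
rewrite (bigD1 (a i))/=; last by apply: aj.
rewrite eqxx mul1r big1 ?addr0// => v /andP[_ /negbTE]; rewrite eq_sym => ->.
by rewrite mul0r.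
Qed.

Lemma has_supplies_sum x a j beta : (forall i, (i < j)%N -> a i != sink N) ->
  has_supplies x a j -> beta (sink N) = 0 ->
  \sum_v bal x v * beta v = \sum_(i < j) beta (a i).
Proof.
move=> aj hs b0; rewrite (bigD1 (sink N))//= b0 mulr0 add0r -(supply_sum beta aj).
by apply: eq_bigr => v vs; rewrite hs.
Qed.

Lemma supply_countS a j v : supply_count a j.+1 v = supply_count a j v + (a j == v)%:R.
Proof. by rewrite /supply_count big_ord_recr. Qed.

(* The real-valued potential [g] on [P], extended by a value that can be taken
   arbitrarily large (standing for [+oo]) outside [P]. *)
Definition partial_potential x (P : pred 'I_n) (g : 'I_n -> R) :=
  forall B : R, exists f, [/\ residual_potential x f,
    forall v, P v -> f v = g v & forall v, ~~ P v -> B <= f v].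

(** The potential [min(rh, T + sg)] is residual, so its cut is tight for [x] and amounts to the sum
    of its values at the [a i] minus the flow cost; these values are at most [T] since [sg <= 0]
    there. The infinite parts only need to be at least [T] for [rh] and [|T|] for [sg]. *)
Lemma partial_cut x a j P1 sg P2 rh T (B : pred 'I_n) :
  (forall i, (i < j)%N -> a i != sink N) -> has_supplies x a j ->
  partial_potential x P1 sg -> partial_potential x P2 rh ->
  P2 (sink N) -> rh (sink N) = 0 -> (forall i, (i < j)%N -> P1 (a i) && (sg (a i) <= 0)) ->
  cut_condition N w T -> (P1 (sink N) -> 0 <= T + sg (sink N)) ->
  (forall v, v \in sources N -> B v -> (P1 v ==> (0 <= sg v)) && (P2 v ==> (T <= rh v))) ->
  \sum_(v in sources N | B v) w v <= u * (j%:R * T - flow_cost x).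
Proof.
move=> aj hs pp1 pp2 P2s rhs sga cc Ts HB.
have [s [sp sE sB]] := pp1 `|T|; have [r [rp rE rB]] := pp2 T.
pose ga v := Num.min (r v) (T + s v).
have gap : residual_potential x ga by apply: residual_min => //; exact: residual_shift.
have gas : ga (sink N) = 0.
  rewrite /ga rE// rhs; apply/min_idPl.
  have [P1s|P1s] := boolP (P1 (sink N)); first by rewrite sE// Ts.
  by have := sB _ P1s; have := ler_norm (- T); rewrite normrN; lra.
have h1 := cc _ gas; rewrite (cut_value_residual gap) in h1.
apply: le_trans (le_trans h1 _).
  rewrite big_mkcond [leRHS]big_mkcond; apply: ler_sum => v _.
  have [vS|//] := boolP (v \in sources N); rewrite /=.
  have w0 : 0 <= w v by case: sd => /(_ _ vS)/ltW.
  case: ifP => Bv; last by case: ifP.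
  have /andP[/implyP h2 /implyP h3] := HB _ vS Bv.
  rewrite ifT// /ga le_min; apply/andP; split.
    by have [Pv|Pv] := boolP (P2 v); [rewrite rE// h3|exact: rB].
  rewrite lerDl; have [Pv|Pv] := boolP (P1 v); first by rewrite sE// h2.
  by apply: le_trans (sB _ Pv).
rewrite ler_pM2l// lerD2r (has_supplies_sum aj hs gas).
rewrite -[j in leRHS]card_ord mulr_natl -sumr_const; apply: ler_sum => i _.
have /andP[P1a sa] := sga i (ltn_ord i).
by rewrite /ga ge_min; apply/orP; right; rewrite sE// gerDl.
Qed.

(* Here [rh] and [sg] are the residual distances to the sink and to the sources in
   use, defined on [P2] and [P1] and infinite elsewhere. For [T <= rh v], the cut
   with potential [min(rh, T + sg)] has value at most [j * T - c] and contains the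
   threshold set of [v]. *)
Definition threshold_set (P1 : pred 'I_n) (sg : 'I_n -> R) (P2 : pred 'I_n) (rh : 'I_n ->
  R) v v' :=
  (~~ P1 v' || (0 <= sg v')) && (~~ P2 v' || (P2 v && (rh v <= rh v'))).

Definition threshold_weight P1 sg P2 rh v : R :=
  \sum_(v' in sources N | threshold_set P1 sg P2 rh v v') w v'.

(** The smaller of [rh v], infinite outside [P2], and the root in [T] of [u * (j * T - c) = W]: at
    horizons below both, the cut of [v] is violated as soon as [T + sg] is nonnegative at the sink.
    For [j = 0] the quotient is 0 by convention, and bounds that are not positive are ignored. *)
Definition candidate j (c : R) P1 sg P2 rh v : R :=
  let W := threshold_weight P1 sg P2 rh v in
  if P2 v && (u * (j%:R * rh v - c) <= W) then rh v else (W / u + c) / j%:R.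

Lemma candidate_valid x a j P1 sg P2 rh v T :
  (forall i, (i < j)%N -> a i != sink N) -> has_supplies x a j ->
  partial_potential x P1 sg -> partial_potential x P2 rh ->
  P2 (sink N) -> rh (sink N) = 0 -> (forall i, (i < j)%N -> P1 (a i) && (sg (a i) <= 0)) ->
  v \in sources N -> ~~ P1 v || (0 <= sg v) ->
  let tc := candidate j (flow_cost x) P1 sg P2 rh v in
  (P1 (sink N) -> - sg (sink N) < tc) -> 0 < tc -> 0 <= T ->
  cut_condition N w T -> tc <= T.
Proof.
move=> aj hs pp1 pp2 P2s rhs sga vS okv tc Ltc tc0 T0 cT.
rewrite leNgt; apply/negP => Ttc.
(* The cut of [v] must have potential 0 at the sink, which requires [T + sg (sink N) >= 0]. A
   smaller [T] is raised to that point: monotonicity permits it, and [T2] is still below the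
   candidate. *)
pose T2 := if P1 (sink N) then Num.max T (- sg (sink N)) else T.
have TT2 : T <= T2 by rewrite /T2; case: ifP => // _; rewrite le_max lexx.
have T2tc : T2 < tc by rewrite /T2; case: ifP => // P1s; rewrite gt_max Ttc Ltc.
have c2 : cut_condition N w T2 by apply: cut_condition_mono cT => //; rewrite T0.
set W := threshold_weight P1 sg P2 rh v.
have WP : P2 v -> tc <= rh v.
  rewrite /tc /candidate -/W => -> /=; case: (leP _ W) => // WL.
  have j0 : (0 < j)%N.
    rewrite lt0n; apply/eqP => j0; move: WL; rewrite j0 mul0r sub0r.
    have : 0 <= W by apply: sumr_ge0 => v' /andP[v'S _]; case: sd => /(_ _ v'S)/ltW.
    have := mulr_ge0 (ltW u0) (flow_cost_ge0 x); lra.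
  rewrite ler_pdivrMr ?ltr0n// -lerBrDr ler_pdivrMr// mulrC (mulrC (rh v)); exact: ltW.
have WT : W <= u * (j%:R * T2 - flow_cost x).
  apply: (partial_cut (a := a) (P1 := P1) (sg := sg) (P2 := P2) (rh := rh)) => //.
    by move=> P1s; rewrite /T2 P1s -lerBlDr sub0r le_max lexx orbT.
  move=> v' v'S /andP[h1 h2]; apply/andP; split; first by rewrite implybE.
  rewrite implybE; case: (P2 v') h2 => //= /andP[P2v rr].
  by apply: le_trans rr; apply: le_trans (WP P2v); exact: ltW.
have W0 : 0 < W.
  have tv : threshold_set P1 sg P2 rh v v.
    by rewrite /threshold_set okv/=; case: (P2 v); rewrite //= lexx.
  rewrite /W /threshold_weight (bigD1 v)/=; last by rewrite vS.
  rewrite ltr_pwDl//; first by case: sd => ->.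
  by apply: sumr_ge0 => v' /andP[/andP[v'S _] _]; case: sd => /(_ _ v'S)/ltW.
have j0 : (0 < j)%N.
  rewrite lt0n; apply/eqP => j0; move: WT; rewrite j0 mul0r sub0r.
  have := mulr_ge0 (ltW u0) (flow_cost_ge0 x); lra.
have jR : 0 < j%:R :> R by rewrite ltr0n.
move: T2tc; rewrite /tc /candidate -/W; case: ifP => [/andP[_ h1] h2|_].
  have : u * (j%:R * T2 - flow_cost x) < u * (j%:R * rh v - flow_cost x).
    by rewrite ltr_pM2l// ltrD2r ltr_pM2l.
  lra.
rewrite ltr_pdivlMr// -ltrBlDr ltr_pdivlMr// => h.
by move: WT; rewrite mulrC (mulrC _ T2) leNgt h.
Qed.

(** * Optimal static flows and exchange arguments *)

Definition flow_from (A : {set 'I_n}) x : bool :=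
  [forall v, (v != sink N) ==> (0 <= bal x v) && ((v \notin A) ==> (bal x v == 0))].

(** Ford and Fulkerson's formula for the amount sent within [T] by repeating [x] over time, in units
    of the capacity. The value of the flow is minus its balance at the sink. *)
Definition lagrangian T x : R := T * - bal x (sink N) - flow_cost x.

(** Among the maximisers a flow of largest value is taken: this also excludes a further augmentation
    of length exactly [T], and so yields [T < rh] on [A]. *)
Definition optimal_flow (A : {set 'I_n}) T x : Prop :=
  flow_from A x /\ forall y, flow_from A y ->
    lagrangian T y < lagrangian T x \/
    lagrangian T y = lagrangian T x /\ - bal y (sink N) <= - bal x (sink N).

Lemma optimal_flow_exists A T : exists x, optimal_flow A T x.
Proof.
have ext (f g : 'I_m -> bool) v : f =1 g -> bal f v = bal g v.
  by move=> fg; rewrite /bal; congr (_ - _); apply: eq_bigr => e _; rewrite fg.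
have extc (f g : 'I_m -> bool) : f =1 g -> flow_cost f = flow_cost g.
  by move=> fg; apply: eq_bigr => e _; rewrite fg.
have extF (f g : 'I_m -> bool) : f =1 g -> flow_from A f = flow_from A g.
  by move=> fg; apply: eq_forallb => v; rewrite (ext f g).
pose z : {ffun 'I_m -> bool} := [ffun=> false].
have z0 : flow_from A z.
  apply/forallP => v; apply/implyP => _.
  have -> : bal z v = 0 by rewrite /bal !big1 ?subrr// => e _; rewrite ffunE.
  by rewrite lexx eqxx implybT.
have [x1 x1F x1M] := @arg_maxP _ _ _ z (fun y : {ffun 'I_m -> bool} => flow_from A y)
  (fun y => lagrangian T y) z0.
have x1P : flow_from A x1 && (lagrangian T x1 == lagrangian T x1) by rewrite x1F eqxx.
have [x2 /andP[x2F /eqP x2E] x2M] := @arg_maxP _ _ _ x1 (fun y : {ffun 'I_m -> bool} =>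
  flow_from A y && (lagrangian T y == lagrangian T x1)) (fun y => - bal y (sink N)) x1P.
exists x2; split=> // y yF.
pose yf : {ffun 'I_m -> bool} := [ffun e => y e].
have yE : yf =1 y by move=> e; rewrite ffunE.
have yfF : flow_from A yf by rewrite (extF _ _ yE).
have LE : lagrangian T yf = lagrangian T y by rewrite /lagrangian (ext _ _ _ yE) (extc _ _ yE).
have := x1M _ yfF; rewrite /Order.ge /= le_eqVlt x2E LE => /predU1P[h|]; last by left.
right; split=> //; have := x2M yf; rewrite yfF LE h eqxx => /(_ isT).
by rewrite /Order.ge /= (ext _ _ _ yE).
Qed.

(** A residual potential certifies least cost for the given balances. This is how the flow of a
    stage, computed without knowledge of [A] and [T], turns out to be optimal for them. *)
Lemma optimal_flow_transfer A T x y beta : optimal_flow A T x ->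
  (forall v, bal y v = bal x v) -> residual_potential y beta -> optimal_flow A T y.
Proof.
move=> [xF xM] yx yp; split.
  by move: xF; congr is_true; apply: eq_forallb => v; rewrite yx.
have LL : lagrangian T x <= lagrangian T y.
  by rewrite /lagrangian yx lerB// (min_cost yp).
move=> y' y'F; rewrite yx; have [h|[h1 h2]] := xM _ y'F.
  by left; exact: lt_le_trans h LL.
by move: LL; rewrite -h1 le_eqVlt => /predU1P[->|]; [right|left].
Qed.

(** Ranks strictly decrease along the path, so each arc is reversed at most once and still has its
    direction in [x] when its turn comes; the last clause carries this through the induction. *)
Lemma augment_exists x (P term : pred 'I_n) (y : 'I_n -> R) (rk : 'I_n -> nat) :
  (forall v, P v -> ~~ term v -> exists e, [/\ rfrom x e = v, P (rto x e),
     (rk (rto x e) < rk v)%N & y v = y (rto x e) + rlen x e]) ->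
  forall v, P v -> exists x1 t, [/\ P t, term t,
     forall v0, bal x1 v0 = bal x v0 + (v0 == v)%:R - (v0 == t)%:R,
     flow_cost x1 = flow_cost x + (y v - y t) &
     forall e, x1 e != x e -> (rk (rfrom x e) <= rk v)%N].
Proof.
move=> H v; have [k] := ubnP (rk v); elim: k v => // k IHk v rkv Pv.
have [tv|ntv] := boolP (term v).
  exists x, v; split=> //; [by move=> v0; ring|by ring|by move=> e; rewrite eqxx].
have [e0 [h1 h2 h3 h4]] := H v Pv ntv.
have [|x1 [t [Pt tt balx1 costx1 difx1]]] := IHk _ _ h2; first by apply: leq_trans h3 _;
  rewrite -ltnS.
have same : x1 e0 = x e0.
  by apply/eqP; apply: contraT => /difx1; rewrite h1 leqNgt h3.
have sf : rfrom x1 e0 = v by rewrite /rfrom same; move: h1; rewrite /rfrom.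
have st : rto x1 e0 = rto x e0 by rewrite /rto same.
have sl : rlen x1 e0 = rlen x e0 by rewrite /rlen same.
exists (flip x1 e0), t; split=> //.
- by move=> v0; rewrite bal_flip sf st balx1; ring.
- by rewrite flow_cost_flip sl costx1 h4; ring.
- move=> e; rewrite /flip; case: (e =P e0) => [-> _|_ /difx1 r]; first by rewrite h1.
  exact: leq_trans r (ltnW h3).
Qed.

Lemma flow_fromP A x : reflect
  (forall v, v != sink N -> 0 <= bal x v /\ (v \notin A -> bal x v = 0)) (flow_from A x).
Proof.
apply: (iffP forallP) => [H v vs|H v].
  by have /implyP/(_ vs)/andP[h1 /implyP h2] := H v; split=> // /h2/eqP.
by apply/implyP => vs; have [-> h] := H v vs; apply/implyP => /h ->.
Qed.

(** If [r <= T], one more unit from [v] would not lower the Lagrangian and would raise the value,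
    against the tie-break. *)
Lemma optimal_to_sink A T x x1 v (r : R) : optimal_flow A T x -> v \in A ->
  v != sink N ->
  (forall v0, bal x1 v0 = bal x v0 + (v0 == v)%:R - (v0 == sink N)%:R) ->
  flow_cost x1 = flow_cost x + r -> T < r.
Proof.
move=> [xF xM] vA vs b1 c1; rewrite ltNge; apply/negP => rT.
have x1F : flow_from A x1.
  apply/flow_fromP => v0 v0s; rewrite b1 (negbTE v0s) subr0.
  have [h1 h2] := flow_fromP _ _ xF v0 v0s.
  split; first by rewrite addr_ge0.
  move=> v0A; rewrite h2//; case: eqP => [vv|_]; last by rewrite addr0.
  by move: v0A; rewrite vv vA.
have bs : - bal x1 (sink N) = - bal x (sink N) + 1.
  by rewrite b1 eqxx eq_sym (negbTE vs) /=; ring.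
have := xM _ x1F; rewrite /lagrangian bs c1.
have -> : T * (- bal x (sink N) + 1) - (flow_cost x + r) =
  T * - bal x (sink N) - flow_cost x + (T - r) by ring.
by move=> [h|[h1 h2]]; lra.
Qed.

(** Trading a unit supplied by [t] for one supplied by [v] keeps the value of the flow, so it cannot
    be cheaper. *)
Lemma optimal_swap A T x x1 v t (r : R) : optimal_flow A T x -> v \in A ->
  v != sink N -> t != sink N -> 1 <= bal x t ->
  (forall v0, bal x1 v0 = bal x v0 + (v0 == v)%:R - (v0 == t)%:R) ->
  flow_cost x1 = flow_cost x + r -> 0 <= r.
Proof.
move=> [xF xM] vA vs ts bt b1 c1; rewrite leNgt; apply/negP => r0.
have x1F : flow_from A x1.
  apply/flow_fromP => v0 v0s; rewrite b1.
  have [h1 h2] := flow_fromP _ _ xF v0 v0s.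
  split.
    have [->|_] := eqVneq v0 t; last by rewrite subr0 addr_ge0.
    by rewrite subr_ge0 ler_wpDr.
  move=> v0A; have h3 := h2 v0A; rewrite h3 add0r.
  have -> : (v0 == v) = false by apply: contraNF v0A => /eqP ->.
  have -> : (v0 == t) = false by apply/eqP => vt; move: bt; rewrite -vt h3 ler10.
  by rewrite subrr.
have bs : - bal x1 (sink N) = - bal x (sink N).
  by rewrite b1 !(eq_sym (sink N)) (negbTE vs) (negbTE ts) /=; ring.
have := xM _ x1F; rewrite /lagrangian bs c1.
by move=> [h|[h1 h2]]; lra.
Qed.

(** Cancelling a unit of [t] costs [T] in the Lagrangian, so it cannot save more than that. *)
Lemma optimal_from_sink A T x x1 t (r : R) : optimal_flow A T x ->
  t != sink N -> 1 <= bal x t ->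
  (forall v0, bal x1 v0 = bal x v0 + (v0 == sink N)%:R - (v0 == t)%:R) ->
  flow_cost x1 = flow_cost x + r -> - r <= T.
Proof.
move=> [xF xM] ts bt b1 c1; rewrite leNgt; apply/negP => r0.
have x1F : flow_from A x1.
  apply/flow_fromP => v0 v0s; rewrite b1 (negbTE v0s) addr0.
  have [h1 h2] := flow_fromP _ _ xF v0 v0s.
  split; first by have [->|_] /= := eqVneq v0 t; rewrite ?subr0// subr_ge0.
  move=> v0A; have h3 := h2 v0A; rewrite h3 add0r.
  have -> : (v0 == t) = false by apply/eqP => vt; move: bt; rewrite -vt h3 ler10.
  by rewrite oppr0.
have bs : - bal x1 (sink N) = - bal x (sink N) - 1.
  by rewrite b1 eqxx eq_sym (negbTE ts) /=; ring.
have := xM _ x1F; rewrite /lagrangian bs c1.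
have -> : T * (- bal x (sink N) - 1) - (flow_cost x + r) =
  T * - bal x (sink N) - flow_cost x + (- r - T) by ring.
by move=> [h|[h1 h2]]; lra.
Qed.

Lemma candidate_complete x j A T (P1 : pred 'I_n) sg (P2 : pred 'I_n) rh :
  A \subset sources N -> A != finset.set0 ->
  (forall v, v \in A -> P2 v -> T < rh v) ->
  (forall v, v \in A -> P1 v -> 0 <= sg v) ->
  (j = 0%N -> forall v, v \in A -> P2 v) ->
  u * (j%:R * T - flow_cost x) < \sum_(v in A) w v ->
  exists v, [/\ v \in sources N, ~~ P1 v || (0 <= sg v) &
     T < candidate j (flow_cost x) P1 sg P2 rh v].
Proof.
move=> AS /set0Pn[v1 v1A] hr hs j0 wA.
have okA v : v \in A -> ~~ P1 v || (0 <= sg v).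
  by move=> vA; have := hs v vA; case: (P1 v) => //= ->.
(* [v] is an element of [A] nearest to the sink, or any element if none reaches it; all of [A] then
   lies in its threshold set. *)
have [v [vA vmin]] : exists v, v \in A /\ forall v', v' \in A -> P2 v' -> P2 v && (rh v
  <= rh v').
  have [/existsP[v2 /andP[v2A v2P]]|noP] := boolP [exists v, (v \in A) && P2 v]; last first.
    exists v1; split=> // v' v'A Pv'; move: noP; rewrite negb_exists => /forallP/(_ v').
    by rewrite v'A Pv'.
  have v2' : (fun v => (v \in A) && P2 v) v2 by rewrite v2A.
  have [v /andP[vA Pv] vM] := @arg_minP _ _ _ v2 (fun v => (v \in A) && P2 v) rh v2'.
  exists v; split=> // v' v'A Pv'; rewrite Pv /=.
  by apply: vM; rewrite v'A.
exists v; split; [exact: (fintype.subsetP AS)|exact: okA|].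
set W := threshold_weight P1 sg P2 rh v.
have wW : \sum_(v in A) w v <= W.
  rewrite big_mkcond /W /threshold_weight [leRHS]big_mkcond; apply: ler_sum => v' _.
  have [v'A|_] := boolP (v' \in A).
    have v'S := fintype.subsetP AS _ v'A.
    rewrite v'S /= ifT// /threshold_set okA//=.
    by have := vmin _ v'A; case: (P2 v') => //= ->.
  by case: ifP => // /andP[v'S _]; case: sd => /(_ _ v'S)/ltW.
rewrite /candidate -/W; case: ifP => [/andP[Pv _]|hn]; first exact: hr.
have jp : (0 < j)%N.
  rewrite lt0n; apply/eqP => jz; move: hn; rewrite (j0 jz v vA) /= jz mul0r sub0r => /negbT.
  rewrite -ltNge; have := mulr_ge0 (ltW u0) (flow_cost_ge0 x).
  have : 0 < \sum_(v in A) w v.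
    rewrite (bigD1 v1)//= ltr_pwDl//; first by case: sd => -> //; exact: (fintype.subsetP AS).
    apply: sumr_ge0 => v' /andP[v'A _]; case: sd => h _ _ _; apply/ltW/h.
    exact: (fintype.subsetP AS).
  lra.
have jR : 0 < j%:R :> R by rewrite ltr0n.
rewrite ltr_pdivlMr// -ltrBlDr ltr_pdivlMr//.
by apply: lt_le_trans wW; move: wA; rewrite mulrC (mulrC _ T).
Qed.

(* A flow with supplies [a 0, ..., a j] crosses the boundary of the set of
   unreachable vertices, which [x] already saturates. *)
Lemma reach_next x a j y (P : pred 'I_n) :
  (forall i, (i <= j)%N -> a i != sink N) ->
  P (sink N) -> (forall e, P (rto x e) -> P (rfrom x e)) ->
  has_supplies x a j ->
  (forall v, v != sink N -> supply_count a j.+1 v <= bal y v) -> P (a j).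
Proof.
move=> aj Ps Pc hx hy; apply: contraT => nP.
pose ind v : R := (~~ P v)%:R.
have inds : ind (sink N) = 0 by rewrite /ind Ps.
have hle : \sum_v bal y v * ind v <= \sum_v bal x v * ind v.
  rewrite -!bal_potential; apply: ler_sum => e _.
  have := Pc e; rewrite /rto /rfrom /ind; case: (x e); case: (y e); case: (P (etail N e));
   case: (P (ehead N e)) => /=; rewrite ?subrr ?mulr0 ?mul0r ?mul1r//; try (by move=> /(_
     isT)); lra.
have xE : \sum_v bal x v * ind v = \sum_(i < j) ind (a i).
  by apply: has_supplies_sum => // i ij; apply: aj; exact: ltnW.
have : \sum_(i < j.+1) ind (a i) <= \sum_v bal y v * ind v.
  rewrite [leRHS](bigD1 (sink N))//= inds mulr0 add0r.
  have aj' i : (i < j.+1)%N -> a i != sink N by exact: aj.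
  rewrite -(supply_sum ind aj').
  by apply: ler_sum => v vs; rewrite ler_wpM2r// hy.
have indj : ind (a j) = 1 by rewrite /ind nP.
by rewrite big_ord_recr/= indj => h; suff: False by []; lra.
Qed.

(** Potential [T] outside [P] and 0 inside gives a cut of value 0, because no edge leads into [P]
    from outside; so no supply can lie outside. *)
Lemma reach_sources (P : pred 'I_n) T : 0 <= T -> cut_condition N w T ->
  P (sink N) -> (forall e, P (ehead N e) -> P (etail N e)) ->
  forall v, v \in sources N -> P v.
Proof.
move=> T0 cc Ps Pc v vS; apply: contraT => nP.
pose beta v := if P v then 0 else T.
have bs : beta (sink N) = 0 by rewrite /beta Ps.
have := cc _ bs; have -> : cut_value N beta = 0.
  rewrite /cut_value big1// => e _; apply/max_idPl; have := Pc e; have := transit_gt0 N e.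
  by rewrite /beta; case: (P (ehead N e)); case: (P (etail N e)) => // t0 h; try lra;
    have := h isT.
rewrite mulr0 (bigD1 v)/=; last by rewrite vS /beta (negbTE nP) lexx.
rewrite leNgt ltr_pwDl//; first by case: sd => ->.
by apply: sumr_ge0 => v' /andP[/andP[v'S _] _]; case: sd => /(_ _ v'S)/ltW.
Qed.

(** [A] collects the sources counted by a violated cut. Weak duality passes the violation on to
    every flow whose supplies lie in [A], after which the potential can be forgotten. *)
Lemma violated_cut T : 0 <= T -> ~ cut_condition N w T ->
  exists (A : {set 'I_n}), [/\ A \subset sources N, A != finset.set0 &
    forall x a j, (forall i, (i < j)%N -> a i \in A) -> has_supplies x a j ->
      u * (j%:R * T - flow_cost x) < \sum_(v in A) w v].
Proof.
move=> T0 /existsNP[beta /not_implyP[bs /negP]]; rewrite -ltNge => viol.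
pose A := [set v in sources N | T <= beta v].
have wA : \sum_(v in A) w v = \sum_(v in sources N | T <= beta v) w v.
  by apply: eq_bigl => v; rewrite inE.
exists A; split.
- by apply/fintype.subsetP => v; rewrite inE => /andP[].
- apply/eqP => A0; move: viol; rewrite -wA A0 big_set0 ltNge mulr_ge0 ?(ltW u0)//.
  by apply: sumr_ge0 => e _; rewrite le_max lexx.
- move=> x a j aA hs; rewrite wA; apply: le_lt_trans viol.
  rewrite ler_pM2l//; apply: le_trans (weak_duality x beta).
  have aj i : (i < j)%N -> a i != sink N.
    move=> /aA; rewrite inE => /andP[aS _]; apply/eqP => E.
    by move: (sink_notin_sources N); rewrite -E aS.
  rewrite lerD2r (has_supplies_sum aj hs bs) -[j in leLHS]card_ord mulr_natl -sumr_const.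
  by apply: ler_sum => i _; have := aA i (ltn_ord i); rewrite inE => /andP[].
Qed.

Lemma supplies_exist A T x v0 : A \subset sources N -> v0 \in sources N -> optimal_flow A T x ->
  exists (a : nat -> 'I_n) j, [/\ (j <= sink_indegree N)%N, forall i, a i \in sources N,
     forall i, (i < j)%N -> a i \in A & has_supplies x a j].
Proof.
move=> AS v0S [/flow_fromP xF _].
pose outn v := (\sum_(e | etail N e == v) x e)%N.
pose inn v := (\sum_(e | ehead N e == v) x e)%N.
have balE v : bal x v = (outn v)%:R - (inn v)%:R by rewrite /bal /outn /inn !natr_sum.
pose c v := if v == sink N then 0%N else (outn v - inn v)%N.
have cE v : v != sink N -> bal x v = (c v)%:R.
  move=> vs; have [h _] := xF v vs; move: h; rewrite balE subr_ge0 ler_nat => h.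
  by rewrite /c (negbTE vs) natrB.
have cA v : (0 < c v)%N -> v \in A.
  move=> c0; apply: contraT => vA; have vs : v != sink N by apply: contraTneq c0 => ->;
    rewrite /c eqxx.
  have [_ /(_ vA)/eqP] := xF v vs; rewrite cE// pnatr_eq0 => /eqP h; by rewrite h in c0.
pose s := flatten [seq nseq (c v) v | v <- enum 'I_n].
have scount v : count_mem v s = c v.
  rewrite /s count_flatten -map_comp sumnE big_map big_enum /=.
  rewrite (bigD1 v)//= count_nseq /= eqxx mul1n big1 ?addn0// => v' /negbTE v'v.
  by rewrite count_nseq /= v'v mul0n.
have sA v : v \in s -> v \in A.
  by rewrite -has_pred1 has_count scount => /cA.
(* Each source is repeated according to its balance, so the length is the flow value, at most the
   in-degree of the sink. Padding with [v0] allows tuples of full length [d] to be enumerated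
   whatever [j] is. *)
exists (nth v0 s), (size s); split.
- have szE : size s = (\sum_(v | v != sink N) c v)%N.
    rewrite /s size_flatten /shape -map_comp sumnE big_map big_enum /=.
    rewrite (bigD1 (sink N))//= size_nseq /c eqxx add0n; apply: eq_bigr => v /negbTE vs.
    by rewrite size_nseq vs.
  rewrite -(ler_nat R) szE natr_sum (eq_bigr (fun v => bal x v)); last by move=> v vs;
    rewrite cE.
  have := bal_sink x; rewrite balE => E.
  have -> : \sum_(v | v != sink N) bal x v = (inn (sink N))%:R - (outn (sink N))%:R by lra.
  apply: le_trans (_ : (inn (sink N))%:R <= _); first by rewrite gerBl.
  rewrite ler_nat /inn sink_indegreeE.
  by apply: leq_sum => e _; case: (x e).
- move=> i; have [h|h] := ltnP i (size s); last by rewrite nth_default.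
  by apply: (fintype.subsetP AS); apply: sA; exact: mem_nth.
- by move=> i ij; apply: sA; exact: mem_nth.
- move=> v vs; rewrite cE// -scount /supply_count -natr_sum; congr (_%:R).
  rewrite -sum1_count big_mkcond /= (big_nth v0) big_mkord.
  by apply: eq_bigr => i _; rewrite /=; case: eqP.
Qed.

End static_flows.

(** * Dijkstra's algorithm *)

(* Integer arrays are named with a final A, real arrays with a final R; variables
   are cells 0, those of integer type have names ending in V or V2. *)
Local Notation pN := (IGet 0 (ICst 0)).
Local Notation pM := (IGet 0 (ICst 1)).
Local Notation pS := (IGet 0 (ICst 2)).
Local Notation tailA := 1%N.
Local Notation headA := 2%N.
Local Notation flagA := 3%N.
Local Notation srcA := 4%N.
Local Notation kV := 5%N.
Local Notation dV := 6%N.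
Local Notation powV := 7%N.
Local Notation qV := 8%N.
Local Notation digA := 9%N.
Local Notation jV := 10%N.
Local Notation aliveV := 11%N.
Local Notation fromA := 12%N.
Local Notation toA := 13%N.
Local Notation setA := 14%N.
Local Notation parA := 15%N.
Local Notation okA := 16%N.
Local Notation foundV := 17%N.
Local Notation beV := 18%N.
Local Notation lflagV := 19%N.
Local Notation curV := 20%N.
Local Notation carryV := 21%N.
Local Notation ieV := 22%N.
Local Notation itV := 23%N.
Local Notation ivV := 24%N.
Local Notation ivV2 := 25%N.
Local Notation inV := 26%N.
Local Notation iaV := 27%N.
Local Notation tmpV := 28%N.
Local Notation bestR := 3%N.
Local Notation lenR := 4%N.
Local Notation piR := 5%N.
Local Notation dR := 6%N.
Local Notation bkR := 7%N.
Local Notation mvR := 8%N.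
Local Notation cR := 9%N.
Local Notation jR := 10%N.
Local Notation wbR := 11%N.
Local Notation tcR := 12%N.
Local Notation llR := 13%N.

Fixpoint prog (l : seq program) : program :=
  match l with [::] => Skip | [:: p] => p | p :: l' => Seq p (prog l') end.

Definition is1 (x : iexpr) : test := ILe (ICst 1) x.
Definition is0 (x : iexpr) : test := ILe x (ICst 0).
Definition tor (b1 b2 : test) : test := TNot (TAnd (TNot b1) (TNot b2)).

Section dijkstra_math.
Variables (R : realType) (nn mm : nat) (fr to : nat -> nat) (len pi : nat -> R) (z : nat).

(** The search runs backwards from [z]: [D] measures the distance to [z] in reduced lengths
    [pi (to e) + len e - pi (fr e)], nonnegative by [pip] although reversed edges have negative
    length. The true distance is [D v + pi v - pi z]. *)
Definition dkey (D : nat -> R) e := D (to e) + pi (to e) + len e - pi (fr e).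

Definition upd1 (A : Type) (f : nat -> A) i x := fun j => if j == i then x else f j.

Definition crossing (st : nat -> nat) e := (st (to e) == 1%N) && (st (fr e) == 0%N).

(* [st] marks the settled vertices, after [k] rounds with last key [M]; in the last
   clause, either no arc enters the settled set any more, or it has grown in
   every round. *)
Record dij_inv (k : nat) (st : nat -> nat) (D : nat -> R) (par : nat -> nat) (M : R) :
  Prop := DijInv {
  dij_le1 : forall v, (v < nn)%N -> (st v <= 1)%N;
  dij_z : st z = 1%N;
  dij_Dz : D z = 0;
  dij_M0 : 0 <= M;
  dij_D : forall v, (v < nn)%N -> st v = 1%N -> 0 <= D v <= M;
  dij_arc : forall e, (e < mm)%N -> st (fr e) = 1%N -> st (to e) = 1%N ->
    D (fr e) + pi (fr e) <= D (to e) + pi (to e) + len e;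
  dij_cross : forall e, (e < mm)%N -> crossing st e -> M <= dkey D e;
  dij_par : exists rk : nat -> nat, forall v, (v < nn)%N -> st v = 1%N ->
    (rk v <= k)%N /\
    (v <> z -> [/\ (par v < mm)%N, fr (par v) = v, st (to (par v)) = 1%N,
      (rk (to (par v)) < rk v)%N
      & D v + pi v = D (to (par v)) + pi (to (par v)) + len (par v)]);
  dij_count : (forall e, (e < mm)%N -> ~~ crossing st e) \/
    (k < count (fun v => st v == 1%N) (iota 0 nn))%N }.

Hypothesis frn : forall e, (e < mm)%N -> (fr e < nn)%N.
Hypothesis ton : forall e, (e < mm)%N -> (to e < nn)%N.
Hypothesis zn : (z < nn)%N.
Hypothesis pip : forall e, (e < mm)%N -> pi (fr e) <= pi (to e) + len e.

Lemma dij_init (st : nat -> nat) D par : (forall v, (v < nn)%N -> st v = (v == z)) -> D z = 0 ->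
  dij_inv 0 st D par 0.
Proof.
move=> stE Dz; have st1 v : (v < nn)%N -> st v = 1%N -> v = z.
  by move=> /stE ->; case: eqP.
split=> //.
- by move=> v /stE ->; case: eqP.
- by rewrite stE// eqxx.
- by move=> v vn /(st1 _ vn) ->; rewrite Dz lexx.
- move=> e em /(st1 _ (frn em)) E1 /(st1 _ (ton em)) E2.
  by have := pip em; rewrite E1 E2; lra.
- move=> e em /andP[/eqP/(st1 _ (ton em)) E1 _]; have := pip em.
  by rewrite /dkey E1 Dz; lra.
- by exists (fun=> 0%N) => v vn /(st1 _ vn) ->.
- right; rewrite -has_count; apply/hasP; exists z; first by rewrite mem_iota.
  by rewrite stE// eqxx.
Qed.

Lemma dij_stop k st D par M : dij_inv k st D par M ->
  (forall e, (e < mm)%N -> ~~ crossing st e) -> dij_inv k.+1 st D par M.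
Proof.
move=> [h1 h2 h3 h4 h5 h6 h7 [rk h8] h9] nc; split=> //; last by left.
by exists rk => v vn /(h8 _ vn) [h ?]; split=> //; exact: leqW.
Qed.

(** Nonnegative reduced lengths keep the new [M] below the keys of the arcs that start to cross, and
    the rank [k.+1] of the new vertex keeps the parent arcs acyclic. *)
Lemma dij_step k st D par M be : dij_inv k st D par M -> (be < mm)%N ->
  crossing st be -> (forall e, (e < mm)%N -> crossing st e -> dkey D be <= dkey D e) ->
  dij_inv k.+1 (upd1 st (fr be) 1%N) (upd1 D (fr be) (dkey D be))
    (upd1 par (fr be) be) (dkey D be).
Proof.
move=> [h1 h2 h3 h4 h5 h6 h7 [rk h8] h9] bm cb mini.
have Mle : M <= dkey D be by exact: h7.
move: (cb) => /andP[/eqP stt /eqP stf].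
set p := fr be in stf *.
have pz : p <> z by move=> E; move: stf; rewrite E h2.
have tp e : st (to e) = 1%N -> to e <> p by move=> E1 E2; rewrite E2 stf in E1.
split.
- by move=> v vn; rewrite /upd1; case: eqP => // _; exact: h1.
- by rewrite /upd1; case: eqP.
- by rewrite /upd1; case: eqP => // /esym.
- exact: le_trans Mle.
- move=> v vn; rewrite /upd1; case: eqP => [_ _|_ /(h5 v vn)/andP[-> /le_trans ->//]].
  by rewrite lexx (le_trans h4).
- move=> e em; rewrite /upd1; case: eqP => [Ef _|Ef stfe]; case: eqP => [Et _|Et stte].
  + by have := pip em; lra.
  + have := mini e em; rewrite /crossing stte Ef stf eqxx => /(_ isT).
    by rewrite /dkey Ef -/p; lra.
  + have /andP[_ De] := h5 _ (frn em) stfe; have := pip em; rewrite Et -/p; lra.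
  + exact: h6.
- move=> e em; rewrite /crossing /upd1; case: (fr e =P p) => [_|Ef]; first by rewrite andbF.
  case: (to e =P p) => [Et /= stfe|Et cr].
    rewrite /dkey Et eqxx; have := pip em; rewrite Et /dkey; lra.
  rewrite /dkey; case: eqP => // _; exact: mini.
- exists (upd1 rk p k.+1) => v vn; rewrite /upd1; case: (v =P p) => [-> _|vp stv].
    have /eqP/negbTE tbp := tp _ stt; rewrite tbp.
    split=> // _; split=> //.
      by have [+ _] := h8 _ (ton bm) stt; rewrite ltnS.
    by rewrite /dkey -/p; ring.
  have [h10 h11] := h8 v vn stv; split; first exact: leqW.
  move=> /h11 [g1 g2 g3 g4 g5]; have /eqP/negbTE tpp := tp _ g3.
  by rewrite tpp; split.
- case: h9 => [/(_ _ bm)|h9]; first by rewrite cb.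
  right; have pn : p \in iota 0 nn by rewrite mem_iota add0n frn.
  have -> : count (fun v => upd1 st p 1%N v == 1%N) (iota 0 nn) =
      count (predU (fun v => st v == 1%N) (pred1 p)) (iota 0 nn).
    by apply: eq_count => v; rewrite /upd1 /=; case: (v =P p); rewrite ?orbT ?orbF.
  have := count_predUI (fun v => st v == 1%N) (pred1 p) (iota 0 nn).
  rewrite (count_uniq_mem _ (iota_uniq _ _)) pn.
  have -> : count (predI (fun v => st v == 1%N) (pred1 p)) (iota 0 nn) = 0%N.
    rewrite (eq_count (a2 := pred0)) ?count_pred0// => v /=.
    by case: (v =P p) => [->|]; rewrite ?stf ?andbF.
  by lia.
Qed.

(** The settled set cannot have grown in each of [nn] rounds, so no arc enters it any more. *)
Lemma dij_closed k st D par M : (nn <= k)%N -> dij_inv k st D par M ->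
  forall e, (e < mm)%N -> st (to e) = 1%N -> st (fr e) = 1%N.
Proof.
move=> nk [h1 _ _ _ _ _ _ _ [nc|hc]] e em ste; last first.
  by have := leq_trans hc (count_size _ _); rewrite size_iota ltnNge nk.
have := nc e em; rewrite /crossing ste eqxx /= => stf.
by have := h1 _ (frn em); case: (st (fr e)) stf => [|[]].
Qed.

End dijkstra_math.

(** * Dijkstra's algorithm as a program *)

Ltac simp_mem :=
  repeat match goal with
  | |- context [@upd ?A ?m ?a ?i ?x ?b] =>
      first [ change (@upd A m a i x b) with (m b) | rewrite (upd_row m a i x) ]
  end.

Local Notation key_expr := (RSub (RAdd (RAdd (RGet dR (IGet toA (iget ieV)))
    (RGet piR (IGet toA (iget ieV)))) (RGet lenR (iget ieV)))
    (RGet piR (IGet fromA (iget ieV)))).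

Definition search_prog : program := prog [:: iset foundV (ICst 0);
  For ieV (IAdd pM (iget jV))
   (Cond (TAnd (is1 (IGet setA (IGet toA (iget ieV))))
               (is0 (IGet setA (IGet fromA (iget ieV)))))
     (Cond (tor (is0 (iget foundV)) (TNot (RLe (rget bkR) key_expr)))
        (prog [:: iset foundV (ICst 1); iset beV (iget ieV); rset bkR key_expr])
        Skip)
     Skip)].

(** [zi] is the cell of integer array 0 that holds the target: cell 2 holds the sink, and cell 0
    holds [n], which is also the number of the additional vertex. *)
Definition dij_prog (zi : nat) : program := prog [::
  For ivV (IAdd pN (ICst 1)) (ISet setA (iget ivV) (ICst 0));
  prog [:: ISet setA (IGet 0 (ICst zi)) (ICst 1); RSet dR (IGet 0 (ICst zi)) (RCst 0);
           rset mvR (RCst 0)];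
  For itV (IAdd pN (ICst 1)) (prog [:: search_prog;
    Cond (is1 (iget foundV))
      (prog [:: RSet dR (IGet fromA (iget beV)) (rget bkR);
                ISet parA (IGet fromA (iget beV)) (iget beV);
                rset mvR (rget bkR);
                ISet setA (IGet fromA (iget beV)) (ICst 1)])
      Skip])].

Section dij_spec.
Variable R : realType.
Implicit Types s : state R.

Lemma search_spec s (mm := (imem s 0 1 + imem s jV 0)%N) :
  (forall e, (e < mm)%N -> (imem s setA (imem s toA e) <= 1)%N) ->
  wp search_prog (150 * mm.+1) s (fun s' =>
    let cr := crossing (imem s fromA) (imem s toA) (imem s setA) in
    let key := dkey (imem s fromA) (imem s toA) (rmem s lenR) (rmem s piR) (rmem s dR) in
    (imem s' foundV 0 = 0%N /\ forall e, (e < mm)%N -> ~~ cr e) \/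
    (imem s' foundV 0 = 1%N /\ [/\ (imem s' beV 0 < mm)%N, cr (imem s' beV 0),
       rmem s' bkR 0 = key (imem s' beV 0) &
       forall e, (e < mm)%N -> cr e -> key (imem s' beV 0) <= key e])).
Proof.
move=> st1.
set cr := crossing _ _ _; set key := dkey _ _ _ _ _.
apply: (wp_seqf (c1 := 3) (Q1 := fun s1 => imem s1 foundV 0 = 0%N)).
- by apply: wp_run.
- move=> s1 fr1 f0.
  apply: (@wp_for _ _ _ _ _ 80 mm (fun k s' =>
    (imem s' foundV 0 = 0%N /\ forall e, (e < k)%N -> ~~ cr e) \/
    (imem s' foundV 0 = 1%N /\ [/\ (imem s' beV 0 < k)%N, cr (imem s' beV 0),
       rmem s' bkR 0 = key (imem s' beV 0) &
       forall e, (e < k)%N -> cr e -> key (imem s' beV 0) <= key e]))) => //.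
  + by move=> s2 fr2; rewrite /= (fr2.1 0%N isT) (fr2.1 jV isT) (fr1.1 0%N isT) (fr1.1 jV isT).
  + by left; split.
  + move=> k s2 km fr2 ik inv.
    have Es a : a \notin [:: ieV; foundV; beV] -> imem s2 a = imem s a.
      by rewrite !inE !negb_or => /and3P[h1 h2 h3];
         rewrite fr2.1 ?fr1.1//= !inE ?negb_or ?h1 ?h2 ?h3.
    have Er a : a != bkR -> rmem s2 a = rmem s a.
      by move=> h; rewrite fr2.2 ?fr1.2//= !inE.
    apply: wp_run => //; rewrite [run _ _]/= ik.
    rewrite (Es setA isT) (Es toA isT) (Es fromA isT).
    rewrite (Er dR isT) (Er piR isT) (Er lenR isT).
    have -> : (1 <= imem s setA (imem s toA k))%N && (imem s setA (imem s fromA k) <=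
      0)%N = cr k.
      rewrite /cr /crossing leqn0; congr (_ && _).
      by have := st1 _ km; case: (imem s setA (imem s toA k)) => [|[]].
    have keyE : rmem s dR (imem s toA k) + rmem s piR (imem s toA k) + rmem s lenR k
        - rmem s piR (imem s fromA k) = key k by [].
    rewrite keyE; case: ifP => crk; [case: ifP => upc|]; rewrite /=; simp_mem;
      rewrite /= ?ik ?(Es toA isT) ?(Es fromA isT) ?(Er dR isT) ?(Er piR isT) ?(Er lenR
        isT) ?keyE.
    - right; split=> //; split=> // e; rewrite ltnS leq_eqVlt => /predU1P[->//|ek] cre.
      case: inv => [[_ /(_ e ek)]|[f1 [be1 be2 be3 be4]]]; first by rewrite cre.
      move: upc; rewrite f1 be3 /= !negbK => upc.
      by apply: le_trans (be4 _ ek cre); rewrite leNgt; apply: contra upc; exact: ltW.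
    - case: inv => [[f0' _]|[f1 [be1 be2 be3 be4]]]; first by move: upc; rewrite f0'.
      move: upc; rewrite f1 be3 /= !negbK => /negbFE upc.
      right; split=> //; split=> //; first exact: leqW.
      by move=> e; rewrite ltnS leq_eqVlt => /predU1P[->//|]; exact: be4.
    - case: inv => [[f0' nc]|[f1 [be1 be2 be3 be4]]].
        left; split=> // e; rewrite ltnS leq_eqVlt => /predU1P[->|]; last exact: nc.
        by rewrite crk.
      right; split=> //; split=> //; first exact: leqW.
      move=> e; rewrite ltnS leq_eqVlt => /predU1P[->|]; last exact: be4.
      by rewrite crk.
- by rewrite /=; lia.
Qed.

Lemma dij_spec s zi (nn := (imem s 0 0).+1) (mm := (imem s 0 1 + imem s jV 0)%N)
   (z := imem s 0 zi) :
  (forall e, (e < mm)%N -> (imem s fromA e < nn)%N) ->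
  (forall e, (e < mm)%N -> (imem s toA e < nn)%N) -> (z < nn)%N ->
  (forall e, (e < mm)%N -> rmem s piR (imem s fromA e) <= rmem s piR (imem s toA e) +
    rmem s lenR e) ->
  wp (dij_prog zi) (300 * nn * mm.+1) s (fun s' =>
    dij_inv nn mm (imem s fromA) (imem s toA) (rmem s lenR) (rmem s piR) z nn
      (imem s' setA) (rmem s' dR) (imem s' parA) (rmem s' mvR 0)).
Proof.
move=> frn ton zn pip.
apply: (wp_seqf (c1 := (50 * nn)%N) (c2 := (250 * nn * mm.+1)%N)
    (Q1 := fun s1 => forall v, (v < nn)%N -> imem s1 setA v = 0%N)).
- apply: (@wp_for _ _ _ _ _ 4 nn (fun k s1 => forall v, (v < k)%N -> imem s1 setA v =
    0%N)) => //.
  + by move=> s1 fr1; rewrite /= (fr1.1 0%N isT) addn1.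
  + move=> k s1 kn fr1 ik IH; apply: wp_run => //; rewrite /=; simp_mem; rewrite /= ik => v.
    by case: eqP => // vk; rewrite ltnS leq_eqVlt => /predU1P[|/IH].
  + by rewrite /=; lia.
- move=> s1 fr1 z1.
  apply: (wp_seqf (c1 := 20) (c2 := (230 * nn * mm.+1)%N)
    (Q1 := fun s2 => [/\ forall v, (v < nn)%N -> imem s2 setA v = (v == z), rmem s2 dR z
      = 0 & rmem s2 mvR 0 = 0])).
  + apply: wp_run => //; rewrite /=; simp_mem; rewrite /= (fr1.1 0%N isT) -/z; split.
    * by move=> v vn; case: eqP => // _; rewrite z1.
    * by rewrite eqxx.
    * by [].
  + move=> s2 fr2 [st0 D0 M0].
    have F2 := frame_cat fr1 fr2.
    apply: (@wp_for _ _ _ _ _ (190 * mm.+1)%N nn (fun k s3 =>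
       dij_inv nn mm (imem s fromA) (imem s toA) (rmem s lenR) (rmem s piR) z k
      (imem s3 setA) (rmem s3 dR) (imem s3 parA) (rmem s3 mvR 0))) => //.
    * by move=> s3 fr3; rewrite /= (fr3.1 0%N isT) (F2.1 0%N isT) addn1.
    * rewrite /=; simp_mem; rewrite M0; exact: dij_init.
    * move=> k s3 kn fr3 ik inv.
      have F := frame_cat F2 fr3.
      have st1 e : (e < mm)%N -> (imem s3 setA (imem s toA e) <= 1)%N.
        by move=> em; apply: (dij_le1 inv); exact: ton.
      have SP := @search_spec s3.
      rewrite /= (F.1 0%N isT) (F.1 jV isT) (F.1 toA isT) (F.1 fromA isT) (F.2 lenR isT)
        (F.2 piR isT) in SP.
      apply: (wp_seqf (c2 := 40) (SP st1)) => [s4 fr4|]; last by rewrite /mm; lia.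
      have F4 := frame_cat F fr4.
      move=> [[f0 nc]|[f1 [be1 be2 be3 be4]]].
        apply: wp_run => //; rewrite [run _ _]/= f0 /=; simp_mem.
        rewrite (fr4.1 setA isT) (fr4.2 dR isT) (fr4.1 parA isT) (fr4.2 mvR isT).
        exact: dij_stop.
      apply: wp_run => //; rewrite [run _ _]/= f1 /=; simp_mem.
      rewrite /= (F4.1 fromA isT) (fr4.1 setA isT) (fr4.2 dR isT) (fr4.1 parA isT) be3.
      exact: (dij_step frn ton zn pip inv be1 be2 be4).
    * rewrite /=; nia.
  + nia.
- nia.
Qed.
End dij_spec.

(** * Distances in the residual graph *)

Section stage_math.
Variables (R : realType) (n m : nat) (N : network R n m).
Variables (x : 'I_m -> bool) (a : nat -> 'I_n) (j : nat).
Variables (fr to : nat -> nat) (len pi : nat -> R).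
Notation nn := n.+1.
Notation mm := (m + j)%N.

(* Besides the residual graph of [x], there is a vertex [n], entered by an arc of
   length 0 from each of the sources [a 0, ..., a (j - 1)] in use. *)
Record graph_repr : Prop := GraphRepr {
  repr_from : forall e : 'I_m, fr e = rfrom N x e;
  repr_to : forall e : 'I_m, to e = rto N x e;
  repr_len : forall e : 'I_m, len e = rlen N x e;
  repr_from_extra : forall i, (i < j)%N -> fr (m + i)%N = a i;
  repr_to_extra : forall i, (i < j)%N -> to (m + i)%N = n;
  repr_len_extra : forall i, (i < j)%N -> len (m + i)%N = 0 }.

Hypothesis gr : graph_repr.
Hypothesis pip : residual_potential N x (fun v => pi v).
Hypothesis pin : forall v : 'I_n, pi v <= pi n.

Lemma repr_ind (Q : nat -> Prop) : (forall e : 'I_m, Q e) ->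
  (forall i, (i < j)%N -> Q (m + i)%N) -> forall e, (e < mm)%N -> Q e.
Proof.
move=> h1 h2 e em; have [h|h] := ltnP e m; first exact: (h1 (Ordinal h)).
by rewrite -(subnKC h); apply: h2; rewrite ltn_subLR.
Qed.

Lemma repr_from_lt e : (e < mm)%N -> (fr e < n)%N.
Proof.
move: e; apply: repr_ind => [e|i ij]; first by rewrite (repr_from gr).
by rewrite (repr_from_extra gr).
Qed.

Lemma repr_to_lt e : (e < mm)%N -> (to e < nn)%N.
Proof.
move: e; apply: repr_ind => [e|i ij]; first by rewrite (repr_to gr) ltnS ltnW.
by rewrite (repr_to_extra gr).
Qed.

Lemma repr_pip e : (e < mm)%N -> pi (fr e) <= pi (to e) + len e.
Proof.
move: e; apply: repr_ind => [e|i ij]; first by rewrite (repr_from gr) (repr_to gr)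
  (repr_len gr).
by rewrite (repr_from_extra gr)// (repr_to_extra gr)// (repr_len_extra gr)// addr0.
Qed.

Section after_dij.
Variables (z : nat) (st : nat -> nat) (D : nat -> R) (par : nat -> nat) (M : R).
Hypothesis inv : dij_inv nn mm fr to len pi z nn st D par M.

Let ltO (v : 'I_n) : (v < nn)%N. Proof. by rewrite ltnS ltnW. Qed.

Lemma dij_st v : (v < nn)%N -> (st v != 1%N) = (st v == 0%N).
Proof. by move=> /(dij_le1 inv); case: (st v) => [|[]]. Qed.

Lemma dij_close (e : 'I_m) : st (rto N x e) = 1%N -> st (rfrom N x e) = 1%N.
Proof.
rewrite -(repr_from gr) -(repr_to gr); apply: (dij_closed _ (leqnn _) inv).
  by move=> e' /repr_from_lt /leqW.
by rewrite (leq_trans (ltn_ord e))// leq_addr.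
Qed.

(** No arc leads from an unsettled vertex to a settled one, and settled vertices have [D <= M], so
    all unsettled potentials may be raised by [K]. Its arbitrary size realises infinite
    distances. *)
Lemma dij_residual (K : R) : M <= K ->
  residual_potential N x (fun v => if st v == 1%N then D v + pi v else pi v + K).
Proof.
move=> MK e; have em : (e < mm)%N by rewrite (leq_trans (ltn_ord e))// leq_addr.
have pe := pip e.
have [tst|tst] := eqVneq (st (rto N x e)) 1%N.
  have fst1 := dij_close tst; rewrite fst1 eqxx.
  have := dij_arc inv em; rewrite (repr_from gr) (repr_to gr) (repr_len gr).
  exact.
have [fst1|fst0] := eqVneq (st (rfrom N x e)) 1%N; last by lra.
have /andP[_ h] := dij_D inv (ltO _) fst1; lra.
Qed.

Lemma dij_partial (c : R) :
  partial_potential N x (fun v => st v == 1%N) (fun v => D v + pi v - c).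
Proof.
move=> B; pose K := M + \sum_(v < n) `|B - (pi v - c)|.
have MK : M <= K by rewrite lerDl; apply: sumr_ge0.
exists (fun v : 'I_n => - c + (if st v == 1%N then D v + pi v else pi v + K)); split.
- apply: (@residual_shift _ _ _ N _ (fun v : 'I_n => if st v == 1%N then D v + pi v else
    pi v + K)).
  exact: dij_residual.
- by move=> v ->; rewrite addrC.
- move=> v /negbTE ->.
  have : B - (pi v - c) <= K.
    rewrite /K (bigD1 v)//=; apply: le_trans (ler_norm _) _.
    have := dij_M0 inv; have : 0 <= \sum_(i < n | i != v) `|B - (pi i - c)| by apply: sumr_ge0.
    lra.
  lra.
Qed.

End after_dij.

Section sigma_run.
Variables (st : nat -> nat) (D : nat -> R) (par : nat -> nat) (M : R).
Hypothesis inv : dij_inv nn mm fr to len pi n nn st D par M.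
Let ltO (v : 'I_n) : (v < nn)%N. Proof. by rewrite ltnS ltnW. Qed.
Let sg (v : 'I_n) : R := D v + pi v - pi n.

Lemma sigma_supply i : (i < j)%N -> (st (a i) == 1%N) && (sg (a i) <= 0).
Proof.
move=> ij; have im : (m + i < mm)%N by rewrite ltn_add2l.
have tn : st (to (m + i)%N) = 1%N by rewrite (repr_to_extra gr)// (dij_z inv).
have fn : st (fr (m + i)%N) = 1%N.
  by apply: (dij_closed _ (leqnn _) inv) => // e /repr_from_lt /leqW.
have := dij_arc inv im fn tn; rewrite (repr_from_extra gr)// (repr_to_extra gr)//.
rewrite (repr_len_extra gr)// (dij_Dz inv) add0r addr0 => h.
by move: fn; rewrite (repr_from_extra gr)// => ->; rewrite eqxx /sg /=; lra.
Qed.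

(** Parent arcs are followed up to a vertex whose parent is one of the added arcs; having length 0,
    that arc shows the vertex to be a source in use at distance 0. *)
Lemma sigma_walk (v : 'I_n) : st v == 1%N -> exists x1 i, [/\ (i < j)%N,
  forall v0, bal N x1 v0 = bal N x v0 + (v0 == v)%:R - (v0 == a i)%:R &
  flow_cost N x1 = flow_cost N x + sg v].
Proof.
move=> stv; have [rk rkP] := dij_par inv.
pose P (v : 'I_n) := st v == 1%N; pose term (v : 'I_n) := (m <= par v)%N.
have H (v' : 'I_n) : P v' -> ~~ term v' -> exists e, [/\ rfrom N x e = v', P (rto N x e),
    (rk (rto N x e) < rk v')%N & D v' + pi v' = (D (rto N x e) + pi (rto N x e)) + rlen N x e].
  move=> /eqP Pv'; rewrite -ltnNge => pm; have [_] := rkP v' (ltO v') Pv'.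
  case; first by apply/eqP; rewrite ltn_eqF.
  move=> _ f1 f2 f3 f4; exists (Ordinal pm).
  have /= E1 := repr_from gr (Ordinal pm); have /= E2 := repr_to gr (Ordinal pm).
  have /= E3 := repr_len gr (Ordinal pm).
  rewrite -E2 -E3; split=> //; last by rewrite /P -E2 f2.
  by apply: val_inj; rewrite /= -E1.
have [x1 [t [Pt tt b1 c1 _]]] := @augment_exists _ _ _ N x P term (fun v => D v + pi v)
  rk H v stv.
have [_] := rkP t (ltO t) (eqP Pt); case; first by apply/eqP; rewrite ltn_eqF.
move=> pm f1 _ _ f4.
have ij : (par t - m < j)%N by rewrite ltn_subLR.
have pE : par t = (m + (par t - m))%N by rewrite subnKC.
have tE : t = a (par t - m)%N by apply: val_inj; rewrite /= -(repr_from_extra gr ij) -pE f1.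
exists x1, (par t - m)%N; split=> //; first by move=> v0; rewrite b1 -tE.
move: f4; rewrite pE (repr_to_extra gr ij) (repr_len_extra gr ij) (dij_Dz inv) => f4.
by rewrite c1 /sg f4; ring.
Qed.

Lemma sigma_optimal A T : optimal_flow N A T x -> has_supplies N x a j ->
  (forall i, (i < j)%N -> a i != sink N) -> sink N \notin A ->
  (forall v : 'I_n, v \in A -> st v == 1%N -> 0 <= sg v) /\
  (st (sink N) == 1%N -> - sg (sink N) <= T).
Proof.
move=> opt hs aj sA.
have b1 i : (i < j)%N -> 1 <= bal N x (a i).
  move=> ij; rewrite hs ?aj// /supply_count (bigD1 (Ordinal ij))//= eqxx lerDl.
  by apply: sumr_ge0.
split.
  move=> v vA /sigma_walk [x1 [i [ij h1 h2]]].
  have vs : v != sink N by apply: contraNneq sA => <-.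
  exact: (optimal_swap opt vA vs (aj i ij) (b1 i ij) h1 h2).
move=> /sigma_walk [x1 [i [ij h1 h2]]].
exact: (optimal_from_sink opt (aj i ij) (b1 i ij) h1 h2).
Qed.

End sigma_run.

Section rho_run.
Variables (st : nat -> nat) (D : nat -> R) (par : nat -> nat) (M : R).
Hypothesis inv : dij_inv nn mm fr to len pi (sink N) nn st D par M.
Let ltO (v : 'I_n) : (v < nn)%N. Proof. by rewrite ltnS ltnW. Qed.

(** The additional vertex has no outgoing arc, so the added arcs are invisible to the search from
    the sink. *)
Lemma rho_extra : st n = 0%N.
Proof.
apply/eqP; rewrite -(dij_st inv)//; apply/eqP => h; have [rk rkP] := dij_par inv.
have [_ []] := rkP n (ltnSn n) h; first by apply/eqP; rewrite gtn_eqF.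
by move=> pm f1 _ _ _; have := repr_from_lt pm; rewrite f1 ltnn.
Qed.

Definition new_pi v := if st v == 1%N then pi v + D v else pi v + M.

Lemma new_pi_residual : residual_potential N x (fun v => new_pi v).
Proof.
by move=> e; have := dij_residual inv (lexx M) e; rewrite /new_pi !(addrC (D _)).
Qed.

Lemma new_pi_max (v : 'I_n) : new_pi v <= new_pi n.
Proof.
rewrite /new_pi rho_extra /=; have := pin v; case: eqP => [h|_]; last by lra.
by have /andP[_] := dij_D inv (ltO v) h; lra.
Qed.

Lemma rho_partial : partial_potential N x (fun v => st v == 1%N)
  (fun v => new_pi v - new_pi (sink N)).
Proof.
move=> B; have [f [f1 f2 f3]] := dij_partial inv (pi (sink N)) B.
exists f; split=> // v sv; rewrite f2// /new_pi sv (dij_z inv) eqxx (dij_Dz inv); ring.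
Qed.

Lemma rho_tree : exists rk : nat -> nat, forall v : 'I_n, st v == 1%N ->
  (rk v <= nn)%N /\
  (v != sink N -> exists e : 'I_m, [/\ par v = e, rfrom N x e = v, st (rto N x e) = 1%N,
     (rk (rto N x e) < rk v)%N & new_pi v = new_pi (rto N x e) + rlen N x e]).
Proof.
have [rk rkP] := dij_par inv; exists rk => v /eqP sv.
have [h1 h2] := rkP v (ltO v) sv; split=> // vs.
have [|pm f1 f2 f3 f4] := h2; first by move=> E; move/eqP: vs; apply; exact: val_inj.
have pm' : (par v < m)%N.
  rewrite ltnNge; apply/negP => mp.
  have ij : (par v - m < j)%N by rewrite ltn_subLR.
  have pE : par v = (m + (par v - m))%N by rewrite subnKC.
  by move: f2; rewrite pE (repr_to_extra gr ij) rho_extra.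
exists (Ordinal pm').
have /= E1 := repr_from gr (Ordinal pm'); have /= E2 := repr_to gr (Ordinal pm').
have /= E3 := repr_len gr (Ordinal pm').
rewrite -E2 -E3; split=> //; first by apply: val_inj; rewrite /= -E1.
by rewrite /new_pi sv f2 eqxx !(addrC (pi _)).
Qed.

Lemma rho_optimal A T : optimal_flow N A T x -> sink N \notin A ->
  forall v : 'I_n, v \in A -> st v == 1%N -> T < new_pi v - new_pi (sink N).
Proof.
move=> opt sA v vA sv; have vs : v != sink N by apply: contraNneq sA => <-.
have [rk rkP] := rho_tree.
have H (v' : 'I_n) : st v' == 1%N -> ~~ (v' == sink N) -> exists e, [/\ rfrom N x e = v',
  st (rto N x e) == 1%N,
    (rk (rto N x e) < rk v')%N & new_pi v' = new_pi (rto N x e) + rlen N x e].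
  by move=> Pv' v's; have [_ /(_ v's) [e [_ ? /eqP ? ? ?]]] := rkP v' Pv'; exists e.
have [x1 [t [_ /eqP tt b1 c1 _]]] := @augment_exists _ _ _ N x
   (fun v : 'I_n => st v == 1%N) (fun v => v == sink N) (fun v => new_pi v) rk H v sv.
by apply: (optimal_to_sink opt vA vs (x1 := x1)); rewrite -tt.
Qed.

End rho_run.
End stage_math.

(** * One augmentation stage *)

(** The results are copied because the run towards the sink reuses the arrays. [llR] is minus the
    distance from the sink to the sources in use, the horizon from which on the cuts of the stage
    vanish at the sink. *)
Definition sigma_prog : program := prog [:: dij_prog 0;
  For ivV pN (Cond (tor (is0 (IGet setA (iget ivV)))
                     (RLe (RGet piR pN) (RAdd (RGet dR (iget ivV)) (RGet piR (iget ivV)))))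
                (ISet okA (iget ivV) (ICst 1)) (ISet okA (iget ivV) (ICst 0)));
  iset lflagV (IGet setA pS);
  rset llR (RSub (RSub (RGet piR pN) (RGet piR pS)) (RGet dR pS))].

(** After the update, the distance of [v] to the sink is the difference of their potentials. *)
Definition rho_prog : program := prog [:: dij_prog 2;
  For ivV (IAdd pN (ICst 1)) (Cond (is1 (IGet setA (iget ivV)))
     (RSet piR (iget ivV) (RAdd (RGet piR (iget ivV)) (RGet dR (iget ivV))))
     (RSet piR (iget ivV) (RAdd (RGet piR (iget ivV)) (rget mvR))))].

Local Notation curS := (IGet srcA (iget ivV)).
Local Notation thr_expr := (RSub (RGet piR curS) (RGet piR pS)).

Definition weight_prog : program := prog [:: rset wbR (RCst 0);
  For ivV2 pN (Cond (TAnd (TAnd (is1 (IGet flagA (iget ivV2))) (is1 (IGet okA (iget ivV2))))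
       (tor (is0 (IGet setA (iget ivV2)))
            (TAnd (is1 (IGet setA curS)) (RLe (RGet piR curS) (RGet piR (iget ivV2))))))
     (rset wbR (RAdd (rget wbR) (RGet 2 (iget ivV2)))) Skip)].

Definition bound_prog : program := prog [::
  Cond (TAnd (is1 (IGet setA curS))
             (RLe (RMul (rget 0) (RSub (RMul (rget jR) thr_expr) (rget cR))) (rget wbR)))
    (rset tcR thr_expr)
    (rset tcR (RDiv (RAdd (RDiv (rget wbR) (rget 0)) (rget cR)) (rget jR)));
  Cond (TAnd (tor (is0 (iget lflagV)) (TNot (RLe (rget tcR) (rget llR))))
             (TNot (RLe (rget tcR) (rget bestR))))
    (rset bestR (rget tcR)) Skip].

Definition cand_prog : program :=
  For ivV (iget kV) (Cond (is1 (IGet okA curS)) (Seq weight_prog bound_prog) Skip).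

Local Notation nextS := (IGet srcA (IGet digA (iget jV))).

(** The walk has [n + 1] rounds, idle once the sink is reached. The cost grows by the potential
    difference, which is the length of the path. [aliveV] becomes 0 if the tuple is exhausted or its
    next source cannot reach the sink. *)
Definition augment_prog : program :=
  Cond (TAnd (ilt (iget jV) (iget dV)) (is1 (IGet setA nextS)))
    (prog [:: prog [:: iset curV nextS;
                rset cR (RAdd (rget cR) (RSub (RGet piR nextS) (RGet piR pS)))];
       For iaV (IAdd pN (ICst 1))
         (Cond (TNot (TAnd (ILe (iget curV) pS) (ILe pS (iget curV))))
           (prog [:: iset beV (IGet parA (iget curV));
              iset curV (IGet toA (iget beV));
              iset tmpV (IGet fromA (iget beV));
              ISet fromA (iget beV) (IGet toA (iget beV));
              ISet toA (iget beV) (iget tmpV);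
              RSet lenR (iget beV) (RSub (RCst 0) (RGet lenR (iget beV)))])
           Skip);
       prog [:: ISet fromA (IAdd pM (iget jV)) nextS; ISet toA (IAdd pM (iget jV)) pN;
           RSet lenR (IAdd pM (iget jV)) (RCst 0);
           rset jR (RAdd (rget jR) (RCst 1)); iset aliveV (ICst 1)]])
    (iset aliveV (ICst 0)).

Definition stage_prog : program :=
  prog [:: sigma_prog; rho_prog; cand_prog; augment_prog].

Lemma of_ordE (A : Type) (x0 : A) (n : nat) (g : 'I_n -> A) (i : 'I_n) : of_ord x0 g i = g i.
Proof. by rewrite /of_ord valK. Qed.

Section algorithm.
Variables (R : realType) (n m : nat) (N : network R n m) (w : 'I_n -> R).
Implicit Types s : state R.
Let u := capacity N.
Let d := sink_indegree N.
Let k := nb_sources N.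

Record setup s : Prop := Setup {
  setup_n : imem s 0 0 = n;
  setup_m : imem s 0 1 = m;
  setup_s : imem s 0 2 = sink N;
  setup_tail : forall e : 'I_m, imem s tailA e = etail N e;
  setup_head : forall e : 'I_m, imem s headA e = ehead N e;
  setup_flag : forall v : 'I_n, imem s flagA v = (v \in sources N);
  setup_cap : rmem s 0 0 = u;
  setup_len : forall e : 'I_m, rmem s 1 e = transit N e;
  setup_w : forall v : 'I_n, rmem s 2 v = w v;
  setup_k : imem s kV 0 = k;
  setup_d : imem s dV 0 = d;
  setup_src : forall l, (l < k)%N -> exists2 v : 'I_n, v \in sources N & imem s srcA l = v;
  setup_srcs : forall v : 'I_n, v \in sources N -> exists2 l, (l < k)%N & imem s srcA l = v }.

(** Arrays are numbered so that all data of [setup] lie below 7 among the integers and below 3 among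
    the reals. *)
Lemma setup_frame iw rw s s' : setup s -> frame iw rw s s' ->
  all (leq 7) iw -> all (leq 3) rw -> setup s'.
Proof.
move=> st [h1 h2] /allP iw7 /allP rw3.
have Ei b : (b < 7)%N -> imem s' b = imem s b.
  by move=> b7; apply: h1; apply: contraTN b7 => /iw7; rewrite -leqNgt.
have Er b : (b < 3)%N -> rmem s' b = rmem s b.
  by move=> b7; apply: h2; apply: contraTN b7 => /rw3; rewrite -leqNgt.
case: st => *; split; rewrite ?Ei ?Er//.
Qed.

(** The bound by the potential of the additional vertex is required of all vertices, so that any
    source can later be linked to it by an arc of length 0. *)
Record stage_state s (x : 'I_m -> bool) (a : nat -> 'I_n) (j : nat) : Prop := StageState {
  stage_graph : graph_repr N x a j (imem s fromA) (imem s toA) (rmem s lenR);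
  stage_pi : residual_potential N x (fun v => rmem s piR v);
  stage_pin : forall v : 'I_n, rmem s piR v <= rmem s piR n;
  stage_supplies : has_supplies N x a j;
  stage_cost : rmem s cR 0 = flow_cost N x;
  stage_j : rmem s jR 0 = j%:R }.

Section one_stage.
Variables (x : 'I_m -> bool) (a : nat -> 'I_n) (j : nat).
Hypothesis aS : forall i, a i \in sources N.

Let aj i : (i < j)%N -> a i != sink N.
Proof. by move=> _; apply: contraNneq (sink_notin_sources N) => <-. Qed.

Let sinkA (A : {set 'I_n}) : A \subset sources N -> sink N \notin A.
Proof. by move=> AS; apply: contra (sink_notin_sources N); exact: (fintype.subsetP AS). Qed.

(** The last clause is about all [A] and [T], of which the program knows nothing: it states what
    follows if the current flow happens to be optimal for them. *)
Definition sigma_post (s' : state R) (P1 : pred 'I_n) (sg : 'I_n -> R) : Prop :=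
  [/\ forall v : 'I_n, imem s' okA v = (~~ P1 v || (0 <= sg v)),
      imem s' lflagV 0 = P1 (sink N), P1 (sink N) -> rmem s' llR 0 = - sg (sink N),
      partial_potential N x P1 sg & forall i, (i < j)%N -> P1 (a i) && (sg (a i) <= 0)]
  /\ forall (A : {set 'I_n}) T, A \subset sources N -> optimal_flow N A T x ->
       (forall v, v \in A -> P1 v -> 0 <= sg v) /\ (P1 (sink N) -> - sg (sink N) <= T).

Lemma sigma_spec s : setup s -> imem s jV 0 = j -> stage_state s x a j ->
  wp sigma_prog (400 * n.+1 * (m + j).+1) s (fun s' => exists P1 sg, sigma_post s' P1 sg).
Proof.
move=> st jE ss.
have gr := stage_graph ss.
have dspec := @dij_spec R s 0.
rewrite (setup_n st) (setup_m st) jE in dspec.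
apply: (wp_seqf (c2 := (100 * n.+1 * (m + j).+1)%N) (dspec _ _ _ _)).
- by move=> e /(repr_from_lt gr) /leqW.
- by move=> e /(repr_to_lt gr).
- by [].
- by move=> e; exact: (repr_pip gr (stage_pi ss) (stage_pin ss)).
- move=> s1 fr1 inv.
  have st1 : setup s1 by exact: (setup_frame st fr1).
  pose P1 (v : 'I_n) := imem s1 setA v == 1%N.
  pose sg (v : 'I_n) : R := rmem s1 dR v + rmem s piR v - rmem s piR n.
  apply: (wp_seqf (c1 := (60 * n.+1)%N) (c2 := 30)
    (Q1 := fun s2 => forall v : 'I_n, imem s2 okA v = (~~ P1 v || (0 <= sg v)))).
  + apply: (@wp_for _ _ _ _ _ 40 n (fun i s2 => forall v : 'I_n, (v < i)%N ->
        imem s2 okA v = (~~ P1 v || (0 <= sg v)))) => //.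
    * by move=> s2 fr2; rewrite /= (fr2.1 0%N isT) (setup_n st1).
    * move=> i s2 im fr2 ii IH; apply: wp_run => //.
      have F2 := frame_cat fr1 fr2.
      rewrite [run _ _]/= ii (F2.1 0%N isT) (setup_n st) (fr2.1 setA isT) (F2.2 piR isT)
        (fr2.2 dR isT).
      set b := (~~ _).
      have bE (v : 'I_n) : v = i :> nat -> b = (~~ P1 v || (0 <= sg v)).
        move=> vi; rewrite /b -vi negb_and !negbK /P1 /sg; congr (_ || _); last by
          rewrite subr_ge0.
        by have := dij_le1 inv (v := v); rewrite ltnS => /(_ (ltnW (ltn_ord v))); case:
          (imem s1 setA v) => [|[]].
      case: ifP => hb; rewrite /=; simp_mem; rewrite /= ?ii => v; rewrite ltnS leq_eqVlt.
        case: (v =P i :> nat) => [vi _|_ /= vi]; last exact: IH.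
        by rewrite -(bE v vi) hb.
      case: (v =P i :> nat) => [vi _|_ /= vi]; last exact: IH.
      by rewrite -(bE v vi) hb.
    * by rewrite /=; nia.
    * by move=> s2 fr2 IH v; apply: IH.
  + move=> s2 fr2 okE; have F2 := frame_cat fr1 fr2.
    apply: wp_run => //; exists P1, sg; rewrite /sigma_post /=; simp_mem.
    rewrite /= (F2.1 0%N isT) (setup_s st) (setup_n st) (fr2.1 setA isT) (F2.2 piR isT)
      (fr2.2 dR isT).
    split; first split.
    * exact: okE.
    * rewrite /P1; have := dij_le1 inv (v := sink N); rewrite ltnS => /(_ (ltnW (ltn_ord _))).
      by case: (imem s1 setA (sink N)) => [|[]].
    * by move=> _; rewrite /sg; ring.
    * exact: (dij_partial gr (stage_pi ss) inv).
    * exact: (sigma_supply gr inv).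
    * move=> A T AS opt.
      exact: (sigma_optimal gr inv opt (stage_supplies ss) aj (sinkA AS)).
  + by nia.
- by nia.
Qed.

Definition rho_post (s' : state R) (P2 : pred 'I_n) : Prop :=
  let rh (v : 'I_n) : R := rmem s' piR v - rmem s' piR (sink N) in
  [/\ forall v : 'I_n, imem s' setA v = P2 v, P2 (sink N),
      partial_potential N x P2 rh, forall e, P2 (rto N x e) -> P2 (rfrom N x e) &
      exists rk : nat -> nat, forall v : 'I_n, P2 v -> (rk v <= n.+1)%N /\
        (v != sink N -> exists e : 'I_m, [/\ imem s' parA v = e, rfrom N x e = v,
          P2 (rto N x e), (rk (rto N x e) < rk v)%N
          & rmem s' piR v = rmem s' piR (rto N x e) + rlen N x e])]
  /\ forall (A : {set 'I_n}) T, A \subset sources N -> optimal_flow N A T x ->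
       forall v, v \in A -> P2 v -> T < rh v.

Lemma rho_spec s : setup s -> imem s jV 0 = j -> stage_state s x a j ->
  wp rho_prog (400 * n.+1 * (m + j).+1) s (fun s' => stage_state s' x a j /\
    exists P2, rho_post s' P2).
Proof.
move=> st jE ss.
have gr := stage_graph ss.
have dspec := @dij_spec R s 2.
rewrite (setup_n st) (setup_m st) jE (setup_s st) in dspec.
apply: (wp_seqf (c2 := (100 * n.+1 * (m + j).+1)%N) (dspec _ _ _ _)).
- by move=> e /(repr_from_lt gr) /leqW.
- by move=> e /(repr_to_lt gr).
- by rewrite ltnS ltnW.
- by move=> e; exact: (repr_pip gr (stage_pi ss) (stage_pin ss)).
- move=> s1 fr1 inv.
  have st1 : setup s1 by exact: (setup_frame st fr1).
  pose np := new_pi (rmem s piR) (imem s1 setA) (rmem s1 dR) (rmem s1 mvR 0).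
  apply: (@wp_for _ _ _ _ _ 40 n.+1 (fun i s2 => forall v,
        rmem s2 piR v = if (v < i)%N then np v else rmem s piR v)) => //.
  + by move=> s2 fr2; rewrite /= (fr2.1 0%N isT) (setup_n st1) addn1.
  + by move=> v; rewrite /= (fr1.2 piR isT).
  + move=> i s2 im fr2 ii IH; apply: wp_run => //.
    rewrite [run _ _]/= ii (fr2.1 setA isT) (fr2.2 dR isT) (fr2.2 mvR isT).
    have E : (0 < imem s1 setA i)%N = (imem s1 setA i == 1%N).
      by have := dij_le1 inv im; case: (imem s1 setA i) => [|[]].
    rewrite E.
    by case: ifP => hb; rewrite /=; simp_mem; rewrite /= => v; rewrite ltnS leq_eqVlt;
      case: (v =P i) => [->|_]; rewrite //= ?IH ?ltnn // /np /new_pi hb.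
  + by rewrite /=; nia.
  + move=> s2 fr2 IH; have F2 := frame_cat fr1 fr2.
    have piO (v : 'I_n) : rmem s2 piR v = np v by rewrite IH ltnS ltnW.
    have pin : rmem s2 piR n = np n by rewrite IH ltnSn.
    have piP : residual_potential N x (fun v => rmem s2 piR v).
      by move=> e; rewrite !piO; exact: (new_pi_residual gr (stage_pi ss) inv).
    split.
      split.
      * by rewrite (F2.1 fromA isT) (F2.1 toA isT) (F2.2 lenR isT).
      * exact: piP.
      * by move=> v; rewrite piO pin; exact: (new_pi_max gr (stage_pin ss) inv).
      * exact: (stage_supplies ss).
      * by rewrite (F2.2 cR isT) (stage_cost ss).
      * by rewrite (F2.2 jR isT) (stage_j ss).
    exists (fun v => imem s1 setA v == 1%N); split; first split.
    * move=> v; rewrite (fr2.1 setA isT); have := dij_le1 inv (v := v).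
      by rewrite ltnS => /(_ (ltnW (ltn_ord _))); case: (imem s1 setA v) => [|[]].
    * by rewrite (dij_z inv).
    * move=> B; have [f [f1 f2 f3]] := rho_partial gr (stage_pi ss) inv B.
      by exists f; split=> // v hv; rewrite f2// !piO.
    * by move=> e /eqP h; apply/eqP; exact: (dij_close gr inv).
    * have [rk rkP] := rho_tree gr inv; exists rk => v /rkP [h1 h2]; split=> //.
      move=> /h2 [e [e1 e2 e3 e4 e5]]; exists e; split=> //; last by rewrite !piO.
        by rewrite (fr2.1 parA isT).
      by rewrite e3.
    * move=> A T AS opt v vA sv; rewrite !piO.
      exact: (rho_optimal gr inv opt (sinkA AS)).
- by nia.
Qed.

End one_stage.
End algorithm.

(** * Lower bounds read off the distances *)

Section candidates.
Variables (R : realType) (n m : nat) (N : network R n m) (w : 'I_n -> R).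
Implicit Types s : state R.
Variables (P1 P2 : pred 'I_n) (sg : 'I_n -> R) (j : nat) (c : R).

Record cand_pre s : Prop := CandPre {
  cp_setup : setup N w s;
  cp_ok : forall v : 'I_n, imem s okA v = (~~ P1 v || (0 <= sg v));
  cp_set : forall v : 'I_n, imem s setA v = P2 v;
  cp_lflag : imem s lflagV 0 = P1 (sink N);
  cp_ll : P1 (sink N) -> rmem s llR 0 = - sg (sink N);
  cp_c : rmem s cR 0 = c;
  cp_j : rmem s jR 0 = j%:R }.

Let rh s (v : 'I_n) : R := rmem s piR v - rmem s piR (sink N).

Lemma cand_pre_frame iw rw s s' : cand_pre s -> frame iw rw s s' ->
  all (fun b => b \notin [:: 0; 1; 2; 3; 4; 5; 6; okA; setA; lflagV]%N) iw ->
  all (fun b => b \notin [:: 0; 1; 2; piR; llR; cR; jR]%N) rw -> cand_pre s' /\ rh s' = rh s.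
Proof.
move=> [h1 h2 h3 h4 h5 h6 h7] fr iwP rwP.
have Ei b : b \in [:: 0; 1; 2; 3; 4; 5; 6; okA; setA; lflagV]%N -> imem s' b = imem s b.
  by move=> hb; apply: fr.1; apply: contraTN hb; exact: (allP iwP).
have Er b : b \in [:: 0; 1; 2; piR; llR; cR; jR]%N -> rmem s' b = rmem s b.
  by move=> hb; apply: fr.2; apply: contraTN hb; exact: (allP rwP).
split; last by rewrite /rh (Er piR isT).
split; rewrite ?(Ei okA isT) ?(Ei setA isT) ?(Ei lflagV isT) ?(Er llR isT) ?(Er cR isT)
  ?(Er jR isT)//.
by case: h1 => *; split; rewrite ?(Ei 0%N isT) ?(Ei 1%N isT) ?(Ei 2%N isT) ?(Ei 3%N isT)
  ?(Ei 4%N isT) ?(Ei 5%N isT) ?(Ei 6%N isT) ?(Er 0%N isT) ?(Er 1%N isT) ?(Er 2%N isT).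
Qed.

Lemma weight_spec s (v : 'I_n) : cand_pre s -> imem s srcA (imem s ivV 0) = v ->
  wp weight_prog (100 * n.+1) s (fun s' =>
    rmem s' wbR 0 = threshold_weight N w P1 sg P2 (rh s) v).
Proof.
move=> cp vE.
pose G (v' : 'I_n) : R := if (v' \in sources N) && threshold_set P1 sg P2 (rh s) v v'
  then w v' else 0.
apply: (wp_seqf (c1 := 3) (c2 := (97 * n.+1)%N) (Q1 := fun s1 => rmem s1 wbR 0 = 0)).
- by apply: wp_run.
- move=> s1 fr1 w0.
  have [cp1 rh1] : cand_pre s1 /\ rh s1 = rh s by exact: cand_pre_frame fr1 _ _.
  apply: (@wp_for _ _ _ _ _ 70 n (fun i s2 => rmem s2 wbR 0 = \sum_(0 <= l < i) of_ord 0
    G l)) => //.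
  + by move=> s2 fr2; rewrite /= (fr2.1 0%N isT) (setup_n (cp_setup cp1)).
  + by rewrite big_geq.
  + move=> i s2 im fr2 ii IH; have F2 := frame_cat fr1 fr2.
    have [cp2 rh2] : cand_pre s2 /\ rh s2 = rh s by exact: cand_pre_frame F2 _ _.
    apply: wp_run => //; rewrite [run _ _]/= ii (F2.1 srcA isT) (F2.1 ivV isT) vE.
    pose vi := Ordinal im; have -> : i = vi by [].
    rewrite (setup_flag (cp_setup cp2)) (cp_ok cp2) !(cp_set cp2) (setup_w (cp_setup cp2)).
    rewrite big_nat_recr//= (of_ordE 0 G vi).
    have -> : (0 < (vi \in sources N))%N && (0 < (~~ P1 vi || (0 <= sg vi)%R))%N &&
      ~~ (~~ (P2 vi <= 0)%N && ~~ ((0 < P2 v)%N && (rmem s2 piR v <= rmem s2 piR i)))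
      = (vi \in sources N) && threshold_set P1 sg P2 (rh s) v vi.
      rewrite -rh2 /threshold_set /rh lerD2r negb_and !negbK !lt0b -andbA.
      by case: (P2 vi).
    by rewrite /G -IH; case: ifP => hb; rewrite /=; simp_mem; rewrite //= addr0.
  + by rewrite /=; nia.
  + move=> s2 fr2 ->; rewrite big_mkord /threshold_weight [RHS]big_mkcond.
    by apply: eq_bigr => l _; rewrite of_ordE.
- by nia.
Qed.

Lemma bound_spec s (v : 'I_n) : cand_pre s -> imem s srcA (imem s ivV 0) = v ->
  rmem s wbR 0 = threshold_weight N w P1 sg P2 (rh s) v ->
  let tc := candidate N w j c P1 sg P2 (rh s) v in
  wp bound_prog 200 s (fun s' => rmem s' bestR 0 =
    if (P1 (sink N) ==> (- sg (sink N) < tc)) && (rmem s bestR 0 < tc) then tc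
    else rmem s bestR 0).
Proof.
move=> cp vE wE tc.
apply: (wp_seqf (c1 := 90) (c2 := 100) (Q1 := fun s1 => rmem s1 tcR 0 = tc)) => //.
- apply: wp_run => //; rewrite [run _ _]/= vE (cp_set cp) (setup_s (cp_setup cp)).
  rewrite (setup_cap (cp_setup cp)) (cp_j cp) (cp_c cp) wE lt0b.
  by rewrite /tc /candidate -/(rh s v); case: ifP => hb; rewrite /=; simp_mem.
- move=> s1 fr1 tE.
  have [cp1 rh1] : cand_pre s1 /\ rh s1 = rh s by exact: cand_pre_frame fr1 _ _.
  apply: wp_run => //; rewrite [run _ _]/= tE (cp_lflag cp1) (fr1.2 bestR isT).
  have -> : ~~ (~~ (P1 (sink N) <= 0)%N && ~~ ~~ (tc <= rmem s1 llR 0)) = (P1 (sink N)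
    ==> (- sg (sink N) < tc)).
    rewrite negb_and !negbK; have := cp_ll cp1.
    by case: (P1 (sink N)) => [/(_ isT) ->|_] //=; rewrite -ltNge.
  by rewrite -ltNge; case: ifP => hb; rewrite /=; simp_mem; rewrite /= ?tE // (fr1.2 bestR isT).
Qed.

Definition valid_bound (b : R) := 0 <= b /\
  forall T, 0 <= T -> cut_condition N w T -> b <= T.

Lemma cand_spec s : cand_pre s -> valid_bound (rmem s bestR 0) ->
  let tc v := candidate N w j c P1 sg P2 (rh s) v in
  (forall v, v \in sources N -> ~~ P1 v || (0 <= sg v) ->
     (P1 (sink N) -> - sg (sink N) < tc v) -> 0 < tc v ->
     forall T, 0 <= T -> cut_condition N w T -> tc v <= T) ->
  wp cand_prog (400 * n.+1 * (nb_sources N).+1) s (fun s' =>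
    [/\ valid_bound (rmem s' bestR 0), rmem s bestR 0 <= rmem s' bestR 0 &
      forall v, v \in sources N -> ~~ P1 v || (0 <= sg v) ->
        (P1 (sink N) -> - sg (sink N) < tc v) -> tc v <= rmem s' bestR 0]).
Proof.
move=> cp vb tc tcv.
apply: (@wp_for _ _ _ _ _ (340 * n.+1)%N (nb_sources N) (fun i s' =>
    [/\ valid_bound (rmem s' bestR 0), rmem s bestR 0 <= rmem s' bestR 0 &
      forall l (v : 'I_n), (l < i)%N -> imem s srcA l = v -> v \in sources N -> ~~ P1 v
        || (0 <= sg v) ->
        (P1 (sink N) -> - sg (sink N) < tc v) -> tc v <= rmem s' bestR 0])) => //.
- by move=> s1 fr1; rewrite /= (fr1.1 kV isT) (setup_k (cp_setup cp)).
- move=> i s1 ik fr1 ii [vb1 le1 IH].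
  have [cp1 rh1] : cand_pre s1 /\ rh s1 = rh s by exact: cand_pre_frame fr1 _ _.
  have [v vS vE] := setup_src (cp_setup cp) ik.
  have vE1 : imem s1 srcA (imem s1 ivV 0) = v by rewrite (fr1.1 srcA isT) ii.
  apply: wp_conseq (_ : wp _ ((tcost (is1 (IGet okA curS))).+1 + (100 * n.+1 + 200)) s1
    _) _ _; last first.
    by move=> s2 fr2 h; exact: h.
    by rewrite [tcost _]/=; nia.
  apply: wp_cond; rewrite [teval _ _]/= (fr1.1 srcA isT) ii vE (cp_ok cp1) lt0b => hok;
    last first.
    apply: wp_run => //.
    rewrite /=; split=> // l v' ; rewrite ltnS leq_eqVlt.
    case/predU1P => [->|li]; last exact: IH.
    by rewrite vE => /val_inj <- _ h; case/negP: hok.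
  apply: wp_seqf (weight_spec cp1 vE1) _ (leqnn _) => s2 fr2 wE.
  have [cp2 rh2] : cand_pre s2 /\ rh s2 = rh s1 by exact: cand_pre_frame fr2 _ _.
  have vE2 : imem s2 srcA (imem s2 ivV 0) = v by rewrite (fr2.1 srcA isT) (fr2.1 ivV isT).
  rewrite -rh2 in wE.
  apply: wp_conseq (bound_spec cp2 vE2 wE) (leqnn _) _ => s3 fr3.
  rewrite rh2 rh1 -/(tc v) (fr2.2 bestR isT) /= => bE.
  have tv3 : (P1 (sink N) -> - sg (sink N) < tc v) -> tc v <= rmem s3 bestR 0.
    by move=> /implyP h; rewrite bE h /=; case: ltP.
  have [b0 bv] := vb1.
  have le13 : rmem s1 bestR 0 <= rmem s3 bestR 0.
    by rewrite bE; case: ifP => // /andP[_ /ltW].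
  split.
  + rewrite bE; case: ifP => // /andP[/implyP h1 h2].
    split; first by apply: le_trans (ltW h2).
    by apply: tcv => //; exact: le_lt_trans b0 h2.
  + exact: le_trans le13.
  + move=> l v' ; rewrite ltnS leq_eqVlt => /predU1P[->|li].
      by rewrite vE => /val_inj <- _ _; exact: tv3.
    by move=> h1 h2 h3 h4; apply: le_trans le13; exact: (IH l).
- by rewrite /=; nia.
- move=> s1 fr1 [vb1 le1 IH]; split=> // v vS.
  by have [l lk lE] := setup_srcs (cp_setup cp) vS; exact: (IH l).
Qed.

End candidates.

(** * Augmentation along a shortest path *)

Section augment.
Variables (R : realType) (n m : nat) (N : network R n m) (w : 'I_n -> R).
Hypothesis sd : supply_demand N w.
Implicit Types s : state R.
Variables (x : 'I_m -> bool) (a : nat -> 'I_n) (j : nat).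
Hypothesis aS : forall i, a i \in sources N.

(** The unit has been pushed from [a j] to [cur]. Only arcs with tails of higher rank have been
    reversed, so the parent arc of [cur] still has its direction in the tree; the last clause lets
    ranks bound the number of rounds. *)
Definition augment_inv s (rk : nat -> nat) (P2 : pred 'I_n) (i : nat) (s1 : state R) : Prop :=
  exists y (cur : 'I_n), [/\ imem s1 curV 0 = cur, P2 cur,
    graph_repr N y a j (imem s1 fromA) (imem s1 toA) (rmem s1 lenR),
    residual_potential N y (fun v => rmem s piR v) &
    [/\ forall v, bal N y v = bal N x v + (v == a j)%:R - (v == cur)%:R,
     flow_cost N y = flow_cost N x + (rmem s piR (a j) - rmem s piR cur),
     forall e, y e != x e -> (rk cur < rk (rfrom N x e))%N
     & cur != sink N -> (rk cur + i <= n.+1)%N]].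

Lemma graph_repr_flip y fr to len (e : 'I_m) :
  graph_repr N y a j fr to len ->
  graph_repr N (flip y e) a j (upd1 fr e (to e)) (upd1 to e (fr e)) (upd1 len e (- len e)).
Proof.
move=> [h1 h2 h3 h4 h5 h6].
have ne i : (m + i == e)%N = false by apply/eqP => E; have := ltn_ord e; rewrite -E; lia.
split=> [e'|e'|e'|i ij|i ij|i ij]; rewrite /upd1 ?ne; auto.
- rewrite /rfrom /flip; have [->|ee] := eqVneq e' e; rewrite ?eqxx ?val_eqE ?(negbTE ee)
    ?h1 ?h2//.
  by rewrite /rto; case: (y e).
- rewrite /rto /flip; have [->|ee] := eqVneq e' e; rewrite ?eqxx ?val_eqE ?(negbTE ee)
    ?h1 ?h2//.
  by rewrite /rfrom; case: (y e).
- rewrite /rlen /flip; have [->|ee] := eqVneq e' e; rewrite ?eqxx ?val_eqE ?(negbTE ee) ?h3//.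
  by rewrite /rlen; case: (y e); rewrite ?opprK.
Qed.

Lemma augment_spec s (P2 : pred 'I_n) : setup N w s -> imem s jV 0 = j ->
  stage_state N s x a j -> rho_post N x s P2 ->
  ((j < sink_indegree N)%N -> imem s srcA (imem s digA j) = a j) ->
  wp augment_prog (200 * n.+1) s (fun s' =>
    (imem s' aliveV 0 = 1%N /\ (j < sink_indegree N)%N /\ exists x', stage_state N s' x'
      a j.+1) \/
    (imem s' aliveV 0 = 0%N /\ ((j < sink_indegree N)%N -> ~~ P2 (a j)))).
Proof.
move=> st jE ss [[setE P2s pp cl [rk rkP]] _] bE.
apply: wp_conseq (_ : wp _ ((tcost (TAnd (ilt (iget jV) (iget dV)) (is1 (IGet setA nextS)))).+1
   + 180 * n.+1) s _) _ _; last first.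
  by move=> s' _ h; exact: h.
  by rewrite [tcost _]/=; nia.
apply: wp_cond; rewrite [teval _ _]/= jE (setup_d st) -ltnNge => hc; last first.
  apply: wp_run => //; first by rewrite [max_cost _]/=; lia.
  right; rewrite /=; simp_mem; split=> // jd.
  by move: hc; rewrite jd bE//= setE lt0b.
move: hc => /andP[jd]; rewrite bE// setE lt0b => Paj.
have ajs : a j != sink N by apply: contraNneq (sink_notin_sources N) => <-.
apply: (wp_seqf (c1 := 40) (c2 := (140 * n.+1)%N) (Q1 := fun s1 => imem s1 curV 0 = a j /\
    rmem s1 cR 0 = flow_cost N x + (rmem s piR (a j) - rmem s piR (sink N)))).
- apply: wp_run => //; rewrite /=; simp_mem; rewrite /= jE bE// (setup_s st) (stage_cost ss).
  by [].
- move=> s1 fr1 [cur1 c1].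
  apply: (wp_seqf (c1 := (90 * n.+1)%N) (c2 := 50)
      (Q1 := fun s2 => augment_inv s rk P2 n.+1 s2)).
  + apply: (@wp_for _ _ _ _ _ 60 n.+1 (augment_inv s rk P2)) => //.
    * by move=> s2 fr2; rewrite /= (fr2.1 0%N isT) (fr1.1 0%N isT) (setup_n st) addn1.
    * exists x, (a j); rewrite /= -/(imem s1); simp_mem; split=> //.
      - by rewrite (fr1.1 fromA isT) (fr1.1 toA isT) (fr1.2 lenR isT); exact: stage_graph ss.
      - exact: stage_pi ss.
      - split=> [v||e|_]; [ring|ring|by rewrite eqxx|].
        by rewrite addn0; have [] := rkP _ Paj.
    * move=> i s2 ik fr2 ii [y [cur [curE Pc gr rp [b1 b2 b3 b4]]]].
      have F2 := frame_cat fr1 fr2.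
      apply: wp_run => //; rewrite [run _ _]/= curE (F2.1 0%N isT) (setup_s st) -eqn_leq
        val_eqE.
      case: eqP => /= [cs|/eqP cs].
        by exists y, cur; split=> //; split=> //; rewrite cs eqxx.
      have [rk1 /(_ cs) [e [e1 e2 e3 e4 e5]]] := rkP cur Pc.
      have ye : y e = x e.
        by apply/eqP; apply: contraT => /b3; rewrite e2 ltnn.
      have ff : rfrom N y e = cur by rewrite /rfrom ye; exact: e2.
      have tt : rto N y e = rto N x e by rewrite /rto ye.
      have ll : rlen N y e = rlen N x e by rewrite /rlen ye.
      exists (flip y e), (rto N x e); simp_mem; rewrite /= (F2.1 parA isT) e1.
      split=> //.
      - by rewrite (repr_to gr) tt.
      - have := graph_repr_flip e gr; rewrite /upd1 => h.
        by rewrite sub0r; exact: h.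
      - by apply: residual_flip => //; rewrite ff tt ll.
      - split.
        + by move=> v; rewrite bal_flip b1 ff tt; ring.
        + by rewrite flow_cost_flip b2 ll e5; ring.
        + move=> e'; rewrite /flip; case: (e' =P e) => [-> _|_ /b3 h]; first by rewrite e2.
          exact: ltn_trans e4 h.
        + by move=> _; have := b4 cs; lia.
    * by rewrite /=; nia.
  + move=> s2 fr2 [y [cur [curE Pc gr rp [b1 b2 b3 b4]]]].
    have F2 := frame_cat fr1 fr2.
    have cs : cur = sink N.
      apply/eqP; apply: contraT => cs; have [_ /(_ cs) [e [_ _ _ e4 _]]] := rkP cur Pc.
      by have := b4 cs; lia.
    apply: wp_run => //; left; rewrite /=; simp_mem; split=> //; split=> //.
    exists y; split; rewrite /=; simp_mem; rewrite /= ?(F2.1 0%N isT) ?(F2.1 jV isT)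
      ?(F2.1 srcA isT)
       ?(F2.1 digA isT) ?(setup_m st) ?(setup_n st) ?jE ?bE//.
    * have ne (e : 'I_m) : (e == (m + j)%N :> nat) = false.
        by apply/eqP => E; have := ltn_ord e; rewrite E; lia.
      case: gr => h1 h2 h3 h4 h5 h6; split=> [e|e|e|i|i|i]; rewrite ?ne//.
      - by rewrite ltnS leq_eqVlt eqn_add2l => /predU1P[->|ij]; rewrite ?eqxx// ltn_eqF// h4.
      - by rewrite ltnS leq_eqVlt eqn_add2l => /predU1P[->|ij]; rewrite ?eqxx// ltn_eqF// h5.
      - by rewrite ltnS leq_eqVlt eqn_add2l => /predU1P[->|ij]; rewrite ?eqxx// ltn_eqF// h6.
    * by rewrite (F2.2 piR isT).
    * by move=> v; rewrite (F2.2 piR isT); exact: stage_pin ss v.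
    * move=> v vs; rewrite supply_countS b1 cs (negbTE vs) subr0 (eq_sym v).
      by rewrite (stage_supplies ss).
    * by rewrite (fr2.2 cR isT) c1 b2 cs.
    * by rewrite (F2.2 jR isT) (stage_j ss) natr1.
  + by nia.
- by nia.
Qed.

(** Completeness for one prefix of a tuple: [b] exceeds every horizon at which [A] is overloaded and
    an optimal flow has exactly these supplies. The overload is stated for all flows with these
    supplies because the stage computes one of its own. *)
Definition complete_bound (j' : nat) (b : R) : Prop :=
  forall (A : {set 'I_n}) T y, A \subset sources N -> A != finset.set0 ->
    optimal_flow N A T y -> has_supplies N y a j' ->
    (forall y', has_supplies N y' a j' ->
       capacity N * (j'%:R * T - flow_cost N y') < \sum_(v in A) w v) -> T < b.

Lemma stage_spec s : setup N w s -> imem s jV 0 = j ->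
  stage_state N s x a j -> valid_bound N w (rmem s bestR 0) ->
  (j = 0%N -> x =1 xpred0) -> (exists2 T, 0 <= T & cut_condition N w T) ->
  ((j < sink_indegree N)%N -> imem s srcA (imem s digA j) = a j) ->
  wp stage_prog (1000 * n.+1 * (m + j).+1 + 400 * n.+1 * (nb_sources N).+1) s (fun s' =>
    [/\ valid_bound N w (rmem s' bestR 0), rmem s bestR 0 <= rmem s' bestR 0,
     complete_bound j (rmem s' bestR 0) &
    (imem s' aliveV 0 = 1%N /\ (j < sink_indegree N)%N /\ exists x', stage_state N s' x'
      a j.+1) \/
    (imem s' aliveV 0 = 0%N /\ forall j' b, (j < j' <= sink_indegree N)%N ->
      complete_bound j' b)]).
Proof.
move=> st jE ss vb x0 [T0 T00 cT0] bE.
have aj i : (i < j)%N -> a i != sink N.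
  by move=> _; apply: contraNneq (sink_notin_sources N) => <-.
apply: (wp_seqf (c2 := (600 * n.+1 * (m + j).+1 + 400 * n.+1 * (nb_sources N).+1)%N)
   (sigma_spec aS st jE ss)); last by nia.
move=> s1 fr1 [P1 [sg [[ok1 lf1 ll1 pp1 sa1] opt1]]].
have st1 : setup N w s1 by exact: (setup_frame st fr1).
have jE1 : imem s1 jV 0 = j by rewrite (fr1.1 jV isT).
have ss1 : stage_state N s1 x a j.
  by case: ss => *; split; rewrite ?(fr1.1 fromA isT) ?(fr1.1 toA isT) ?(fr1.2 lenR isT)
    ?(fr1.2 piR isT) ?(fr1.2 cR isT) ?(fr1.2 jR isT).
apply: (wp_seqf (c2 := (200 * n.+1 * (m + j).+1 + 400 * n.+1 * (nb_sources N).+1)%N)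
   (rho_spec st1 jE1 ss1)); last by nia.
move=> s2 fr2 [ss2 [P2 rp2]].
have st2 : setup N w s2 by exact: (setup_frame st1 fr2).
have jE2 : imem s2 jV 0 = j by rewrite (fr2.1 jV isT).
have F2 := frame_cat fr1 fr2.
pose rh (v : 'I_n) : R := rmem s2 piR v - rmem s2 piR (sink N).
have cp : cand_pre N w P1 P2 sg j (flow_cost N x) s2.
  split=> //.
  - by move=> v; rewrite (fr2.1 okA isT) ok1.
  - by case: rp2 => [[]].
  - by rewrite (fr2.1 lflagV isT).
  - by rewrite (fr2.2 llR isT).
  - exact: stage_cost ss2.
  - exact: stage_j ss2.
have [[set2 P2s pp2 cl2 tree2] opt2] := rp2.
have vb2 : valid_bound N w (rmem s2 bestR 0) by rewrite (F2.2 bestR isT).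
have rhs : rh (sink N) = 0 by rewrite /rh subrr.
apply: (wp_seqf (c2 := (200 * n.+1)%N) (cand_spec cp vb2 _)).
- move=> v vS okv Ltc tc0 T T0' cT.
  exact: (candidate_valid sd aj (stage_supplies ss) pp1 pp2 P2s rhs sa1 vS okv Ltc tc0 T0' cT).
- move=> s3 fr3 [vb3 le3 tc3].
  have st3 : setup N w s3 by exact: (setup_frame st2 fr3).
  have jE3 : imem s3 jV 0 = j by rewrite (fr3.1 jV isT).
  have F3 := frame_cat F2 fr3.
  have ss3 : stage_state N s3 x a j.
    by case: ss2 => *; split; rewrite ?(fr3.1 fromA isT) ?(fr3.1 toA isT) ?(fr3.2 lenR isT)
      ?(fr3.2 piR isT) ?(fr3.2 cR isT) ?(fr3.2 jR isT).
  have rp3 : rho_post N x s3 P2.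
    by move: rp2; rewrite /rho_post (fr3.1 setA isT) (fr3.1 parA isT) (fr3.2 piR isT).
  have bE3 : (j < sink_indegree N)%N -> imem s3 srcA (imem s3 digA j) = a j.
    by rewrite (F3.1 srcA isT) (F3.1 digA isT).
  apply: wp_conseq (augment_spec st3 jE3 ss3 rp3 bE3) (leqnn _) _ => s4 fr4 H.
  have b4 : rmem s4 bestR 0 = rmem s3 bestR 0 by rewrite (fr4.2 bestR isT).
  rewrite b4; split=> //.
  + by rewrite -(F2.2 bestR isT).
  + move=> A T y AS A0 opty hy viol.
    have balE v : bal N x v = bal N y v.
      have [->|vs] := eqVneq v (sink N); last by rewrite hy// (stage_supplies ss).
      by rewrite !bal_sink; congr (- _); apply: eq_bigr => v' v's; rewrite hy//
        (stage_supplies ss).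
    have optx := optimal_flow_transfer opty balE (stage_pi ss).
    have [q1 q2] := opt1 A T AS optx.
    have [|v [vS okv Tv]] := @candidate_complete _ _ _ N w sd x j A T P1 sg P2 rh AS A0
       (opt2 A T AS optx) q1 _ (viol x (stage_supplies ss)).
      (* Before any augmentation the residual graph is the network itself, where feasibility lets
         every source reach the sink. *)
      move=> j0 v vA; apply: (reach_sources sd T00 cT0 P2s) => [e|]; last exact:
        (fintype.subsetP AS).
      by have := cl2 e; rewrite /rto /rfrom (x0 j0 e).
    apply: (lt_le_trans Tv); apply: tc3 => // P1s.
    exact: le_lt_trans (q2 P1s) Tv.
  + case: H => [[h1 [h2 [x' h3]]]|[h1 h2]]; [left|right].
      by split=> //; split=> //; exists x'.
    (* If [a j] cannot reach the sink, no flow has supplies extending the current ones, so longer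
       prefixes are settled vacuously. *)
    split=> // j' b /andP[jj' j'd] A T y AS A0 opty hy viol.
    have jd : (j < sink_indegree N)%N by exact: leq_trans jj' j'd.
    have Pa : P2 (a j); last by have := h2 jd; rewrite Pa.
    apply: (@reach_next R n m N x a j y P2) => //.
    * by move=> i _; apply: contraNneq (sink_notin_sources N) => <-.
    * exact: stage_supplies ss.
    * move=> v vs; rewrite hy// /supply_count (big_ord_widen j' (fun i => (a i == v)%:R :
        R) jj').
      by rewrite big_mkcond; apply: ler_sum => i _; case: ifP.
- by nia.
Qed.

End augment.

(** * Enumeration of the tuples of sources *)

Definition reset_prog : program := prog [::
  For ieV pM (prog [:: ISet fromA (iget ieV) (IGet tailA (iget ieV));
     ISet toA (iget ieV) (IGet headA (iget ieV)); RSet lenR (iget ieV) (RGet 1 (iget ieV))]);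
  For ivV (IAdd pN (ICst 1)) (RSet piR (iget ivV) (RCst 0));
  prog [:: rset cR (RCst 0); rset jR (RCst 0); iset aliveV (ICst 1)]].

Definition stages_prog : program :=
  For jV (IAdd (iget dV) (ICst 1)) (Cond (is1 (iget aliveV)) stage_prog Skip).

(** The machine cannot divide integers, so the base [k] digits of the tuple number are stored and
    incremented with carry. *)
Definition odometer_prog : program := prog [:: iset carryV (ICst 1);
  For ivV (iget dV) (Cond (is1 (iget carryV))
    (Cond (ilt (IAdd (IGet digA (iget ivV)) (ICst 1)) (iget kV))
       (prog [:: ISet digA (iget ivV) (IAdd (IGet digA (iget ivV)) (ICst 1)); iset carryV
         (ICst 0)])
       (ISet digA (iget ivV) (ICst 0)))
    Skip)].

Definition digit (k t i : nat) : nat := ((t %/ k ^ i) %% k)%N.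

Lemma digit_exists (k d : nat) (l : nat -> nat) : (forall i, (l i < k)%N) ->
  exists2 t, (t < k ^ d)%N & forall i, (i < d)%N -> digit k t i = l i.
Proof.
elim: d l => [|d IHd] l lk; first by exists 0%N.
have [t td tE] := IHd (fun i => l i.+1) (fun i => lk i.+1).
have k0 : (0 < k)%N by exact: leq_ltn_trans (lk 0%N).
exists (l 0%N + t * k)%N.
  rewrite expnSr; apply: leq_trans (_ : t.+1 * k <= _)%N; last by rewrite leq_mul2r td orbT.
  by rewrite mulSn ltn_add2r.
case=> [_|i id]; rewrite /digit.
  by rewrite expn0 divn1 addnC modnMDl modn_small.
have E : ((l 0 + t * k) %/ k = t)%N by rewrite addnC divnMDl// (divn_small (lk 0%N)) addn0.
by rewrite expnS divnMA E; exact: tE.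
Qed.

Section tuples.
Variables (R : realType) (n m : nat) (N : network R n m) (w : 'I_n -> R).
Hypothesis sd : supply_demand N w.
Hypothesis feas : exists2 T, 0 <= T & cut_condition N w T.
Implicit Types s : state R.
Let d := sink_indegree N.
Let k := nb_sources N.

Lemma reset_spec s (a : nat -> 'I_n) : setup N w s ->
  wp reset_prog (100 * (m + n.+1)) s (fun s' =>
    imem s' aliveV 0 = 1%N /\ stage_state N s' (fun=> false) a 0).
Proof.
move=> st.
apply: (wp_seqf (c1 := (40 * m.+1)%N) (c2 := (20 + 40 * n.+1)%N) (Q1 := fun s1 =>
   forall e : 'I_m, [/\ imem s1 fromA e = etail N e, imem s1 toA e = ehead N e & rmem s1
     lenR e = transit N e])).
- apply: (@wp_for _ _ _ _ _ 20 m (fun i s1 => forall e : 'I_m, (e < i)%N ->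
    [/\ imem s1 fromA e = etail N e, imem s1 toA e = ehead N e & rmem s1 lenR e = transit
      N e])) => //.
  + by move=> s1 fr1; rewrite /= (fr1.1 0%N isT) (setup_m st).
  + move=> i s1 im fr1 ii IH; have st1 := setup_frame st fr1 isT isT.
    apply: wp_run => //; rewrite /=; simp_mem; rewrite /= ii => e; rewrite ltnS leq_eqVlt.
    case: (e =P i :> nat) => [<- _|_ /IH //].
    by rewrite (setup_tail st1) (setup_head st1) (setup_len st1).
  + by rewrite /=; nia.
  + by move=> s1 fr1 IH e; apply: IH.
- move=> s1 fr1 gE; have st1 := setup_frame st fr1 isT isT.
  apply: (wp_seqf (c1 := (40 * n.+1)%N) (c2 := 20%N) (Q1 := fun s2 =>
     forall v, (v < n.+1)%N -> rmem s2 piR v = 0)).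
  + apply: (@wp_for _ _ _ _ _ 10 n.+1 (fun i s2 => forall v, (v < i)%N -> rmem s2 piR v =
      0)) => //.
    * by move=> s2 fr2; rewrite /= (fr2.1 0%N isT) (setup_n st1) addn1.
    * move=> i s2 im fr2 ii IH; apply: wp_run => //; rewrite /=; simp_mem; rewrite /= ii => v.
      by case: eqP => // vi; rewrite ltnS leq_eqVlt => /predU1P[//|/IH].
    * by rewrite /=; nia.
  + move=> s2 fr2 pE; apply: wp_run => //; rewrite /=; simp_mem; split=> //.
    have pO (v : 'I_n) : rmem s2 piR v = 0 by rewrite pE// ltnS ltnW.
    split; rewrite /=; simp_mem; rewrite /=.
    * split=> // e; have [h1 h2 h3] := gE e.
      - by rewrite (fr2.1 fromA isT).
      - by rewrite (fr2.1 toA isT).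
      - by rewrite (fr2.2 lenR isT).
    * by move=> e; rewrite !pO add0r /rlen ltW// transit_gt0.
    * by move=> v; rewrite pO pE.
    * by move=> v _; rewrite /bal /supply_count big_ord0 !big1 ?subrr.
    * by rewrite /flow_cost big1// => e _; rewrite mul0r.
    * by [].
  + by nia.
- by nia.
Qed.

Lemma stage_state_iassign s x a j i :
  stage_state N s x a j -> stage_state N (iassign s jV i) x a j.
Proof. by case=> *; split. Qed.

Lemma complete_bound_le a j b b' : b <= b' -> complete_bound N w a j b -> complete_bound
  N w a j b'.
Proof. by move=> bb h A T y h1 h2 h3 h4 h5; apply: lt_le_trans bb; exact: (h A T y). Qed.

Lemma complete_bound_ext a a' j b : (forall i, (i < j)%N -> a i = a' i) ->
  complete_bound N w a j b -> complete_bound N w a' j b.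
Proof.
move=> aa h A T y h1 h2 h3 h4 h5.
have E y' : has_supplies N y' a j <-> has_supplies N y' a' j.
  have sc v : supply_count R a j v = supply_count R a' j v.
    by apply: eq_bigr => i _; rewrite aa.
  by split=> hh v vs; rewrite hh// sc.
by apply: (h A T y) => // [|y' hy']; [exact/E|apply: h5; exact/E].
Qed.

Let S := (1000 * n.+1 * (m + d).+1 + 400 * n.+1 * k.+1)%N.

Lemma stages_spec s (a : nat -> 'I_n) : setup N w s -> (forall i, a i \in sources N) ->
  imem s aliveV 0 = 1%N -> stage_state N s (fun=> false) a 0 ->
  valid_bound N w (rmem s bestR 0) ->
  (forall i, (i < d)%N -> imem s srcA (imem s digA i) = a i) ->
  wp stages_prog (d.+1 * (S + 30) + 20) s (fun s' =>
    [/\ valid_bound N w (rmem s' bestR 0), rmem s bestR 0 <= rmem s' bestR 0 &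
      forall j, (j <= d)%N -> complete_bound N w a j (rmem s' bestR 0)]).
Proof.
move=> st aS al0 ss0 vb tE.
apply: (@wp_for _ _ _ _ _ (S + 10)%N d.+1 (fun i s1 =>
  [/\ valid_bound N w (rmem s1 bestR 0), rmem s bestR 0 <= rmem s1 bestR 0,
   forall j, (j < i)%N -> complete_bound N w a j (rmem s1 bestR 0) &
   (imem s1 aliveV 0 = 1%N /\ exists2 x, stage_state N s1 x a i & (i = 0%N -> x =1 xpred0)) \/
   (imem s1 aliveV 0 = 0%N /\ forall j, (j <= d)%N -> complete_bound N w a j (rmem s1
     bestR 0))])) => //.
- by move=> s1 fr1; rewrite /= (fr1.1 dV isT) (setup_d st) addn1.
- rewrite /=; simp_mem; split=> //; left; split=> //; exists (fun=> false) => //.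
  exact: stage_state_iassign.
- move=> i s1 id fr1 ii [vb1 le1 cb1 al1].
  have st1 := setup_frame st fr1 isT isT.
  apply: wp_conseq (_ : wp _ ((tcost (is1 (iget aliveV))).+1 + S) s1 _) _ _; last first.
    by move=> s' _ h; exact: h.
    by rewrite [tcost _]/=; lia.
  apply: wp_cond; rewrite [teval _ _]/= => al.
    case: al1 => [[al1 [x ssx x0]]|[al0' _]]; last by rewrite al0' in al.
    have bE : (i < sink_indegree N)%N -> imem s1 srcA (imem s1 digA i) = a i.
      by move=> id'; rewrite (fr1.1 srcA isT) (fr1.1 digA isT) tE.
    apply: wp_conseq (stage_spec sd aS st1 ii ssx vb1 x0 feas bE) _ _.
      rewrite /S; apply: leq_add => //; rewrite leq_mul2l ltnS leq_add2l -ltnS id orbT//.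
    move=> s2 fr2 [vb2 le2 cb2 al2]; rewrite /=; simp_mem.
    have cb2' j : (j < i.+1)%N -> complete_bound N w a j (rmem s2 bestR 0).
      rewrite ltnS leq_eqVlt => /predU1P[->//|ji].
      exact: complete_bound_le le2 (cb1 j ji).
    split=> //; first exact: le_trans le1 le2.
    case: al2 => [[h1 [_ [x' h2]]]|[h1 h2]]; [left|right]; split=> //.
      by exists x' => //; exact: stage_state_iassign.
    move=> j jd; have [ji|ij] := ltnP j i.+1; first exact: cb2'.
    by apply: h2; rewrite ij.
  apply: wp_run => //.
  rewrite /=; simp_mem; case: al1 => [[al1 _]|[al0' cb]]; first by rewrite al1 in al.
  split=> //; last by right.
  by move=> j; rewrite ltnS => ji; apply: cb; apply: leq_trans ji _; rewrite -ltnS.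
- by rewrite /=; nia.
- by move=> s1 fr1 [h1 h2 h3 _]; split=> // j jd; exact: h3.
Qed.

Hypothesis k0 : (0 < k)%N.

Lemma odometer_spec s t : setup N w s ->
  (forall i, (i < d)%N -> imem s digA i = digit k t i) ->
  wp odometer_prog (60 * d.+1) s (fun s' => forall i, (i < d)%N -> imem s' digA i = digit
    k t.+1 i).
Proof.
move=> st dE.
apply: (wp_seqf (c1 := 3) (c2 := (55 * d.+1)%N) (Q1 := fun s1 => imem s1 carryV 0 = 1%N)).
- by apply: wp_run.
- move=> s1 fr1 ca; have st1 := setup_frame st fr1 isT isT.
  (* A carry reaches digit [i] exactly when [k ^ i] divides [t.+1]. *)
  apply: (@wp_for _ _ _ _ _ 40 d (fun i s2 =>
    (forall l, (l < d)%N -> imem s2 digA l = if (l < i)%N then digit k t.+1 l else digit k t l)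
    /\ imem s2 carryV 0 = (k ^ i %| t.+1)%N)) => //.
  + by move=> s2 fr2; rewrite /= (fr2.1 dV isT) (setup_d st1).
  + rewrite /=; simp_mem; split; last by rewrite ca expn0 dvd1n.
    by move=> l ld; rewrite (fr1.1 digA isT) dE.
  + move=> i s2 id fr2 ii [dg cE]; have st2 := setup_frame st1 fr2 isT isT.
    apply: wp_run => //; rewrite [run _ _]/= ii cE lt0b (setup_k st2) dg// ltnn -/k.
    have c0 : (0 < k ^ i)%N by rewrite expn_gt0 k0.
    have dS : digit k t.+1 i = if (k ^ i %| t.+1)%N then
        (if (k ^ i.+1 %| t.+1)%N then 0%N else (digit k t i).+1) else digit k t i.
      rewrite /digit divnS//; case: ifP => hc; last by rewrite add0n.
      by rewrite add1n modnS expnS -dvdn_divRL// divnS// hc add1n.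
    have cS : (k ^ i.+1 %| t.+1)%N = (k ^ i %| t.+1)%N && (k <= (digit k t i).+1)%N.
      case: (boolP (k ^ i %| t.+1)%N) => hc /=; last first.
        by apply: contraNF hc; apply: dvdn_trans; rewrite expnS dvdn_mull.
      rewrite expnS -dvdn_divRL// divnS// hc add1n /digit.
      set q := (t %/ k ^ i)%N.
      have := ltn_pmod q k0; rewrite leq_eqVlt => /predU1P[E|lt].
        rewrite E leqnn /dvdn -add1n -modnDmr add1n E modnn; exact: eqxx.
      rewrite leqNgt lt /=; apply/negbTE; rewrite /dvdn -add1n -modnDmr add1n modn_small//.
    case: ifP => hc; rewrite hc /= in dS cS; last first.
      rewrite /=; simp_mem; rewrite cE hc cS; split=> // l ld; rewrite dg// ltnS
        (leq_eqVlt l i).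
      by case: eqP => [->|]; rewrite ?ltnn ?dS.
    rewrite addn1; case: ifP => hk; rewrite /=; simp_mem; rewrite /= ?ii.
      split; last by rewrite cS (negbTE hk).
      move=> l ld; case: eqP => [->|/eqP li]; first by rewrite ltnSn dS cS (negbTE hk).
      by rewrite dg// ltnS (leq_eqVlt l i) (negbTE li).
    move/negbFE: hk => hk; split; last by rewrite cE hc cS hk.
    move=> l ld; case: eqP => [->|/eqP li]; first by rewrite ltnSn dS cS hk.
    by rewrite dg// ltnS (leq_eqVlt l i) (negbTE li).
  + by rewrite /=; nia.
  + by move=> s2 fr2 [dg _] i id; rewrite dg// id.
- by nia.
Qed.

End tuples.

(** * The algorithm *)

Definition sources_prog : program :=
  For ivV pN (Cond (is1 (IGet flagA (iget ivV)))
    (prog [:: ISet srcA (iget kV) (iget ivV); iset kV (IAdd (iget kV) (ICst 1))]) Skip).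

Definition indegree_prog : program :=
  For ieV pM (Cond (TAnd (ILe (IGet headA (iget ieV)) pS) (ILe pS (IGet headA (iget ieV))))
    (iset dV (IAdd (iget dV) (ICst 1))) Skip).

(** Integers cannot be multiplied either: [k ^ d] is obtained by repeated addition. *)
Definition power_prog : program := prog [:: iset powV (ICst 1);
  For ivV (iget dV) (prog [:: iset qV (ICst 0);
     For ivV2 (iget kV) (iset qV (IAdd (iget qV) (iget powV)));
     iset powV (iget qV)])].

Definition main_prog : program := prog [:: sources_prog; indegree_prog; power_prog;
  For inV (iget powV) (prog [:: reset_prog; stages_prog; odometer_prog])].

(** The summands are the costs of the phases of [main_prog], with [X] for the number of tuples.
    Positive factors let the product absorb lower-order terms; [k <= m] and [k <= n] absorb [nk] and
    [dk]. *)
Lemma total_cost_bound (n m d k X : nat) :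
  (0 < n)%N -> (0 < m)%N -> (0 < d)%N -> (0 < k)%N -> (0 < X)%N ->
  (d <= m)%N -> (k <= m)%N -> (k <= n)%N ->
  (50 * n.+1 + (50 * m.+1 + (100 * d.+1 * k.+1 + (X * (
    (100 * (m + n.+1) + (d.+1 * ((1000 * n.+1 * (m + d).+1 + 400 * n.+1 * k.+1) + 30) + 20)
   + 60 * d.+1) + 30) + 30))) <= 20 * 1000 * (n * m * d * X))%N.
Proof.
move=> n0 m0 d0 k0 X0 dm km kn; set Y := (n * m * d)%N.
have nmY : (n * m <= Y)%N by rewrite leq_pmulr.
have nY : (n <= Y)%N by apply: leq_trans nmY; rewrite leq_pmulr.
have mY : (m <= Y)%N by apply: leq_trans nmY; rewrite leq_pmull.
have dY : (d <= Y)%N by rewrite leq_pmull// muln_gt0 n0.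
have dkY : (d * k <= Y)%N.
  by rewrite mulnC leq_mul2r; apply/orP; right; apply: leq_trans kn _; rewrite leq_pmulr.
have h1 : (n.+1 * (m + d).+1 <= 6 * (n * m))%N by nia.
have h2 : (n.+1 * k.+1 <= 4 * (n * m))%N by nia.
have p0 : (0 < n * m)%N by rewrite muln_gt0 n0.
have h4 : (d.+1 * k.+1 <= 4 * (d * k))%N by nia.
have h3 : (d.+1 * ((1000 * n.+1 * (m + d).+1 + 400 * n.+1 * k.+1) + 30) <= 16 * (1000 * Y))%N.
  apply: leq_trans (_ : (2 * d) * (8 * (1000 * (n * m))) <= _)%N.
    apply: leq_mul; first by lia.
    rewrite -(mulnA 1000%N) -(mulnA 400%N); move: h1 h2 p0.
    move: (n.+1 * (m + d).+1)%N (n.+1 * k.+1)%N (n * m)%N => a b p; lia.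
  by rewrite /Y; move: (n * m)%N => p; lia.
have YX : (Y <= Y * X)%N by rewrite leq_pmulr.
have Y0 : (0 < Y)%N by rewrite /Y muln_gt0 p0.
rewrite -(mulnA 100%N d.+1); clear nmY h1 h2 p0; move: h3 h4 dkY dY mY nY YX Y0.
move: (d.+1 * (1000 * n.+1 * (m + d).+1 + 400 * n.+1 * k.+1 + 30))%N.
move: (d.+1 * k.+1)%N (d * k)%N => b c; move: Y => Y a h3 h4 h5 h6 h7 h8 h9 h10.
have h : (100 * (m + n.+1) + (a + 20) + 60 * d.+1 + 30 <= 17 * (1000 * Y))%N by lia.
have hX := leq_mul (leqnn X) h.
apply: leq_trans (_ : 700 * Y + X * (17 * (1000 * Y)) <= _)%N; first by lia.
rewrite mulnCA [(X * _)%N]mulnCA (mulnC X) -(mulnA 20%N); lia.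
Qed.

(** * Correctness and running time *)

Section main.
Variables (R : realType) (n m : nat) (N : network R n m) (w : 'I_n -> R).
Hypothesis sd : supply_demand N w.
Hypothesis feas : exists T : R, feasible_horizon N w T.
Implicit Types s : state R.
Let d := sink_indegree N.
Let k := nb_sources N.
Let s0 := input_state N w.

Lemma feasible_cut_exists : exists2 T, 0 <= T & cut_condition N w T.
Proof.
by have [T FT] := feas; exists T; [case: FT|exact: feasible_cut FT].
Qed.

Lemma source_exists : exists v, v \in sources N.
Proof.
case: sd => w1 w2 w3 w4; apply: contrapT => noS.
have w0 v : v != sink N -> w v = 0.
  by move=> vs; apply: w3 => //; apply/negP => vS; apply: noS; exists v.
by move: w4; rewrite (bigD1 (sink N))//= big1 ?addr0 => [E|v /w0//]; rewrite E ltxx in w2.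
Qed.

Lemma nb_sources_gt0 : (0 < k)%N.
Proof. by apply/card_gt0P; exact: source_exists. Qed.

Lemma sink_indegree_gt0 : (0 < d)%N.
Proof.
rewrite lt0n; apply/eqP => d0; have [T T0 cT] := feasible_cut_exists.
have [v vS] := source_exists.
have noE e : ehead N e != sink N.
  by apply: contra_eqN d0 => es; rewrite /d sink_indegreeE (bigD1 e).
have /eqP vs := reach_sources sd (P := pred1 (sink N)) T0 cT (eqxx _)
  (fun e h => False_ind _ (negP (noE e) h)) vS.
by move: vS; rewrite vs (negbTE (sink_notin_sources N)).
Qed.

(** The complement of a source without outgoing edges would be closed under predecessors, against
    [reach_sources]; so the tails of the edges cover all sources. *)
Lemma nb_sources_le_edges : (k <= m)%N.
Proof.
have [T T0 cT] := feasible_cut_exists.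
have outE v : v \in sources N -> v \in [set etail N e | e in 'I_m]%SET.
  move=> vS; apply: contraT => nv.
  have vs : v != sink N by apply: contraNneq (sink_notin_sources N) => <-.
  have := @reach_sources _ _ _ N w sd (predC1 v) T T0 cT; rewrite /= eq_sym vs => /(_ isT).
  move=> /(_ _ v vS); rewrite /= eqxx; apply=> e _.
  by apply: contraNneq nv => <-; exact: imset_f.
apply: leq_trans (subset_leq_card (_ : sources N \subset [set etail N e | e in 'I_m]%SET)) _.
  by apply/fintype.subsetP.
by apply: leq_trans (leq_imset_card _ _) _; rewrite card_ord.
Qed.

Lemma nb_sources_le_nodes : (k <= n)%N.
Proof. by rewrite -[n]card_ord; exact: max_card. Qed.

Lemma sink_indegree_le_edges : (d <= m)%N.
Proof.
rewrite /d sink_indegreeE sum1_card -[m in (_ <= m)%N]card_ord; exact: max_card.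
Qed.

Lemma sources_spec : wp sources_prog (50 * n.+1) s0 (fun s =>
  [/\ imem s kV 0 = k,
   forall l, (l < k)%N -> exists2 v : 'I_n, v \in sources N & imem s srcA l = v &
   forall v : 'I_n, v \in sources N -> exists2 l, (l < k)%N & imem s srcA l = v]).
Proof.
pose G (v : 'I_n) := nat_of_bool (v \in sources N).
apply: (@wp_for _ _ _ _ _ 30 n (fun i s =>
  [/\ imem s kV 0 = (\sum_(0 <= l < i) of_ord 0 G l)%N,
   forall l, (l < imem s kV 0)%N -> exists2 v : 'I_n, v \in sources N & imem s srcA l = v &
   forall v : 'I_n, (v < i)%N -> v \in sources N -> exists2 l, (l < imem s kV 0)%N & imem
     s srcA l = v])) => //.
- by move=> s fr; rewrite /= (fr.1 0%N isT).
- by split=> //; rewrite big_geq.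
- move=> i s im fr ii [kE h1 h2]; pose vi := Ordinal im.
  apply: wp_run => //; rewrite [run _ _]/= ii (fr.1 flagA isT) /= (of_ordE _ _ vi) lt0b.
  have sE : (\sum_(0 <= l < i.+1) of_ord 0 G l = imem s kV 0 + (vi \in sources N))%N.
    by rewrite big_nat_recr//= -kE (of_ordE 0 G vi).
  rewrite sE; case: ifP => vS; rewrite /=; simp_mem; rewrite /= ?ii ?addn0.
    split=> //.
    + move=> l; rewrite addn1 ltnS leq_eqVlt; case: eqP => [-> _|_ /= lk]; last exact: h1.
      by exists vi.
    + move=> v; rewrite ltnS leq_eqVlt => /predU1P[vE _|vi' vS'].
        by exists (imem s kV 0); rewrite ?addn1// eqxx vE.
      have [l lk lE] := h2 v vi' vS'; exists l; first by rewrite addn1 ltnS ltnW.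
      by rewrite ltn_eqF.
  split=> // v; rewrite ltnS leq_eqVlt => /predU1P[vE vS'|]; last exact: h2.
  by have vv : v = vi by [apply: val_inj]; rewrite -vv vS' in vS.
- by rewrite /=; nia.
- move=> s fr [kE h1 h2].
  have kk : imem s kV 0 = k.
    rewrite kE big_mkord /k /nb_sources -sum1_card [RHS]big_mkcond; apply: eq_bigr => v _.
    by rewrite of_ordE /G; case: ifP.
  by rewrite kk in h1 h2; split=> // v vS; exact: h2.
Qed.

Lemma indegree_spec s : (forall b, (b < 4)%N -> imem s b = imem s0 b) -> imem s dV 0 = 0%N ->
  wp indegree_prog (50 * m.+1) s (fun s' => imem s' dV 0 = d).
Proof.
move=> base d0; pose G (e : 'I_m) := nat_of_bool (ehead N e == sink N).
apply: (@wp_for _ _ _ _ _ 30 m (fun i s' => imem s' dV 0 = (\sum_(0 <= l < i) of_ord 0 G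
  l)%N)) => //.
- by move=> s1 fr; rewrite /= (fr.1 0%N isT) base.
- by rewrite big_geq.
- move=> i s1 im fr ii dE; pose ei := Ordinal im.
  apply: wp_run => //; rewrite [run _ _]/= ii (fr.1 headA isT) (fr.1 0%N isT) !base//=.
  rewrite (of_ordE _ _ ei) -eqn_leq val_eqE big_nat_recr//= (of_ordE 0 G ei) -dE.
  by rewrite /G; case: ifP => _; rewrite /=; simp_mem; rewrite //= addn0.
- by rewrite /=; nia.
- move=> s1 fr ->; rewrite big_mkord /d sink_indegreeE [RHS]big_mkcond; apply: eq_bigr => e _.
  by rewrite of_ordE /G; case: ifP.
Qed.

Lemma power_spec s : imem s kV 0 = k -> imem s dV 0 = d ->
  wp power_prog (100 * d.+1 * k.+1) s (fun s' => imem s' powV 0 = (k ^ d)%N).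
Proof.
move=> kE dE.
apply: (wp_seqf (c1 := 3) (c2 := (90 * d.+1 * k.+1)%N) (Q1 := fun s1 => imem s1 powV 0 = 1%N)).
- by apply: wp_run.
- move=> s1 fr1 p1.
  apply: (@wp_for _ _ _ _ _ (60 * k.+1)%N d (fun i s2 => imem s2 powV 0 = (k ^ i)%N)) => //.
  + by move=> s2 fr2; rewrite /= (fr2.1 dV isT) (fr1.1 dV isT).
  + move=> i s2 id fr2 ii pE; have F2 := frame_cat fr1 fr2.
    apply: (wp_seqf (c1 := 3) (c2 := (55 * k.+1)%N) (Q1 := fun s3 => imem s3 qV 0 = 0%N)).
    * by apply: wp_run.
    * move=> s3 fr3 q0; have F3 := frame_cat F2 fr3.
      apply: (wp_seqf (c1 := (45 * k.+1)%N) (c2 := 10) (Q1 := fun s4 => imem s4 qV 0 = (k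
        ^ i.+1)%N)).
      - apply: (@wp_for _ _ _ _ _ 10 k (fun l s4 => imem s4 qV 0 = (l * k ^ i)%N)) => //.
        + by move=> s4 fr4; rewrite /= (fr4.1 kV isT) (F3.1 kV isT).
        + move=> l s4 lk fr4 ll qE; apply: wp_run => //; rewrite /=; simp_mem.
          by rewrite /= qE (fr4.1 powV isT) (fr3.1 powV isT) pE mulSn addnC.
        + by rewrite /=; nia.
        + by move=> s4 fr4 ->; rewrite expnS.
      - by move=> s4 fr4 qE; apply: wp_run => //; rewrite /=; simp_mem.
      - by nia.
    * by nia.
  + by rewrite /=; nia.
- by nia.
Qed.

Lemma input_setup s : (forall b, (b < 4)%N -> imem s b = imem s0 b) ->
  (forall b, (b < 3)%N -> rmem s b = rmem s0 b) ->
  imem s kV 0 = k -> imem s dV 0 = d ->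
  (forall l, (l < k)%N -> exists2 v : 'I_n, v \in sources N & imem s srcA l = v) ->
  (forall v : 'I_n, v \in sources N -> exists2 l, (l < k)%N & imem s srcA l = v) ->
  setup N w s.
Proof.
by move=> bi br h1 h2 h3 h4; split=> // [||||||||] *; rewrite ?bi ?br//= of_ordE.
Qed.

Let B := (100 * (m + n.+1) + (d.+1 * ((1000 * n.+1 * (m + d).+1 + 400 * n.+1 * k.+1) + 30) + 20)
   + 60 * d.+1)%N.

Lemma tuples_spec s : setup N w s -> imem s powV 0 = (k ^ d)%N ->
  (forall i, imem s digA i = 0%N) -> valid_bound N w (rmem s bestR 0) ->
  wp (For inV (iget powV) (prog [:: reset_prog; stages_prog; odometer_prog]))
    ((k ^ d) * (B + 30) + 30) s (fun s' => valid_bound N w (rmem s' bestR 0) /\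
      forall a j, (forall i, a i \in sources N) -> (j <= d)%N ->
        complete_bound N w a j (rmem s' bestR 0)).
Proof.
move=> st pE dig0 vb; have k0 := nb_sources_gt0.
have [v0 v0S] := source_exists.
have srcE l : exists v : 'I_n, v \in sources N /\ ((l < k)%N -> imem s srcA l = v).
  have [lk|lk] := ltnP l k; last by exists v0.
  by have [v vS vE] := setup_src st lk; exists v.
have [src srcP] := choice srcE.
pose tup t i := src (digit k t i).
have tupS t i : tup t i \in sources N by have [] := srcP (digit k t i).
apply: (@wp_for _ _ _ _ _ B (k ^ d)%N (fun t s1 => [/\ valid_bound N w (rmem s1 bestR 0),
   forall i, (i < d)%N -> imem s1 digA i = digit k t i &
   forall t' j, (t' < t)%N -> (j <= d)%N -> complete_bound N w (tup t') j (rmem s1 bestR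
     0)])) => //.
- by move=> s1 fr1; rewrite /= (fr1.1 powV isT).
- rewrite /=; simp_mem; split=> // i _; by rewrite dig0 /digit div0n mod0n.
- move=> t s1 tk fr1 ii [vb1 dg1 cb1]; have st1 := setup_frame st fr1 isT isT.
  rewrite /B -addnA.
  apply: wp_seqf (reset_spec (tup t) st1) _ (leqnn _) => s2 fr2 [al2 ss2].
  have st2 := setup_frame st1 fr2 isT isT.
  have F2 := frame_cat fr1 fr2.
  have vb2 : valid_bound N w (rmem s2 bestR 0) by rewrite (fr2.2 bestR isT).
  have tE i : (i < sink_indegree N)%N -> imem s2 srcA (imem s2 digA i) = tup t i.
    move=> id; rewrite (F2.1 srcA isT) (fr2.1 digA isT) dg1//.
    by have [_] := srcP (digit k t i); apply; rewrite ltn_mod.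
  apply: wp_seqf (stages_spec sd feasible_cut_exists st2 (tupS t) al2 ss2 vb2 tE) _ (leqnn _).
  move=> s3 fr3 [vb3 le3 cb3]; have st3 := setup_frame st2 fr3 isT isT.
  have dg3 i : (i < sink_indegree N)%N -> imem s3 digA i = digit (nb_sources N) t i.
    by move=> id; rewrite (fr3.1 digA isT) (fr2.1 digA isT) dg1.
  apply: wp_conseq (odometer_spec k0 st3 dg3) (leqnn _) _ => s4 fr4 dg4.
  rewrite /=; simp_mem; rewrite (fr4.2 bestR isT); split=> // t' j.
  rewrite ltnS leq_eqVlt => /predU1P[->|tt] jd; first exact: cb3.
  by apply: complete_bound_le (cb1 t' j tt jd); rewrite -(fr2.2 bestR isT).
- by rewrite /=; nia.
- move=> s1 fr1 [vb1 _ cb1]; split=> // a j aS jd.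
  (* Any sequence of sources agrees on its first [d] entries with an enumerated tuple, whose digits
     are the positions of these sources in the list. *)
  have lE i : exists l, (l < k)%N /\ imem s srcA l = a i.
    by have [l lk lE] := setup_srcs st (aS i); exists l.
  have [l lP] := choice lE.
  have [t tk tE] := @digit_exists k d l (fun i => (lP i).1).
  apply: complete_bound_ext (cb1 t j tk jd) => i ij.
  have id : (i < d)%N by exact: leq_trans ij jd.
  have [l1 l2] := lP i; have [_ /(_ l1)] := srcP (l i); rewrite l2 => E.
  by rewrite /tup tE//; apply: val_inj; rewrite /= -E.
Qed.

(** A cut violated at [b] itself comes with an optimal flow for its set, whose supplies begin an
    enumerated tuple, and completeness would give [b < b]. *)
Lemma complete_cut b : valid_bound N w b ->
  (forall a j, (forall i, a i \in sources N) -> (j <= d)%N -> complete_bound N w a j b) ->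
  cut_condition N w b.
Proof.
move=> [b0 _] cb; apply: contrapT => ncut.
have [A [AS A0 viol]] := violated_cut b0 ncut.
have [x opt] := optimal_flow_exists N A b.
have [v0 v0S] := source_exists.
have [a [j [jd aS aA hs]]] := supplies_exist AS v0S opt.
have := cb a j aS jd A b x AS A0 opt hs (fun y hy => viol y a j aA hy).
by rewrite ltxx.
Qed.

Lemma main_spec : wp main_prog (20 * 1000 * (n * m * d * k ^ d)) s0
  (fun s => min_feasible_horizon N w (output s)).
Proof.
have k0 := nb_sources_gt0; have d0 := sink_indegree_gt0; have km := nb_sources_le_edges.
have kn := nb_sources_le_nodes; have dm := sink_indegree_le_edges.
apply: wp_conseq (_ : wp _ (50 * n.+1 + (50 * m.+1 + (100 * d.+1 * k.+1 + ((k ^ d) * (B +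
  30) + 30)))) s0 _) _ _.
- apply: wp_seqf sources_spec _ (leqnn _) => s1 fr1 [kE src1 src2].
  have base1 b : (b < 4)%N -> imem s1 b = imem s0 b.
    by case: b => [|[|[|[|]]]]// _; apply: fr1.1.
  have dz : imem s1 dV 0 = 0%N by rewrite (fr1.1 dV isT).
  apply: wp_seqf (indegree_spec base1 dz) _ (leqnn _) => s2 fr2 dE.
  have kE2 : imem s2 kV 0 = k by rewrite (fr2.1 kV isT).
  apply: wp_seqf (power_spec kE2 dE) _ (leqnn _) => s3 fr3 pE.
  have F3 := frame_cat (frame_cat fr1 fr2) fr3.
  have st3 : setup N w s3.
    apply: input_setup.
    + by case=> [|[|[|[|]]]]// _; apply: F3.1.
    + by case=> [|[|[|]]]// _; apply: F3.2.
    + by rewrite (fr3.1 kV isT).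
    + by rewrite (fr3.1 dV isT).
    + by rewrite (fr3.1 srcA isT) (fr2.1 srcA isT).
    + by rewrite (fr3.1 srcA isT) (fr2.1 srcA isT).
  have vb3 : valid_bound N w (rmem s3 bestR 0).
    by rewrite (F3.2 bestR isT) /=; split.
  have dig3 i : imem s3 digA i = 0%N by rewrite (F3.1 digA isT).
  exact: (tuples_spec st3 pE dig3 vb3).
- have n0 : (0 < n)%N by exact: leq_trans k0 kn.
  have m0 : (0 < m)%N by exact: leq_trans k0 km.
  have X0 : (0 < k ^ d)%N by rewrite expn_gt0 k0.
  exact: total_cost_bound.
- move=> s _ [vb cb]; have cut := complete_cut vb cb; case: vb => b0 bv.
  split; first exact: cut_feasible.
  by move=> T' FT'; apply: bv; [case: FT'|exact: feasible_cut FT'].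
Qed.

End main.

Theorem theorem3 :
  exists (p : program) (C : nat),
    forall (R : realType) (n m : nat) (N : network R n m) (w : 'I_n -> R),
      supply_demand N w ->
      (exists T : R, feasible_horizon N w T) ->
      exists (t : nat) (s : state R),
        [/\ exec (input_state N w) p t s,
            (t <= C * (n * m * sink_indegree N
                         * nb_sources N ^ sink_indegree N))%N
          & min_feasible_horizon N w (output s)].
Proof.
exists main_prog, (20 * 1000)%N => R n m N w sd feas.
by have [t [s [h1 h2 h3]]] := main_spec sd feas; exists t, s.
Qed.
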